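(* Let $(R,\mathfrak m)$ be a Noetherian local ring and let $x\in\mathfrak m$ be a nonzerodivisor on $R$. Then $R$ satisfies derived $(\mathbf{rdep})$ if and only if $R/x$ satisfies derived $(\mathbf{rdep})$.
   Context: Complexes are complexes of finitely generated modules, graded homologically. For a local ring $(S,\mathfrak n,\ell)$ and an $S$-complex $X$ with injective resolution $I$ (a K-injective complex of injective modules quasi-isomorphic to $X$), $\operatorname{depth}_S(X):=\inf\{i\mid H_{-i}(\operatorname{Hom}_S(\ell,I))\ne0\}$; this agrees with the usual depth for modules. A Noetherian local ring $S$ satisfies derived $(\mathbf{rdep})$ if for all $S$-complexes $X,Y$ such that $X$, $Y$ and $X\otimes^{\mathbf L}_S Y$ have bounded homology, one has $\operatorname{depth}_S(X\otimes^{\mathbf L}_S Y)+\operatorname{depth}(S)\le\operatorname{depth}_S(X)+\operatorname{depth}_S(Y)$. *)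

(* Defs.v *)
From HB Require Import structures.
From mathcomp Require Import all_boot all_order all_algebra.
From mathcomp Require Import ring_quotient.
From mathcomp Require Import boolp classical_sets constructive_ereal.

Set Implicit Arguments.
Unset Strict Implicit.
Unset Printing Implicit Defensive.

Import Order.TTheory GRing.Theory Num.Theory.
Local Open Scope ring_scope.
Local Open Scope quotient_scope.

(* An [idealr] is a proper ideal; the unit ideal is generated by 1, so it may
   be left out here. *)
Definition noetherian (R : comNzRingType) : Prop :=
  forall I : idealr R, exists s : seq R,
    forall a : R, a \in I <->
      exists c : 'I_(size s) -> R, a = \sum_(i < size s) c i * s`_i.

Definition maximal_ideal (R : comNzRingType) (m : idealr R) : Prop :=
  forall I : idealr R, {subset m <= I} -> {subset I <= m}.

Definition local_ring (R : comNzRingType) (m : idealr R) : Prop :=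
  maximal_ideal m /\ forall m' : idealr R, maximal_ideal m' -> m' =i m.

Definition principal (R : comNzRingType) (x : R) : {pred R} :=
  fun a => `[< exists r, a = r * x >].

Section PrincipalIdeal.
Variables (R : comNzRingType) (m : idealr R) (x : R).
Hypothesis xm : x \in m.

Lemma principal_idealr_closed : idealr_closed (principal x).
Proof.
split.
- by apply/asboolP; exists 0; rewrite mul0r.
- apply/asboolP => -[r r1]; have /negP := idealr1 m; apply.
  by rewrite r1 idealMr.
- move=> a u v /asboolP[r ->] /asboolP[s ->]; apply/asboolP.
  by exists (a * r + s); rewrite mulrDl mulrA.
Qed.

(* xR, which is proper because x lies in the proper ideal m. *)
Definition principal_ideal : idealr R :=
  HB.pack (principal x) (isIdealr.Build R (principal x) principal_idealr_closed).

End PrincipalIdeal.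

Section QuotientModule.
Variables (R : comNzRingType) (I : idealr R).

Definition quot_scale (a : R) (q : {ideal_quot I}) : {ideal_quot I} :=
  \pi_({ideal_quot I}) a * q.

Fact quot_scaleA a b q : quot_scale a (quot_scale b q) = quot_scale (a * b) q.
Proof. by rewrite /quot_scale rmorphM mulrA. Qed.

Fact quot_scale1 : left_id 1 quot_scale.
Proof. by move=> q; rewrite /quot_scale rmorph1 mul1r. Qed.

Fact quot_scaleDr : right_distributive quot_scale +%R.
Proof. by move=> a p q; rewrite /quot_scale mulrDr. Qed.

Fact quot_scaleDl q : {morph quot_scale^~ q : a b / a + b}.
Proof. by move=> a b; rewrite /quot_scale rmorphD mulrDl. Qed.

HB.instance Definition _ := GRing.Zmodule_isLmodule.Build R {ideal_quot I}
  quot_scaleA quot_scale1 quot_scaleDr quot_scaleDl.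

End QuotientModule.

Definition finitely_generated (S : comNzRingType) (M : lmodType S) : Prop :=
  exists s : seq M, forall v : M,
    exists c : 'I_(size s) -> S, v = \sum_(i < size s) c i *: s`_i.

Definition injective_module (S : comNzRingType) (E : lmodType S) : Prop :=
  forall (A B : lmodType S) (u : {linear A -> B}) (g : {linear A -> E}),
    injective u -> exists h : {linear B -> E}, forall a, h (u a) = g a.

Definition projective_module (S : comNzRingType) (P : lmodType S) : Prop :=
  forall (A B : lmodType S) (u : {linear A -> B}) (g : {linear P -> B}),
    (forall b, exists a, u a = b) ->
    exists h : {linear P -> A}, forall p, u (h p) = g p.

(* Homological grading.  The differential is given between any two degrees,
   and vanishes unless it lowers the degree by one; this avoids transporting
   along equalities between degrees. *)
Record complex (S : comNzRingType) := Complex {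
  obj :> int -> lmodType S;
  diff : forall i j : int, {linear obj i -> obj j};
  diff_shape : forall i j : int, i != j + 1 -> forall v, diff i j v = 0;
  diffK : forall (i j k : int) v, diff j k (diff i j v) = 0
}.
Arguments diff {S} X i j : rename.

Record chain_map (S : comNzRingType) (X Y : complex S) := ChainMap {
  chain_fun :> forall i : int, {linear X i -> Y i};
  chain_comm : forall (i j : int) v,
    chain_fun j (diff X i j v) = diff Y i j (chain_fun i v)
}.

Section Complexes.
Variable S : comNzRingType.
Implicit Types X Y : complex S.

Definition cycle X (i : int) (v : X i) : Prop := diff X i (i - 1) v = 0.

Definition boundary X (i : int) (v : X i) : Prop :=
  exists w : X (i + 1), v = diff X (i + 1) i w.

Definition homology_zero X (i : int) : Prop :=
  forall v : X i, cycle v -> boundary v.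

Definition acyclic X : Prop := forall i, homology_zero X i.

Definition bounded_homology X : Prop :=
  exists n : nat, forall i : int, (n < `|i|)%N -> homology_zero X i.

(* The two conditions are injectivity and surjectivity of H_i(f). *)
Definition quasi_iso X Y (f : chain_map X Y) : Prop :=
  forall i : int,
    (forall v : X i, cycle v -> boundary (f i v) -> boundary v) /\
    (forall w : Y i, cycle w -> exists2 v : X i, cycle v & boundary (w - f i v)).

Definition null_homotopic X Y (f : chain_map X Y) : Prop :=
  exists h : forall i j : int, {linear X i -> Y j},
    forall (i : int) (v : X i),
      f i v = diff Y (i + 1) i (h i (i + 1) v)
            + h (i - 1) i (diff X i (i - 1) v).

(* Acyclic complexes are stable under shifts, so this amounts to the acyclicity
   of Hom(N, X); similarly for K_projective. *)
Definition K_injective X : Prop :=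
  forall N : complex S, acyclic N -> forall f : chain_map N X, null_homotopic f.

Definition K_projective X : Prop :=
  forall N : complex S, acyclic N -> forall f : chain_map X N, null_homotopic f.

Definition injective_resolution X (I : complex S) (f : chain_map X I) : Prop :=
  [/\ quasi_iso f, K_injective I & forall i, injective_module (I i)].

Definition projective_resolution X (P : complex S) (f : chain_map P X) : Prop :=
  [/\ quasi_iso f, K_projective P & forall i, projective_module (P i)].

Definition degreewise_fg X : Prop := forall i, finitely_generated (X i).

Section Stalk.
Variable M : lmodType S.

Definition stalk_obj (i : int) : lmodType S := if i == 0 then M else 'rV[S]_0.

Definition stalk_diff (i j : int) : {linear stalk_obj i -> stalk_obj j} := \0.

Fact stalk_shape (i j : int) : i != j + 1 -> forall v, stalk_diff i j v = 0.
Proof. by []. Qed.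

Fact stalk_diffK (i j k : int) v : stalk_diff j k (stalk_diff i j v) = 0.
Proof. by []. Qed.

Definition stalk : complex S := Complex stalk_shape stalk_diffK.
End Stalk.

Definition is_bilinear (U V W : lmodType S) (b : U -> V -> W) : Prop :=
  (forall u, linear (b u)) /\ (forall v, linear (b^~ v)).

(* T is the total tensor product of X and Y: its module T_n, together with the
   maps t i j n : X_i x Y_j -> T_n for i + j = n, has the universal property of
   the direct sum of all X_i (x) Y_j with i + j = n, and its differential is
   d(x (x) y) = dx (x) y + (-1)^i x (x) dy.  The values t i j n for i + j <> n
   play no role. *)
Definition is_tensor_complex X Y (T : complex S) : Prop :=
  exists t : forall i j n : int, X i -> Y j -> T n,
  [/\ forall i j n : int, i + j = n -> is_bilinear (t i j n),
      forall (i j n : int) (x : X i) (y : Y j), i + j = n ->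
        diff T n (n - 1) (t i j n x y) =
          t (i - 1) j (n - 1) (diff X i (i - 1) x) y
          + (-1) ^+ `|i|%N *: t i (j - 1) (n - 1) x (diff Y j (j - 1) y)
    & forall (n : int) (M : lmodType S) (b : forall i j : int, X i -> Y j -> M),
        (forall i j : int, i + j = n -> is_bilinear (b i j)) ->
        let factors (g : {linear T n -> M}) :=
          forall (i j : int) (x : X i) (y : Y j),
            i + j = n -> g (t i j n x y) = b i j x y in
        exists2 g, factors g & forall g', factors g' -> g' =1 g].

(* The derived tensor product is only determined up to quasi-isomorphism; Z is
   any of its representatives P (x) Y. *)
Definition is_derived_tensor X Y (Z : complex S) : Prop :=
  exists (P : complex S) (f : chain_map P X),
    projective_resolution f /\ is_tensor_complex P Y Z.

(* H_j(Hom(L, I)) <> 0, where the module L sits in degree 0, so that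
   Hom(L, I)_j = Hom(L, I_j), with differential given by composition. *)
Definition Hom_homology_neq0 (L : lmodType S) (I : complex S) (j : int) : Prop :=
  exists2 phi : {linear L -> I j},
    forall l, diff I j (j - 1) (phi l) = 0
  & ~ exists psi : {linear L -> I (j + 1)},
        forall l, phi l = diff I (j + 1) j (psi l).

(* The set whose infimum is taken does not depend on the injective resolution;
   the infimum of the empty set is +oo, and that of a set not bounded below
   is -oo. *)
Definition depth (n : idealr S) X : \bar int :=
  infimum +oo%E [set i%:E | i in [set i : int |
    exists (I : complex S) (f : chain_map X I),
      injective_resolution f /\ Hom_homology_neq0 {ideal_quot n} I (- i)]].

Definition derived_rdep : Prop :=
  noetherian S /\
  exists2 n : idealr S, local_ring n &
    forall X Y Z : complex S,
      degreewise_fg X -> degreewise_fg Y -> is_derived_tensor X Y Z ->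
      bounded_homology X -> bounded_homology Y -> bounded_homology Z ->
      (depth n Z + depth n (stalk S^o) <= depth n X + depth n Y)%E.

End Complexes.

(* Main.v *)
Require Import Defs.
From HB Require Import structures.
From mathcomp Require Import all_boot all_order all_algebra ring_quotient.
From mathcomp Require Import boolp classical_sets functions constructive_ereal.
From mathcomp Require Import zify ring.

(**
Write S = R/x.  The depth of X is the least i such that H_(-i)(Hom(G, X)) is
nonzero, where G is a projective resolution of the residue field; this makes
sense over R and over S.

A complex G of finite free S-modules lifts to one of R-modules: lift the
differential d to matrices d~ over R, write d~ d~ = x t, and take F = G~ + G~[1]
with the differential given, up to signs, by d~, x and t.  Then F -> G is a
quasi-isomorphism and F/x is an extension of G by G[1].  When G resolves the
residue field, Hom_R(F, N) = Hom_S(F/x, N) for every S-complex N, so the long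
exact sequence gives depth_R N = depth_S N (by descent along the degrees, the
homology of N being bounded).  If V has x-regular terms, then the sequence
0 -> V -> V -> V/x -> 0 gives depth_S (V/x) = depth_R V - 1, because x is null
homotopic on F.

From R to S: lift a resolution G of Y over S to Q.  Then (Q/x) (x)_S X computes
the derived tensor product of Y and X over R, and it is an extension of two
shifted copies of their derived tensor product over S.  From S to R: apply the
inequality to Q_X/x and Q_Y/x, where Q_X and Q_Y are free resolutions of X and Y;
their tensor product is (Q_X (x) Q_Y)/x.

That K-projective complexes are flat, and that tensoring with projectives is
exact, is tested by mapping into injective modules.
*)

Set Implicit Arguments.
Unset Strict Implicit.
Unset Printing Implicit Defensive.

Import Order.TTheory GRing.Theory Num.Theory.
Local Open Scope classical_set_scope.
Local Open Scope quotient_scope.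
Local Open Scope ring_scope.

(** Injective resolutions survive neither restriction to R nor reduction modulo x. This is why depth
    is read off maps out of a resolution of the residue field, and why the resolution over R is the
    lift of the one over S: the two are then linked by an explicit short exact sequence. The matrix
    t is Eisenbud's operator; it induces the connecting map, which has degree 2. So vanishing over S
    in degree n is deduced from vanishing over R in degree n and over S in degree n + 2, and bounded
    homology provides the start of this descent.

    Depths may be infinite, so no depth is ever cancelled: all comparisons are inequalities with an
    error of at most one. From R to S, the unit lost on the tensor product is recovered from depth S
    + 1 <= depth R. From S to R, all four depths move by one.

    The resolution P inside a derived tensor product is arbitrary, neither bounded nor finitely
    generated. Hence the arguments rest on K-projectivity, and P is exchanged for a free resolution
    only through chains of quasi-isomorphisms. *)

Local Notation cycle := Defs.cycle.

(** * Submodules, quotients and modules of linear maps *)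

Section LinearMaps.
Variable S : comNzRingType.
Implicit Types U V W M N : lmodType S.

Definition lin U V (f : U -> V) (f_lin : linear f) : {linear U -> V} :=
  HB.pack f (GRing.isLinear.Build S U V *:%R f f_lin).

Lemma factor_injective U V W (f : {linear U -> V}) (g : {linear W -> V}) :
  injective f -> (forall w, exists u, f u = g w) ->
  exists h : {linear W -> U}, forall w, f (h w) = g w.
Proof.
move=> fI /choice[h hE].
have hL : linear h by move=> a u v; apply: fI; rewrite linearP !hE linearP.
by exists (lin hL).
Qed.

Lemma factor_surjective U V W (f : {linear U -> V}) (g : {linear U -> W}) :
  (forall v, exists u, f u = v) -> (forall u, f u = 0 -> g u = 0) ->
  exists h : {linear V -> W}, forall u, h (f u) = g u.
Proof.
move=> /choice[s sK] fg.
have gE u v : f u = f v -> g u = g v.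
  by move=> e; apply/subr0_eq; rewrite -linearB fg // linearB e subrr.
have hL : linear (g \o s).
  by move=> a u v /=; rewrite -linearP; apply: gE; rewrite linearP !sK.
by exists (lin hL) => u /=; apply: gE.
Qed.

Definition submod M (P : M -> Prop) :=
  P 0 /\ forall a u v, P u -> P v -> P (a *: u + v).

Lemma submodE M (P : M -> Prop) : submod P ->
  [/\ P 0, forall u v, P u -> P v -> P (u + v), forall u, P u -> P (- u),
      forall a u, P u -> P (a *: u) & forall u v, P u -> P v -> P (u - v)].
Proof.
move=> [P0 PL]; split=> // [u v Pu Pv|u Pu|a u Pu|u v Pu Pv].
- by rewrite -[u]scale1r; apply: PL.
- by rewrite -scaleN1r -[X in P X]addr0; apply: PL.
- by rewrite -[X in P X]addr0; apply: PL.
- by rewrite addrC -scaleN1r; apply: PL.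
Qed.

Lemma submod_sum M (P : M -> Prop) (I : Type) (r : seq I) (F : I -> M) :
  submod P -> (forall i, P (F i)) -> P (\sum_(i <- r) F i).
Proof. by move=> /submodE[P0 PD _ _ _] PF; elim/big_ind: _. Qed.

Section Submodule.
Variables (M : lmodType S) (P : M -> Prop) (hP : submod P).

(** The proof [hP] is recorded in the type, so that the module structure can be inferred from it. *)
Definition subm := let _ := hP in {v : M | P v}.
HB.instance Definition _ := gen_eqMixin subm.
HB.instance Definition _ := gen_choiceMixin subm.

Let sv (u : subm) : M := sval u.
Let svP (u : subm) : P (sv u). Proof. exact: svalP. Qed.
Let svI : injective sv. Proof. by move=> [u Pu] [v Pv] /= uv;
  apply: eq_exist. Qed.
Let c := submodE hP.
Let zero : subm := exist _ 0 (let: And5 h _ _ _ _ := c in h).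
Let add (u v : subm) : subm :=
  exist _ (sv u + sv v) (let: And5 _ h _ _ _ := c in h _ _ (svP u) (svP v)).
Let opp (u : subm) : subm :=
  exist _ (- sv u) (let: And5 _ _ h _ _ := c in h _ (svP u)).
Let scale (a : S) (u : subm) : subm :=
  exist _ (a *: sv u) (let: And5 _ _ _ h _ := c in h a _ (svP u)).

Let addA : associative add.
Proof. by move=> u v w; apply: svI; apply: addrA. Qed.
Let addC : commutative add.
Proof. by move=> u v; apply: svI; apply: addrC. Qed.
Let add0 : left_id zero add.
Proof. by move=> u; apply: svI; apply: add0r. Qed.
Let addN : left_inverse zero opp add.
Proof. by move=> u; apply: svI; apply: addNr. Qed.
HB.instance Definition _ := GRing.isZmodule.Build subm addA addC add0 addN.

Let scaleA' a b u : scale a (scale b u) = scale (a * b) u.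
Proof. by apply: svI; apply: scalerA. Qed.
Let scale1' : left_id 1 scale.
Proof. by move=> u; apply: svI; apply: scale1r. Qed.
Let scaleDr' : right_distributive scale +%R.
Proof. by move=> a u v; apply: svI; apply: scalerDr. Qed.
Let scaleDl' u : {morph scale^~ u : a b / a + b}.
Proof. by move=> a b; apply: svI; apply: scalerDl. Qed.
HB.instance Definition _ := GRing.Zmodule_isLmodule.Build S subm
  scaleA' scale1' scaleDr' scaleDl'.

Fact subm_val_linear : linear (fun u : subm => sval u).
Proof. by []. Qed.
Definition subm_val : {linear subm -> M} := lin subm_val_linear.

Lemma subm_val_inj : injective subm_val.
Proof. exact: svI. Qed.

Lemma subm_valP u : P (subm_val u).
Proof. exact: svP. Qed.

Lemma subm_val_surj v : P v -> exists u, subm_val u = v.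
Proof. by move=> Pv; exists (exist _ v Pv). Qed.

End Submodule.

Section QuotientBySubmodule.
Variables (M : lmodType S) (P : M -> Prop) (hP : submod P).

Let cls (v : M) : M -> Prop := fun w => P (w - v).
Definition cosets := let _ := hP in {C : M -> Prop | exists v, C = cls v}.
HB.instance Definition _ := gen_eqMixin cosets.
HB.instance Definition _ := gen_choiceMixin cosets.

Let q (v : M) : cosets := exist _ (cls v) (ex_intro _ v erefl).
Let rep (C : cosets) : M := sval (cid (svalP C)).
Let repK C : q (rep C) = C.
Proof.
case: C => C eC; apply: eq_exist; rewrite /rep /=.
by case: cid.
Qed.
Let qE v w : q v = q w <-> P (v - w).
Proof.
have [P0 PD PN _ PB] := submodE hP; split=> [/(congr1 sval)/=e|Pvw].
  by rewrite -/(cls w v) -e /cls subrr.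
apply: eq_exist; apply/funext => u; apply/propext; rewrite /cls; split=> Pu.
  by rewrite -[u](subrK v) -addrA; apply: PD.
by rewrite -[u](subrK w) -addrA; apply: PD => //; rewrite -opprB; apply: PN.
Qed.
Let zero : cosets := q 0.
Let add (C D : cosets) : cosets := q (rep C + rep D).
Let opp (C : cosets) : cosets := q (- rep C).
Let scale (a : S) (C : cosets) : cosets := q (a *: rep C).
Let repP v : P (rep (q v) - v). Proof. by apply/qE; rewrite repK. Qed.
Let qD v w : add (q v) (q w) = q (v + w).
Proof.
have [_ PD _ _ _] := submodE hP.
by apply/qE; rewrite opprD addrACA; apply: PD; apply: repP.
Qed.
Let qN v : opp (q v) = q (- v).
Proof.
have [_ _ PN _ _] := submodE hP.
by apply/qE; rewrite -opprD; apply: PN; apply: repP.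
Qed.
Let qZ a v : scale a (q v) = q (a *: v).
Proof.
have [_ _ _ PZ _] := submodE hP.
by apply/qE; rewrite -scalerBr; apply: PZ; apply: repP.
Qed.
Let addA : associative add.
Proof. by move=> u v w; rewrite -[u]repK -[v]repK -[w]repK !qD addrA. Qed.
Let addC : commutative add.
Proof. by move=> u v; rewrite -[u]repK -[v]repK !qD addrC. Qed.
Let add0 : left_id zero add.
Proof. by move=> u; rewrite -[u]repK !qD add0r. Qed.
Let addN : left_inverse zero opp add.
Proof. by move=> u; rewrite -[u]repK !qN !qD addNr. Qed.
HB.instance Definition _ := GRing.isZmodule.Build cosets addA addC add0 addN.

Let scaleA' a b u : scale a (scale b u) = scale (a * b) u.
Proof. by rewrite -[u]repK !qZ scalerA. Qed.
Let scale1' : left_id 1 scale.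
Proof. by move=> u; rewrite -[u]repK !qZ scale1r. Qed.
Let scaleDr' : right_distributive scale +%R.
Proof.
move=> a u v; rewrite -[u]repK -[v]repK.
by rewrite [_ + _ in LHS]qD !qZ [RHS]qD scalerDr.
Qed.
Let scaleDl' u : {morph scale^~ u : a b / a + b}.
Proof. by move=> a b; rewrite -[u]repK !qZ [RHS]qD scalerDl. Qed.
HB.instance Definition _ := GRing.Zmodule_isLmodule.Build S cosets
  scaleA' scale1' scaleDr' scaleDl'.

Let q_linear : linear q.
Proof. by move=> a u v; rewrite -qD -qZ. Qed.
Definition coset_pi : {linear M -> cosets} := lin q_linear.

Lemma coset_pi_surj (C : cosets) : exists v, coset_pi v = C.
Proof. by exists (rep C); apply: repK. Qed.

Lemma coset_pi0 v : coset_pi v = 0 <-> P v.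
Proof. by rewrite -[v in P v]subr0; apply: qE. Qed.

Fact quotient_exists : exists (N : lmodType S) (q : {linear M -> N}),
  (forall C, exists v, q v = C) /\ forall v, q v = 0 <-> P v.
Proof. by exists cosets, coset_pi; split; [exact: coset_pi_surj | exact:
  coset_pi0]. Qed.

(** Taken from an opaque existence statement: the quotient is then known only through its
    projection, and unification never unfolds cosets. *)
Definition quom : lmodType S := sval (cid quotient_exists).
Definition quom_pi : {linear M -> quom} := sval (cid (svalP (cid
  quotient_exists))).

Lemma quom_pi_surj (C : quom) : exists v, quom_pi v = C.
Proof. exact: (svalP (cid (svalP (cid quotient_exists)))).1. Qed.

Lemma quom_pi0 v : quom_pi v = 0 <-> P v.
Proof. exact: (svalP (cid (svalP (cid quotient_exists)))).2. Qed.

End QuotientBySubmodule.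

Lemma submod_ker M N (f : {linear M -> N}) : submod (fun v => f v = 0).
Proof.
by split=> [|a u v fu fv]; rewrite ?linear0 // linearP fu fv scaler0 addr0.
Qed.

Lemma submod_image M N (f : {linear M -> N}) : submod (fun w => exists v,
  f v = w).
Proof.
split=> [|a _ _ [u <-] [v <-]]; first by exists 0; rewrite linear0.
by exists (a *: u + v); rewrite linearP.
Qed.

Fact linear_submod U V : submod (fun f : U -> V => linear f).
Proof.
split=> [a u v|a f g fL gL b u v]; first by rewrite scaler0 addr0.
rewrite /= !fctE /= fL gL !scalerDr !scalerA mulrC addrACA -!scalerA.
by [].
Qed.

Definition lhom U V : lmodType S := subm (linear_submod U V).

Definition hom_app U V (f : lhom U V) : {linear U -> V} := lin (subm_valP f).

Definition to_hom U V (f : {linear U -> V}) : lhom U V :=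
  exist _ (f : U -> V) (@linearP _ _ _ _ f).

Lemma hom_appE U V (f : {linear U -> V}) u : hom_app (to_hom f) u = f u.
Proof. by []. Qed.

Lemma hom_appP U V a (f g : lhom U V) u :
  hom_app (a *: f + g) u = a *: hom_app f u + hom_app g u.
Proof. by []. Qed.

Lemma hom_ext U V (f g : lhom U V) : hom_app f =1 hom_app g -> f = g.
Proof. by move=> fg; apply: subm_val_inj; apply/funext; apply: fg. Qed.

End LinearMaps.

(** * Enough injectives *)

Lemma subtractive_additive (U V : zmodType) (h : U -> V) :
  (forall u v, h (u - v) = h u - h v) -> forall u v, h (u + v) = h u + h v.
Proof.
move=> hB; have h0 : h 0 = 0 by rewrite -[X in h X](subrr (0 : U)) hB subrr.
by move=> u v; rewrite -[v in LHS]opprK hB -[- v]sub0r hB h0 sub0r opprK.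
Qed.

Lemma pairMz (U V : zmodType) (u : U) (v : V) (n : int) :
  (u, v) *~ n = (u *~ n, v *~ n).
Proof. by rewrite [LHS]surjective_pairing !raddfMz. Qed.

(** * Divisible abelian groups are injective *)

Section DivisibleExtension.
Variables (B D : zmodType).
Hypothesis D_div : forall (n : nat) (d : D), (0 < n)%N -> exists e, e *+ n = d.

(** Partial homomorphisms are handled through their graphs, so that extension is inclusion and
    Zorn's lemma applies to unions. *)
Let additive_graph (G : set (B * D)) :=
  [/\ G 0, forall p q, G p -> G q -> G (p - q) & forall d, G (0, d) -> d = 0].

Let graphN G p : additive_graph G -> G p -> G (- p).
Proof. by move=> [G0 GB _] Gp; rewrite -[- p]add0r; apply: GB. Qed.

Let graphD G p q : additive_graph G -> G p -> G q -> G (p + q).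
Proof.
by move=> hG Gp Gq; rewrite -[q]opprK; case: (hG) => _ GB _; apply: GB => //;
  apply: graphN.
Qed.

Let graphMn G p n : additive_graph G -> G p -> G (p *+ n).
Proof.
move=> hG Gp; elim: n => [|n IHn]; first by rewrite mulr0n; case: hG.
by rewrite mulrS; apply: graphD.
Qed.

Let graphMz G p (n : int) : additive_graph G -> G p -> G (p *~ n).
Proof.
move=> hG Gp; case: n => n; first exact: graphMn.
by rewrite NegzE mulrNz; apply: graphN => //; apply: graphMn.
Qed.

(** The integers [k] for which [k b] lies in the domain form an ideal, generated by its least
    positive element [m] if there is one. Dividing the value at [m b] by [m] gives a value at [b]
    compatible with the whole graph. *)
Let graph_extend (G : set (B * D)) (b : B) : additive_graph G ->
  exists2 G', additive_graph G' /\ G `<=` G' & exists e, G' (b, e).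
Proof.
move=> hG; have [G0 GB GF] := hG.
pose mult (k : int) := exists d, G (b *~ k, d).
have multB k l : mult k -> mult l -> mult (k - l).
  by move=> [d Gd] [e Ge]; exists (d - e); rewrite mulrzBr; apply: GB Gd Ge.
have mult0 : mult 0 by exists 0; rewrite mulr0z.
have multMz k l : mult k -> mult (k * l).
  move=> [d Gd]; exists (d *~ l); rewrite mulrzA.
  by have := graphMz l hG Gd; rewrite pairMz.
have [e eP] : exists e, forall k d, G (b *~ k, d) -> d = e *~ k.
  have [[n [n0 [d0 Gd0]]]|none] := pselect (exists n : nat, (0 < n)%N /\
    mult n%:Z).
    have ex : exists n : nat, (0 < n)%N && `[< mult n%:Z >].
      by exists n; rewrite n0; apply/asboolP; exists d0.
    case: (ex_minnP ex) => m /andP[m0 /asboolP [d Gd]] mmin.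
    have [e eE] := D_div d m0; exists e => k d' Gd'.
    have kr : (k %% m)%Z = 0.
      apply/eqP; rewrite -[_ == _]negbK; apply/negP => r0.
      have := mmin `|(k %% m)%Z|%N; rewrite absz_gt0 r0 /=.
      have r_ge : (0 <= (k %% m)%Z) by apply: modz_ge0; lia.
      have r_lt : ((k %% m)%Z < m%:Z) by apply: ltz_pmod; lia.
      have -> : `[< mult `|(k %% m)%Z|%N%:Z >].
        apply/asboolP; rewrite gez0_abs //; have ->
          : (k %% m)%Z = k - (k %/ m)%Z * m by lia.
        by apply: multB; [exists d' | rewrite mulrC; apply: multMz; exists d].
      by move=> /(_ isT); lia.
    have kE : k = m%:Z * (k %/ m)%Z by rewrite {1}(divz_eq k m) kr addr0 mulrC.
    have Gd2 := graphMz (k %/ m)%Z hG Gd.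
    have -> : e *~ k = d *~ (k %/ m)%Z.
      by rewrite -eE -[e *+ m]/(e *~ m%:Z) -mulrzA -kE.
    apply/subr0_eq/GF; have := GB _ _ Gd' Gd2.
    rewrite pairMz -mulrzA -kE [X in G X]surjective_pairing /= subrr //.
  (* Here no positive multiple of [b] lies in the domain, so any value is compatible. *)
  exists 0 => k d Gd; rewrite mul0rz; have [k0|k0] := eqVneq k 0.
    by move: Gd; rewrite k0 mulr0z; apply: GF.
  case: none; exists `|k|%N; split; first by rewrite absz_gt0.
  case: k Gd {k0} => n Gd; first by exists d.
  rewrite NegzE abszN; have := multB _ _ mult0 (ex_intro _ d Gd : mult (Negz
    n)).
  by rewrite sub0r NegzE opprK.
(* The graph generated by [G] and [(b, e)]. *)
exists [set p | exists k d, G (p.1 - b *~ k, d) /\ p.2 = d + e *~ k].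
  split; last by move=> [c d] Gcd; exists 0, d; rewrite /= !mulr0z subr0 addr0.
  split.
  - by exists 0, 0; rewrite /= !mulr0z subrr addr0.
  - move=> [b1 d1] [b2 d2] [k1 [c1 [/= G1 ->]]] [k2 [c2 [/= G2 ->]]].
    exists (k1 - k2), (c1 - c2); split=> /=; last by rewrite mulrzBr addrACA
      -opprD.
    have := GB _ _ G1 G2; congr G; congr (_, _).
    by rewrite /= mulrzBr !opprD !opprK addrACA.
  - move=> d [k [c [/=]]]; rewrite sub0r => Gc ->.
    rewrite -mulrNz in Gc; rewrite (eP _ _ Gc) mulrNz addNr //.
by exists e, 1, 0; rewrite /= !mulr1z subrr add0r.
Qed.

Lemma divisible_extension (G : set (B * D)) :
  G 0 -> (forall p q, G p -> G q -> G (p - q)) -> (forall d, G (0, d) ->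
    d = 0) ->
  exists h : B -> D, (forall u v, h (u - v) = h u - h v) /\
                     forall b d, G (b, d) -> h b = d.
Proof.
move=> G0 GB GF; have hG : additive_graph G by split.
pose P X := X = set0 \/ (additive_graph X /\ G `<=` X).
have [F FP Ftot|A [PA Amax]] := @Zorn_bigcup _ P.
  have [none|] := pselect (forall X, F X -> X = set0).
    left; apply/seteqP; split=> // p [X FX]; by rewrite (none X FX).
  move=> /existsNP[X0 /not_implyP[FX0 X0n]].
  have gX X p : F X -> X p -> additive_graph X /\ G `<=` X.
    by move=> FX Xp; case: (FP X FX) => // X_0; rewrite X_0 in Xp.
  have [hX0 GX0] : additive_graph X0 /\ G `<=` X0 by case: (FP X0 FX0).
  right; split; last by move=> p Gp; exists X0 => //; apply: GX0.
  split.
  - by exists X0 => //; case: hX0.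
  - move=> p q [X FX Xp] [Y FY Yq].
    have [XY|YX] := Ftot X Y FX FY.
      by exists Y => //; have [[_ h _] _] := gX _ _ FY Yq; apply: h => //;
        apply: XY.
    by exists X => //; have [[_ h _] _] := gX _ _ FX Xp; apply: h => //;
      apply: YX.
  - by move=> d [X FX Xd]; have [[_ _ h] _] := gX _ _ FX Xd; apply: h.
have [hA GA] : additive_graph A /\ G `<=` A.
  case: PA => // A0; case: (Amax G); last by right; split.
  by rewrite A0; split=> // /(_ 0 G0).
have tot b : exists d, A (b, d).
  have [G' [hG' AG'] [e G'e]] := graph_extend b hA.
  exists e; apply: contrapT => nAe; apply: (Amax G').
    by split=> // /(_ _ G'e).
  by right; split=> // p Gp; apply: AG'; apply: GA.
have [h hE] := choice tot; have [A0 AB AF] := hA.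
have hU b d : A (b, d) -> h b = d.
  by move=> Ad; apply/subr0_eq/AF; have := AB _ _ (hE b) Ad;
    rewrite -[0](subrr b).
exists h; split=> [u v|b d /GA]; last exact: hU.
by apply: hU; apply: AB (hE u) (hE v).
Qed.

End DivisibleExtension.

Section FormalSums.
Variables (Z : comNzRingType) (A : choiceType).

(** A list of terms stands for a formal sum; collecting equal basis elements shows that its value
    depends only on the total coefficients. *)
Lemma partition_terms (V : lmodType Z) (f : A -> V) (s : seq (Z * A)) :
  \sum_(p <- s) p.1 *: f p.2 =
  \sum_(a <- undup [seq p.2 | p <- s]) (\sum_(p <- s | p.2 == a) p.1) *: f a.
Proof.
under [RHS]eq_bigr do rewrite scaler_suml big_mkcond.
rewrite exchange_big /=; apply: eq_big_seq => p ps.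
rewrite (bigD1_seq p.2) ?undup_uniq ?mem_undup ?map_f //= eqxx.
by rewrite big1 ?addr0 // => a; rewrite eq_sym => /negbTE ->.
Qed.

Lemma sum_terms_eq0 (V : lmodType Z) (f : A -> V) (s : seq (Z * A)) :
  (forall a, \sum_(p <- s | p.2 == a) p.1 = 0) -> \sum_(p <- s) p.1 *: f p.2 =
    0.
Proof. by move=> s0; rewrite partition_terms big1 // => a _;
  rewrite s0 scale0r. Qed.

End FormalSums.

Section DivisibleHull.
Variable M : zmodType.

(* [M] is the quotient of the free group [Z^(M)] by its relations, and the
   quotient of [rat^M] by these same relations is divisible. *)
Let relation (f : zmodule (M -> rat)) := exists2 s : seq (int * M),
  forall v, f v = \sum_(p <- s | p.2 == v) p.1%:~R & \sum_(p <- s) p.2 *~ p.1 =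
    0.

Let zmod_funE (f : zmodule (M -> rat)) (a : int) v : (a *: f) v = f v *~ a.
Proof.
have fMn n : (f *+ n : M -> rat) v = f v *+ n.
  by elim: n => [|n IHn]; rewrite ?mulr0n // !mulrS -IHn.
rewrite scalezrE; case: a => n; first exact: fMn.
by rewrite NegzE !mulrNz; exact: (congr1 -%R (fMn n.+1)).
Qed.

Let relation_submod : submod relation.
Proof.
split=> [|a f g [s fE s0] [t gE t0]].
  by exists [::] => [v|]; rewrite !big_nil.
exists ([seq (a * p.1, p.2) | p <- s] ++ t) => [v|].
  rewrite big_cat big_map /= -gE; congr (_ + _);
    rewrite zmod_funE fE mulrz_suml.
  by apply: eq_bigr => p _; rewrite [in RHS]mulrC mulrzA.
rewrite big_cat big_map /= t0 addr0.
transitivity ((\sum_(p <- s) p.2 *~ p.1) *~ a); last by rewrite s0 mul0rz.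
rewrite mulrz_suml; by apply: eq_bigr => p _; rewrite mulrC mulrzA.
Qed.

Definition divisible_hull : lmodType int := quom relation_submod.

Lemma divisible_hull_div (n : nat) (d : divisible_hull) :
  (0 < n)%N -> exists e, e *+ n = d.
Proof.
move=> n0; have [f <-] := quom_pi_surj d.
exists (quom_pi relation_submod (fun v => f v / n%:R)).
rewrite -raddfMn; congr (quom_pi _ _); apply/funext => v.
have -> : ((fun w => f w / n%:R) : zmodule (M -> rat)) *+ n = n%:Z *: ((fun w
  => f w / n%:R) : zmodule (M -> rat)).
  by rewrite scalezrE.
rewrite zmod_funE [LHS]/(_ *+ n) -[LHS]mulr_natr divfK //.
by rewrite pnatr_eq0 -lt0n.
Qed.

Let delta (v : M) : zmodule (M -> rat) := fun w => (v == w)%:R.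
Definition hull_map (v : M) : divisible_hull := quom_pi relation_submod (delta
  v).

Lemma hull_mapB u v : hull_map (u - v) = hull_map u - hull_map v.
Proof.
apply/subr0_eq; rewrite /hull_map.
have -> : forall a b c, quom_pi relation_submod a -
  (quom_pi relation_submod b - quom_pi relation_submod c) =
  quom_pi relation_submod (a - (b - c)) by move=> a b c; rewrite !linearB.
apply/quom_pi0.
exists [:: (1, u - v); (-1, u); (1, v)] => [w|].
  rewrite !big_cons big_nil /=.
  rewrite [LHS](_ : _ = (u - v == w)%:R - ((u == w)%:R - (v == w)%:R)) //.
  by do 3!case: (_ == w); rewrite /= ?mulr1z ?mulrN1z; ring.
by rewrite !big_cons big_nil /= !mulr1z mulrN1z addr0 addrACA subrr addNr addr0.
Qed.

(** If the delta function at [v] is a relation, the list witnessing it has total coefficient 1 at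
    [v] and 0 elsewhere; so its value, which is zero, is [v]. *)
Lemma hull_map_inj v : hull_map v = 0 -> v = 0.
Proof.
move/quom_pi0 => [s sE s0].
have : \sum_(p <- (-1, v) :: s) p.1 *: (p.2 : zmodule M) = 0.
  apply: (@sum_terms_eq0 int M (zmodule M) id) => w; have := sE w;
    rewrite big_cons /= => e.
  apply/eqP; rewrite -(intr_eq0 rat); apply/eqP; move: e; rewrite /delta.
  by case: (v == w) => e; rewrite ?rmorphD rmorph_sum /= -e ?subrr ?addNr.
by rewrite big_cons /= scaleN1r s0 addr0 => /eqP; rewrite oppr_eq0 => /eqP.
Qed.

End DivisibleHull.

(** * Coinduced modules Hom_Z(R, D) *)

Section Coinduced.
Variables (R : comNzRingType) (D : lmodType int).

Let add_fun (f : R -> D) := forall u v, f (u - v) = f u - f v.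
Let add_fun_submod : submod add_fun.
Proof.
split=> [u v|a f g fA gA u v]; first by rewrite subrr.
by rewrite !fctE fA gA scalerBr opprD addrACA.
Qed.

Definition coinduced : Type := subm add_fun_submod.
HB.instance Definition _ := GRing.Zmodule.on coinduced.

Let ap (f : coinduced) : R -> D := subm_val add_fun_submod f.
Let apB f u v : ap f (u - v) = ap f u - ap f v.
Proof. exact: (subm_valP f). Qed.
Let apD f u v : ap f (u + v) = ap f u + ap f v.
Proof. exact/subtractive_additive/apB. Qed.
Let apI f g : ap f =1 ap g -> f = g.
Proof. by move=> fg; apply: subm_val_inj; apply/funext. Qed.
Let mk (f : R -> D) (fA : add_fun f) : coinduced := exist _ f fA.

Let scale_add (a : R) (f : coinduced) : add_fun (fun r => ap f (r * a)).
Proof. by move=> u v; rewrite mulrBl apB. Qed.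
Let scale (a : R) (f : coinduced) : coinduced := mk (scale_add a f).
Let scaleA' a b f : scale a (scale b f) = scale (a * b) f.
Proof. by apply: apI => r; rewrite /ap /= mulrA. Qed.
Let scale1' : left_id 1 scale.
Proof. by move=> f; apply: apI => r; rewrite /ap /= mulr1. Qed.
Let scaleDr' : right_distributive scale +%R.
Proof. by move=> a f g; apply: apI. Qed.
Let scaleDl' f : {morph scale^~ f : a b / a + b}.
Proof. by move=> a b; apply: apI => r; rewrite [LHS]/(ap f _) mulrDr [LHS]apD.
  Qed.
HB.instance Definition _ := GRing.Zmodule_isLmodule.Build R coinduced
  scaleA' scale1' scaleDr' scaleDl'.

(** Evaluation at 1 identifies [R]-linear maps to the coinduced module with additive maps to [D],
    and these extend because [D] is divisible. *)
Lemma coinduced_injective :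
  (forall (n : nat) (d : D), (0 < n)%N -> exists e, e *+ n = d) ->
  injective_module coinduced.
Proof.
move=> D_div A B u g uI.
pose G : set (B * D) := [set p | exists a, p = (u a, ap (g a) 1)].
have [|_ _ [a ->] [b ->]|d [a]|h [hB hG]] := divisible_extension D_div (G := G).
- by exists 0; rewrite !linear0.
- by exists (a - b); rewrite !linearB.
- by move=> [/esym/eqP]; rewrite raddf_eq0 // => /eqP -> ->; rewrite linear0.
have Hadd b : add_fun (fun r => h (r *: b)) by move=> r s; rewrite scalerBl hB.
have hD := subtractive_additive hB.
have HL : linear (fun b => mk (Hadd b)).
  move=> c v w; apply: apI => r.
  by rewrite /ap /= scalerDr scalerA hD.
exists (lin HL) => a; apply: apI => r.
rewrite /ap /= -linearZ (hG _ (ap (g (r *: a)) 1)); last by exists (r *: a).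
by rewrite linearZ /= /ap /= mul1r.
Qed.

Lemma coinduced_embedding (M : lmodType R) (j : M -> D) :
  (forall u v, j (u - v) = j u - j v) -> (forall v, j v = 0 -> v = 0) ->
  exists f : {linear M -> coinduced}, injective f.
Proof.
move=> jB j0; have jA v : add_fun (fun r => j (r *: v)).
  by move=> r s; rewrite scalerBl jB.
have jD := subtractive_additive jB.
have fL : linear (fun v => mk (jA v)).
  by move=> c v w; apply: apI => r; rewrite /ap /= scalerDr scalerA jD.
exists (lin fL); apply: raddf_inj => v /(congr1 (fun f => ap f 1)).
by rewrite /ap /= scale1r; apply: j0.
Qed.

End Coinduced.

Theorem enough_injectives (R : comNzRingType) (M : lmodType R) :
  exists (E : lmodType R) (f : {linear M -> E}), injective_module E /\
    injective f.
Proof.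
have [f fI] := @coinduced_embedding R (divisible_hull M) M (@hull_map M)
  (@hull_mapB M) (@hull_map_inj M).
exists (coinduced R (divisible_hull M)), f; split=> //.
exact/coinduced_injective/divisible_hull_div.
Qed.

(** * Complexes and homotopies *)

Section Complexes.
Variable S : comNzRingType.
Implicit Types (X Y A B C N P I F : complex S) (n e i j k : int).

Definition lcomp (U V W : lmodType S) (g : {linear V -> W}) (f : {linear U ->
  V})
  : {linear U -> W} := g \o f.
Definition ladd (U V : lmodType S) (f g : {linear U -> V}) : {linear U -> V} :=
  f \+ g.
Fact lscale_linear (U V : lmodType S) (a : S) (f : {linear U -> V}) :
  linear (fun u => a *: f u).
Proof. by move=> b u v; rewrite linearP scalerDr !scalerA mulrC. Qed.
Definition lscale (U V : lmodType S) (a : S) (f : {linear U -> V}) :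
  {linear U -> V} := lin (lscale_linear a f).
Fact lpair_linear (U V W : lmodType S) (f : {linear U -> V}) (g : {linear U ->
  W}) :
  linear (fun u => (f u, g u)).
Proof. by move=> a u v; rewrite !linearP. Qed.
Definition lpair (U V W : lmodType S) (f : {linear U -> V}) (g : {linear U ->
  W}) :
  {linear U -> (V * W)%type} := lin (lpair_linear f g).
Definition lzero (U V : lmodType S) : {linear U -> V} := \0.

(** Transport along [i = j], extended by zero: it is a linear map for all degrees, and no equality
    proof appears in terms. *)
Definition cast X i j : {linear X i -> X j} :=
  match i =P j with
  | ReflectT e => eq_rect i (fun k => {linear X i -> X k}) idfun j e
  | ReflectF _ => lzero (X i) (X j)
  end.

Lemma castxx X i v : cast X i i v = v.
Proof. by rewrite /cast; case: eqP => // e; rewrite eq_axiomK. Qed.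

Lemma cast_neq X i j v : i != j -> cast X i j v = 0.
Proof. by rewrite /cast; case: eqP. Qed.

Lemma diff_cast X i j k v : i = j -> diff X j k (cast X i j v) = diff X i k v.
Proof. by move=> <-; rewrite castxx. Qed.

Lemma cast_diff X i j k v : j = k -> cast X j k (diff X i j v) = diff X i k v.
Proof. by move=> <-; rewrite castxx. Qed.

Lemma cast_trans X i j k v : i = j -> cast X j k (cast X i j v) = cast X i k v.
Proof. by move=> <-; rewrite castxx. Qed.

Lemma cast_section X (f : forall i, X i) i j : i = j -> cast X i j (f i) = f j.
Proof. by move=> <-; rewrite castxx. Qed.

Lemma cycleE X i (v : X i) : cycle v <-> forall j, diff X i j v = 0.
Proof.
split=> [cv j|]; last exact.
have [e|/diff_shape->//] := eqVneq i (j + 1).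
by have -> : j = i - 1 by lia.
Qed.

Lemma cycle_diff X i j v : cycle (diff X i j v).
Proof. exact: diffK. Qed.

Lemma boundary0 X i : boundary (0 : X i).
Proof. by exists 0; rewrite linear0. Qed.

Lemma boundary_diff X i j v : boundary (diff X i j v).
Proof.
have [e|/diff_shape->] := eqVneq i (j + 1); last exact: boundary0.
by exists (cast X i (j + 1) v); rewrite diff_cast.
Qed.

Lemma submod_cycle X i : submod (@cycle S X i).
Proof. exact: submod_ker. Qed.

Lemma submod_boundary X i : submod (@boundary S X i).
Proof.
split=> [|a _ _ [u ->] [v ->]]; first exact: boundary0.
by exists (a *: u + v); rewrite linearP.
Qed.

Lemma cycle_chain X Y (f : chain_map X Y) i (v : X i) : cycle v ->
  cycle (f i v).
Proof. by rewrite /cycle -chain_comm => ->; rewrite linear0. Qed.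

Lemma boundary_chain X Y (f : chain_map X Y) i (v : X i) :
  boundary v -> boundary (f i v).
Proof. by move=> [w ->]; rewrite chain_comm; exists (f (i + 1) w). Qed.

Lemma homology_zero_quasi_iso X Y (f : chain_map X Y) i :
  quasi_iso f -> homology_zero X i <-> homology_zero Y i.
Proof.
move=> /(_ i)[fI fS]; split=> [X0 w cw|Y0 v cv]; last exact/fI/Y0/cycle_chain.
have [v cv] := fS w cw; have /(boundary_chain f) := X0 v cv => bv bw.
rewrite -[w](subrK (f i v)).
by have [_ D _ _ _] := submodE (submod_boundary Y i); apply: D.
Qed.

Fact id_comm X i j v : idfun (diff X i j v) = diff X i j (idfun v).
Proof. by []. Qed.
Definition id_map X : chain_map X X := ChainMap (chain_fun := fun _ =>
  idfun) (@id_comm X).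

Fact comp_comm X Y A (g : chain_map Y A) (f : chain_map X Y) i j v :
  lcomp (g j) (f j) (diff X i j v) = diff A i j (lcomp (g i) (f i) v).
Proof. by rewrite /= !chain_comm. Qed.
Definition comp_map X Y A (g : chain_map Y A) (f : chain_map X Y) : chain_map X
  A :=
  ChainMap (comp_comm g f).

Lemma quasi_iso_id X : quasi_iso (id_map X).
Proof.
move=> i; split=> // w cw; exists w => //=.
by rewrite subrr; apply: boundary0.
Qed.

Lemma quasi_iso_comp X Y A (g : chain_map Y A) (f : chain_map X Y) :
  quasi_iso g -> quasi_iso f -> quasi_iso (comp_map g f).
Proof.
move=> gq fq i; have [gI gS] := gq i; have [fI fS] := fq i; split=> [v cv|w cw].
  by move/(gI _ (cycle_chain f cv)); apply: fI.
have [u cu bu] := gS w cw; have [v cv bv] := fS u cu; exists v => //=.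
have [_ D _ _ _] := submodE (submod_boundary A i).
rewrite -[w](subrK (g i u)) -addrA -linearB; apply: D => //.
exact: boundary_chain.
Qed.

Fact shift_shape n X i j : i != j + 1 -> forall v, diff X (i + n) (j + n) v = 0.
Proof. by move=> ij v; apply: diff_shape; apply: contraNneq ij => e; apply/eqP;
  lia. Qed.
Fact shift_diffK n X i j k v :
  diff X (j + n) (k + n) (diff X (i + n) (j + n) v) = 0.
Proof. exact: diffK. Qed.
(** The differential carries no sign, so chain maps to [shift n B] are the chain maps of degree [n]
    that commute with the differentials on the nose. *)
Definition shift n X : complex S :=
  @Complex S (fun i => X (i + n)) _ (@shift_shape n X) (@shift_diffK n X).

Lemma acyclic_shift n X : acyclic X -> acyclic (shift n X).
Proof.
move=> Xa i v cv.
have [|w ->] := Xa _ v; last first.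
  by exists (cast X _ (i + 1 + n) w); rewrite /= diff_cast //; lia.
rewrite /cycle; have -> : i + n - 1 = (i - 1) + n by lia.
exact: cv.
Qed.

Definition hmap A B := forall i j, {linear A i -> B j}.

(* Chain maps of degree n, without the sign (-1)^n; only the components f i j
   with j = i + n matter. *)
Definition is_chain n A B (f : hmap A B) := forall i j i' j' v,
  j = i + n -> i = i' + 1 -> j = j' + 1 ->
  diff B j j' (f i j v) = f i' j' (diff A i i' v).

(** Neighbouring degrees are variables tied by equations, so no element needs to be transported. The
    plus sign is right for every [n] because chain maps commute without sign. *)
Definition null_by n A B (f h : hmap A B) := forall i j i' j' v,
  j = i + n -> i = i' + 1 -> j' = j + 1 ->
  f i j v = diff B j' j (h i j' v) + h i' j (diff A i i' v).

Definition is_null n A B (f : hmap A B) := exists h, null_by n f h.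

(* H_n(Hom(A, B)) = 0 *)
Definition homvan A B n := forall f : hmap A B, is_chain n f -> is_null n f.

Definition sg i : S := (-1) ^+ `|i|%N.

Lemma sgS i j : i = j + 1 -> sg i = - sg j.
Proof.
rewrite /sg => ->; rewrite -[LHS]signr_odd -[in RHS]signr_odd.
have -> : odd `|(j + 1)%R| = ~~ odd `|j| by lia.
by case: odd; rewrite ?opprK.
Qed.

Lemma sgK i : sg i * sg i = 1.
Proof. by rewrite -expr2 -exprM mulnC exprM sqrrN !expr1n. Qed.

Lemma sgZK (M : lmodType S) i (v : M) : sg i *: (sg i *: v) = v.
Proof. by rewrite scalerA sgK scale1r. Qed.

Lemma chain_of_hmap n A B (f : hmap A B) : is_chain n f ->
  exists g : chain_map A (shift n B), forall i v, g i v = f i (i + n) v.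
Proof.
move=> fc; have gC i j v :
    f j (j + n) (diff A i j v) = diff (shift n B) i j (f i (i + n) v).
  have [e|ij] := eqVneq i (j + 1); last by rewrite !diff_shape ?linear0.
  by rewrite /=; symmetry; apply: fc; lia.
by exists (@ChainMap S A (shift n B) (fun i => f i (i + n)) gC).
Qed.

Lemma null_of_shift n A B (f : hmap A B) (g : chain_map A (shift n B)) :
  (forall i v, g i v = f i (i + n) v) -> null_homotopic g -> is_null n f.
Proof.
move=> gE [h hE].
exists (fun i j => lcomp (cast B (j - n + n) j) (h i (j - n))).
move=> i j i' j' v -> e -> /=; have -> : i' = i - 1 by lia.
rewrite -gE hE /= diff_cast; last lia.
have -> : i + n + 1 - n = i + 1 by lia.
have -> : i + n - n = i by lia.
by rewrite castxx.
Qed.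

Lemma kproj_homvan P N n : K_projective P -> acyclic N -> homvan P N n.
Proof.
move=> Pk Na f /chain_of_hmap[g gE].
exact/(null_of_shift gE)/Pk/acyclic_shift.
Qed.

(** The shift is put on the acyclic source, since [I] has to remain the target. *)
Lemma kinj_homvan N I n : K_injective I -> acyclic N -> homvan N I n.
Proof.
move=> Ik Na f fc; have gC i j (v : shift (- n) N i) :
    f (j - n) j (diff (shift (- n) N) i j v) = diff I i j (f (i - n) i v).
  have [e|ij] := eqVneq i (j + 1); last by rewrite !diff_shape ?linear0.
  by rewrite /=; symmetry; apply: fc; lia.
have [h hE] := Ik _ (@acyclic_shift (- n) N Na)
  (@ChainMap S (shift (- n) N) I (fun i => f (i - n) i) gC).
exists (fun i j => lcomp (h (i + n) j) (cast N i (i + n - n))).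
move=> i j i' j' v -> e -> /=; have -> : i' = i - 1 by lia.
have e1 : i + n - n = i by lia.
have := hE (i + n) (cast N i (i + n - n) v); rewrite /= => e2.
have {}e2 : f i (i + n) v = f (i + n - n) (i + n) (cast N i (i + n - n) v).
  by rewrite e1 castxx.
rewrite e2 hE /=; congr (_ + _).
rewrite diff_cast // cast_diff; last lia.
by have -> : i + n - 1 = i - 1 + n by lia.
Qed.

End Complexes.

(** * Mapping cones *)

Section Cone.
Variable S : comNzRingType.
Variables (A B : complex S) (g : chain_map A B).

Let cone_obj (i : int) : lmodType S := (B i * A (i - 1)%R)%type.
Let cone_fun (i j : int) (w : cone_obj i) : cone_obj j :=
  (diff B i j w.1 + g j (cast A (i - 1) j w.2), - diff A (i - 1) (j - 1) w.2).

Let cone_linear i j : linear (@cone_fun i j).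
Proof.
move=> a [b v] [c u]; rewrite /cone_fun /= !linearP; congr (_, _) => /=.
  by rewrite scalerDr addrACA.
Qed.
Let cone_diff i j : {linear cone_obj i -> cone_obj j} := lin (@cone_linear i j).

Let cone_shape i j : i != j + 1 -> forall w, cone_diff i j w = 0.
Proof.
move=> ij w; rewrite /= /cone_fun diff_shape // cast_neq; last lia.
by rewrite diff_shape ?linear0 ?addr0 ?oppr0 //; lia.
Qed.

Let cone_diffK i j k w : cone_diff j k (cone_diff i j w) = 0.
Proof.
case: w => [b a]; rewrite /= /cone_fun /= !raddfN /= !diffK !oppr0;
  congr (_, _).
rewrite raddfD /= diffK add0r -chain_comm.
have [e|ij] := eqVneq (i - 1) j; last first.
  by rewrite (cast_neq _ ij) !linear0 diff_shape ?raddf0 ?addr0 //; lia.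
rewrite diff_cast //; have [e'|jk] := eqVneq (j - 1) k.
  by rewrite cast_diff // subrr.
rewrite (cast_neq _ jk) linear0 subr0 diff_shape ?linear0 //. lia.
Qed.

Definition cone : complex S := Complex cone_shape cone_diffK.

Lemma cone_diffE i j b a : diff cone i j (b, a) =
  (diff B i j b + g j (cast A (i - 1) j a), - diff A (i - 1) (j - 1) a).
Proof. by []. Qed.

Lemma cone_acyclic : quasi_iso g -> acyclic cone.
Proof.
move=> gq i [b a]; rewrite /cycle cone_diffE castxx => -[/= eb /eqP];
  rewrite oppr_eq0 => /eqP ca.

have [gI _] := gq (i - 1); have [_ gS] := gq i.
have [a' aE] : boundary a.
  apply: gI => //; rewrite -[g _ _]opprK.
  have -> : g (i - 1) a = - diff B i (i - 1) b by apply/eqP;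
    rewrite -addr_eq0 [X in X == _]addrC eb.
  by rewrite opprK -linearN; apply: boundary_diff.
pose a1 := cast A _ i a'.
have da1 : diff A i (i - 1) a1 = a by rewrite diff_cast //; lia.
have [|a2 ca2 [b' bE]] := gS (b + g i a1).
  by rewrite /cycle linearD -chain_comm da1.
have {}ca2 : diff A i (i - 1) a2 = 0 by [].
exists (b', cast A i (i + 1 - 1) (a2 - a1)).
have i1 : i = i + 1 - 1 by lia.
rewrite cone_diffE cast_trans // castxx diff_cast // !linearB /= ca2 da1. 
rewrite oppr0 sub0r opprK -bE; congr (_, _).
by rewrite addrA subrK addrK.
Qed.

End Cone.

(** * Maps from K-projective and to K-injective complexes, along quasi-isomorphisms *)

Section KProjective.
Variable S : comNzRingType.
Variables (P A B : complex S) (g : chain_map A B).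
Hypotheses (Pk : K_projective P) (gq : quasi_iso g).

(** The pair [(f, 0)] is a chain map to the acyclic cone of [g]. Its null homotopy has the wanted
    homotopy as first component and the lift as second one. *)
Lemma kproj_lift n (f : hmap P B) : is_chain n f -> exists psi : hmap P A,
  is_chain n psi /\ exists h : hmap P B, forall i j i' j' v,
    j = i + n -> i = i' + 1 -> j' = j + 1 ->
    f i j v = g j (psi i j v) + (diff B j' j (h i j' v) + h i' j (diff P i i'
      v)).
Proof.
move=> fc.
have [|H HE] := @kproj_homvan S P (cone g) n Pk (cone_acyclic gq) 
  (fun i j => lpair (f i j) (lzero _ _)).
  move=> i j i' j' v ji ii jj; rewrite [LHS]cone_diffE !linear0 addr0 ?oppr0.
  by congr (_, _); apply: fc.
exists (fun i j => lcomp (cast A (j + 1 - 1) j) (lcomp snd (H i (j + 1)))).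
split=> [i j i' j' v ji ii jj|].
  rewrite jj in ji *.
  have := HE i (j' + 1) i' (j' + 1 + 1) v ji ii erefl =>
    /(congr1 snd) /= /esym/eqP.
  rewrite [X in X == _]addrC subr_eq0 => /eqP e2.
  rewrite diff_cast; last lia.
  transitivity (cast A (j' + 1 - 1) j'
      (diff A (j' + 1 + 1 - 1) (j' + 1 - 1) (H i (j' + 1 + 1) v).2)).
    by rewrite cast_diff //; lia.
  by congr (cast _ _ _ _); rewrite e2.
exists (fun i j => lcomp fst (H i j)) => i j i' _ v ji ii ->.
have := HE i j i' (j + 1) v ji ii erefl => /(congr1 fst) /= ->.
by rewrite addrA [X in _ = X + _]addrC.
Qed.

(** Up to signs, [h] and [psi] together form a chain map of degree [n + 1] to the cone of [g]; the
    second component of its null homotopy contracts [psi]. The signs [sg] compensate for the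
    unsigned convention. *)
Lemma kproj_null n (psi : hmap P A) : is_chain n psi ->
  is_null n (fun i j => lcomp (g j) (psi i j)) -> is_null n psi.
Proof.
move=> psic [h hE].
have [|H HE] := @kproj_homvan S P (cone g) (n + 1) Pk (cone_acyclic gq) 
  (fun i j => lpair (lscale (- sg S i) (h i j)) (lscale (sg S i) (psi i (j -
    1)))).

  move=> i j i' j' v ji ii jj; have {}jj : j' = j - 1 by lia.
  subst j'; rewrite [LHS]cone_diffE; congr (_, _).
    rewrite castxx !linearZ /= [g _ _](hE i (j - 1) i' j v); try lia.
    by rewrite scalerDr scaleNr addKr (sgS _ ii).
  rewrite linearZ /= (sgS _ ii) scaleNr opprK; congr (_ *: _).
  by apply: psic; lia.
exists (fun i j => lscale (- sg S i) (lcomp (cast A (j + 1 - 1) j) (lcomp snd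
  (H i (j + 1))))).
move=> i j i' j' v ji ii ->.
have e : j + 1 = i + (n + 1) by lia.
have /(congr1 (fun w => cast A (j + 1 - 1) j w.2)) /= :=
  HE i (j + 1) i' (j + 1 + 1) v e ii erefl.
rewrite linearZ /= (cast_section (fun j => psi i j v)); last lia.
move=> /(congr1 (fun w => sg S i *: w)); rewrite sgZK => ->.
rewrite linearD linearN /= linearZ /= diff_cast ?cast_diff; try lia.
by rewrite -(sgS _ ii) scaleNr scalerDr scalerN.
Qed.

End KProjective.

Section KInjective.
Variable S : comNzRingType.
Variables (I A B : complex S) (g : chain_map A B).
Hypotheses (Ik : K_injective I) (gq : quasi_iso g).

(** Applied to the second component of the cone of [g], [f] is a map of degree [n - 1] to [I]. A
    null homotopy of it restricts to the extension on [B] and to the homotopy on [A]. *)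
Lemma kinj_extend n (f : hmap A I) : is_chain n f -> exists psi : hmap B I,
  is_chain n psi /\ exists h : hmap A I, forall i j i' j' v,
    j = i + n -> i = i' + 1 -> j' = j + 1 ->
    f i j v = psi i j (g i v) + (diff I j' j (h i j' v) + h i' j (diff A i i'
      v)).
Proof.
move=> fc; have [|H HE] := @kinj_homvan S (cone g) I (n - 1) Ik (cone_acyclic
  gq)
    (fun i j => lcomp (lscale (sg S i) (f (i - 1) j)) snd).
  move=> i j i' j' v ji ii jj; rewrite /= linearN linearZ /= (sgS _ ii) scaleNr
    scalerN.
  by congr (- (_ *: _)); apply: fc; lia.
have HD i j b a : H i j (b, a) = H i j (b, 0) + H i j (0, a).
  by rewrite -linearD; congr (H i j _); apply: injective_projections;
    rewrite /= ?addr0 ?add0r.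
exists (fun i j => lscale (sg S (i + 1)) (lcomp (H i j) (lpair idfun (lzero _
  _)))).
split=> [i j i' j' v ji ii jj|].
  have e1 : i + 1 = i' + 1 + 1 by lia.
  have e : j' = i + (n - 1) by lia.
  have /= /esym/eqP := HE i j' i' j (v, 0) e ii jj.
  rewrite !linear0 addr0 => /eqP.
  move/(congr1 (fun w => sg S (i' + 1) *: w)); rewrite scaler0 scalerDr => /eqP.
  rewrite addr_eq0 => /eqP e2; rewrite linearZ /= (sgS _ e1) scaleNr.
  by rewrite e2 opprK.
exists (fun i j => lscale (sg S (i + 1)) (lcomp (H (i + 1) j)
  (lpair (lzero _ _) (cast A i (i + 1 - 1))))).
move=> i j i' j' v ji ii jj.
have e : j = (i + 1) + (n - 1) by lia.
have /= := HE (i + 1) j i j' (0, cast A i (i + 1 - 1) v) e erefl jj.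
have e1 : f (i + 1 - 1) j (cast A i (i + 1 - 1) v) = f i j v.
  by rewrite (_ : i + 1 - 1 = i) ?castxx //; lia.
rewrite e1 => /(congr1 (fun w => sg S (i + 1) *: w)); rewrite sgZK => ->.
rewrite linear0 add0r diff_cast; last lia.
rewrite cast_trans; last lia.
rewrite castxx (HD i j (g i v)) !scalerDr /= linearZ /= addrCA;
  congr (_ + (_ + _)).
have -> : ((0, - diff A i (i - 1) v) : cone g i) = - (0,
  cast A i' (i - 1) (diff A i i' v)).
  apply: injective_projections; rewrite /= ?oppr0 // cast_diff //; lia.
by rewrite linearN (@sgS _ (i + 1) i erefl) scaleNr scalerN opprK; subst i.
Qed.

Lemma kinj_null n (psi : hmap B I) : is_chain n psi ->
  is_null n (fun i j => lcomp (psi i j) (g i)) -> is_null n psi.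
Proof.
move=> psic [h hE]; have [|H HE] := @kinj_homvan S (cone g) I n Ik
  (cone_acyclic gq)
    (fun i j => ladd (lcomp (psi i j) fst) (lcomp (h (i - 1) j) snd)).
  move=> i j i' j' v ji ii jj; have {ii}ii : i' = i - 1 by lia.
  subst i'; rewrite /= castxx !linearD linearN /=.
  rewrite [psi _ _ (g _ _)](hE (i - 1) j' (i - 1 - 1) j v.2) ?addrK; try lia.
  by rewrite (psic i j (i - 1) j') ?addrA ?addrK //; lia.
exists (fun i j => lcomp (H i j) (lpair idfun (lzero _ _))) =>
  i j i' j' v ji ii jj.
have /= := HE i j i' j' (v, 0) ji ii jj.
by rewrite !linear0 !addr0.
Qed.

End KInjective.

(** * Degreewise short exact sequences *)

Lemma hmap_choice (S : comNzRingType) (A B : complex S)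
    (P : forall i j, {linear A i -> B j} -> Prop) :
  (forall i j, exists u, P i j u) -> exists f : hmap A B, forall i j,
    P i j (f i j).
Proof.
by move=> H; exists (fun i j => sval (cid (H i j))) => i j; case: cid.
Qed.

(** Rescaling by [sg] turns an anticommuting family into a chain map. The connecting maps of the
    long exact sequences below are of this kind. *)
Lemma anti_chain_null (S : comNzRingType) (F N : complex S) n (f : hmap F N) :
  homvan F N n ->
  (forall i j i' j' v, j = i + n -> i = i' + 1 -> j = j' + 1 ->
     diff N j j' (f i j v) = - f i' j' (diff F i i' v)) ->
  exists h : hmap F N, forall i j i' j' v, j = i + n -> i = i' + 1 ->
    j' = j + 1 ->
    f i j v = diff N j' j (h i j' v) - h i' j (diff F i i' v).
Proof.
move=> FN fc; have [|h hE] := FN (fun i j => lscale (sg S i) (f i j)).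
  move=> i j i' j' v ji ii jj; rewrite /= linearZ /= (fc i j i' j') //.
  by rewrite (sgS _ ii) scalerN scaleNr opprK.
exists (fun i j => lscale (sg S i) (h i j)) => i j i' j' v ji ii jj.
have /= /(congr1 (fun w => sg S i *: w)) := hE i j i' j' v ji ii jj.
rewrite sgZK => ->; rewrite scalerDr linearZ /=; congr (_ + _).
by rewrite (sgS _ ii) scaleNr.
Qed.

Section ShortExact.
Variable S : comNzRingType.
Variables (A B C : complex S) (e : int) (a : hmap A B) (c : chain_map B C).

(* The map A -> B is allowed to have a degree, which spares us the shifts. *)
Definition ses := [/\ is_chain e a,
  forall i j v, j = i + e -> a i j v = 0 -> v = 0,
  forall i j w, j = i + e -> (c j w = 0 <-> exists v, a i j v = w)
  & forall i w, exists v, c i v = w].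

Hypothesis abc : ses.

Let ca i j v : j = i + e -> c j (a i j v) = 0.
Proof. by move=> ji; case: abc => _ _ H _; apply/(H i j _ ji); exists v. Qed.

Let aI i j : j = i + e -> injective (a i j).
Proof. by move=> ji; apply: raddf_inj => v; case: abc => _ + _ _; apply. Qed.

Let aC i j i' j' v : j = i + e -> i = i' + 1 -> j = j' + 1 ->
  diff B j j' (a i j v) = a i' j' (diff A i i' v).
Proof. by case: abc => H _ _ _; apply: H. Qed.

Let factor_a F n (f : hmap F B) : (forall i j v, j = i + n ->
  c j (f i j v) = 0) ->
  exists f' : hmap F A, forall i j k v, j = i + n -> j = k + e ->
    a k j (f' i k v) = f i j v.
Proof.
move=> cf; have [|f' fE] := @hmap_choice S F A
    (fun i k u => k + e = i + n -> forall v, a k (k + e) (u v) = f i (k + e) v).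
  move=> i k; have [E|] := eqVneq (k + e) (i + n);
    last by exists (lzero _ _) => ?; lia.
  have [|u uE] := @factor_injective _ _ _ _ (a k (k + e)) (f i (k + e)) (aI
    erefl).
    by move=> v; case: abc => _ _ H _; apply/(H _ _ _ erefl)/cf.
  by exists u.
by exists f' => i j k v ji jk; rewrite jk in ji *; exact: (fE i k ji v).
Qed.

Let factor_c N n (f : hmap B N) :
  (forall i j k v, j = i + e -> k = j + n -> f j k (a i j v) = 0) ->
  exists f' : hmap C N, forall j k w, k = j + n -> f' j k (c j w) = f j k w.
Proof.
move=> fa; have [|f' fE] := @hmap_choice S C N
    (fun j k u => k = j + n -> forall w, u (c j w) = f j k w); last first.
  by exists f' => j k w kj; apply: (fE j k kj).
move=> j k; have [E|] := eqVneq k (j + n); last by exists (lzero _ _) => ?; lia.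
have [||u uE] := @factor_surjective _ _ _ _ (c j) (f j k).
- by case: abc => _ _ _ +; apply.
- move=> w; case: abc => _ _ H _ /(H (j - e)); case=> [|v <-]; first by lia.
  by apply: fa; lia.
by exists u.
Qed.

Section Covariant.
Variable F : complex S.
Hypothesis F_proj : forall i, projective_module (F i).

Let lift_c (f : hmap F C) : exists f' : hmap F B, forall i j v,
  c j (f' i j v) = f i j v.
Proof.
apply: (@hmap_choice S F B (fun i j u => forall v, c j (u v) = f i j v)) => i j.
apply: F_proj; by case: abc => _ _ _ +; apply.
Qed.

(** Exactness at [B] of the long exact sequence of Hom([F], -): a homotopy for the image in [C]
    lifts to [B], as the terms of [F] are projective, and what remains of [f] factors through
    [A]. *)
Lemma homvan_mid n : homvan F A (n - e) -> homvan F C n -> homvan F B n.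
Proof.
move=> FA FC f fc.
have [|h hE] := FC (fun i j => lcomp (c j) (f i j)).
  by move=> i j i' j' v ji ii jj; rewrite /= -chain_comm (fc i j i' j').
have [k kE] := lift_c h.
pose f1 i j := ladd (f i j) (lscale (-1) (ladd
  (lcomp (diff B (j + 1) j) (k i (j + 1))) (lcomp (k (i - 1) j) (diff F i (i -
    1))))).
have f1E i j i' j' v : i = i' + 1 -> j' = j + 1 ->
    f1 i j v = f i j v - (diff B j' j (k i j' v) + k i' j (diff F i i' v)).
  move=> ii ->; have {ii}-> : i' = i - 1 by lia.
  by rewrite /= scaleN1r.
have [|f2 f2E] := @factor_a F n f1.
  move=> i j v ji /=; rewrite scaleN1r linearB linearD /= chain_comm !kE.
  by rewrite [c j _](hE i j (i - 1) (j + 1)) ?subrr //; lia.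
have [|u uE] := FA f2.
  move=> i j i' j' v ji ii jj; apply: (@aI j' (j' + e) erefl).
  rewrite -(@aC j (j + e)) //; last by lia.
  rewrite (f2E i (j + e)) ?(f2E i' (j' + e)); try lia.
  rewrite (f1E i (j + e) i' (j + e + 1)) // (f1E i' (j' + e) (i' - 1) (j' + e +
    1)); try lia.
  rewrite linearB linearD /= !diffK add0r linear0 addr0.
  rewrite (fc i (j + e) i' (j' + e)); try lia.
  by have -> : j' + e + 1 = j + e by lia.
exists (fun i j => ladd (k i j) (lcomp (a (j - e) j) (u i (j - e)))).
move=> i j i' j' v ji ii jj; rewrite /= linearD /=.
rewrite (@aC _ j' (j - e) j); try lia.
rewrite addrACA -linearD /= -(uE i (j - e) i' (j' - e)); try lia.
rewrite (f2E i j) //; last lia.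
by rewrite (f1E i j i' j') // addrCA subrr addr0.
Qed.

(** Lift [f] to a family [g] with values in [B]. The failure of [g] to commute with the
    differentials is the connecting map to [A]; a null homotopy of that map corrects [g] to a chain
    map. *)
Lemma homvan_right n : homvan F B n -> homvan F A (n - 1 - e) -> homvan F C n.
Proof.
move=> FB FA f fc; have [g gE] := lift_c f.
pose t i j := ladd (lcomp (diff B (j + 1) j) (g i (j + 1)))
  (lscale (-1) (lcomp (g (i - 1) j) (diff F i (i - 1)))).
have tE i j i' j' v : i = i' + 1 -> j' = j + 1 ->
    t i j v = diff B j' j (g i j' v) - g i' j (diff F i i' v).
  move=> ii ->; have {ii}-> : i' = i - 1 by lia.
  by rewrite /= scaleN1r.
have [|s sE] := @factor_a F (n - 1) t.
  move=> i j v ji /=; rewrite scaleN1r linearB /= chain_comm !gE.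
  by rewrite (fc i (j + 1) (i - 1) j) ?subrr //; lia.
have [|u uE] := anti_chain_null FA (f := s).
  move=> i j i' j' v ji ii jj; apply: (@aI j' (j' + e) erefl).
  rewrite -(@aC j (j + e)) //; last by lia.
  rewrite linearN (sE i (j + e)) ?(sE i' (j' + e)); try lia.
  rewrite (tE i (j + e) i' (j + e + 1)) // (tE i' (j' + e) (i' - 1) (j + e));
    try lia.
  by rewrite linearB /= !diffK sub0r linear0 subr0.
have [|h hE] := FB (fun i j => ladd (g i j) (lscale (-1) (lcomp (a (j - e) j)
  (u i (j - e))))).
  move=> i j i' j' v ji ii jj; rewrite /= !scaleN1r linearB /=.
  rewrite (@aC _ j (j' - e) j'); try lia.
  have := sE i j' (j' - e) v; rewrite (tE i j' i' j) // => E.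
  move: E; rewrite (uE i (j' - e) i' (j - e)) ?linearB /=; try lia.
  move=> /(_ _ _)/esym E; have {}E := E (ltac:(lia)) (ltac:(lia)).
  move/eqP: E; rewrite subr_eq => /eqP ->.
  by rewrite addrAC addrC [X in _ + X]addrAC subrr sub0r.
exists (fun i j => lcomp (c j) (h i j)) => i j i' j' v ji ii jj.
have /= := hE i j i' j' v ji ii jj; rewrite scaleN1r => /(congr1 (c j)).
by rewrite linearB linearD /= gE ca ?subr0 ?chain_comm //; lia.
Qed.

(** Stated for one [f]: in the application [a] is multiplication by [x], whose composite with each
    [f] is null although Hom([F], [B]) may have homology. The image in [C] of the homotopy is null
    itself, and this allows to move the homotopy into [A]. *)
Lemma homvan_left n (f : hmap F A) : is_chain n f ->
  is_null (n + e) (fun i j => lcomp (a (j - e) j) (f i (j - e))) ->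
  homvan F C (n + e + 1) -> is_null n f.
Proof.
move=> fc [h hE] FC.
have [|u uE] := anti_chain_null FC (f := fun i j => lcomp (c j) (h i j)).
  move=> i j i' j' v ji ii jj; rewrite /= -chain_comm -linearN /=.
  have /= E := hE i j' i' j v (ltac:(lia)) ii jj.
  have -> : diff B j j' (h i j v) =
      a (j' - e) j' (f i (j' - e) v) - h i' j' (diff F i i' v) by rewrite E
        addrK.
  by rewrite linearB /= ca ?sub0r ?linearN //; lia.
have [k kE] := lift_c u.
pose h1 i j := ladd (h i j) (lscale (-1) (ladd (lcomp (diff B (j + 1) j) (k i
  (j + 1)))
  (lscale (-1) (lcomp (k (i - 1) j) (diff F i (i - 1)))))).
have h1E i j i' j' v : i = i' + 1 -> j' = j + 1 ->
    h1 i j v = h i j v - (diff B j' j (k i j' v) - k i' j (diff F i i' v)).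
  move=> ii ->; have {ii}-> : i' = i - 1 by lia.
  by rewrite /= !scaleN1r.
have [|s sE] := @factor_a F (n + e + 1) h1.
  move=> i j v ji /=; rewrite !scaleN1r linearB /= linearB /= chain_comm !kE.
  by have /= -> := uE i j (i - 1) (j + 1) v ji (ltac:(lia)) erefl;
    rewrite subrr.
exists s => i j i' j' v ji ii jj; apply: (@aI j (j + e) erefl).
rewrite linearD /= -(@aC j' (j' + e)) //; last lia.
rewrite (sE i (j' + e)) ?(sE i' (j + e)) //; try lia.
rewrite (h1E i (j' + e) i' (j' + e + 1)) // (h1E i' (j + e) (i' - 1) (j' + e));
  try lia.
have /= := hE i (j + e) i' (j' + e) v (ltac:(lia)) ii (ltac:(lia)).
rewrite addrK => ->.
rewrite linearB /= linearB /= !diffK linear0 subr0 sub0r opprK.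
by rewrite addrACA addrN addr0.
Qed.

End Covariant.

Section Contravariant.
Variable N : complex S.
(** Takes the place of injectivity of [N]; it holds for degreewise split sequences, such as
    [lift_ses]. *)
Hypothesis extend : forall i j k (u : {linear A i -> N k}), j = i + e ->
  exists u' : {linear B j -> N k}, forall v, u' (a i j v) = u v.

Let extend_a (h : hmap A N) : exists k : hmap B N, forall i j l v,
  j = i + e -> k j l (a i j v) = h i l v.
Proof.
have [j l|k kE] := @hmap_choice S B N
  (fun j l u => forall v, u (a (j - e) j v) = h (j - e) l v).
  by apply: extend; lia.
exists k => i j l v ji; have e1 : i = j - e by lia.
by subst i; apply: kE.
Qed.

Lemma homvan_mid_contra n : homvan A N (n + e) -> homvan C N n -> homvan B N n.
Proof.
move=> AN CN f fc.
have [|h hE] := AN (fun i k => lcomp (f (i + e) k) (a i (i + e))).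
  move=> i j i' j' v ji ii jj; rewrite /= (fc _ _ (i' + e) j'); try lia.
  by rewrite (@aC i _ i') //; lia.
have [k kE] := extend_a h.
pose f1 i j := ladd (f i j) (lscale (-1) (ladd
  (lcomp (diff N (j + 1) j) (k i (j + 1))) (lcomp (k (i - 1) j) (diff B i (i -
    1))))).
have f1E i j i' j' v : i = i' + 1 -> j' = j + 1 ->
    f1 i j v = f i j v - (diff N j' j (k i j' v) + k i' j (diff B i i' v)).
  move=> ii ->; have {ii}-> : i' = i - 1 by lia.
  by rewrite /= scaleN1r.
have [|f2 f2E] := @factor_c N n f1.
  move=> i j l v ji lj; rewrite (f1E j l (j - 1) (l + 1)) //; last lia.
  rewrite (@aC i j (i - 1) (j - 1)); try lia.
  rewrite !kE; try lia.
  have /= := hE i l (i - 1) (l + 1) v (ltac:(lia)) (ltac:(lia)) erefl.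
  rewrite -ji => ->.
  by rewrite subrr.
have cS : forall i w, exists v, c i v = w by case: abc.
have [|u uE] := CN f2.
  move=> i j i' j' w ji ii jj; have [v <-] := cS i w.
  rewrite -chain_comm !f2E; try lia.
  rewrite (f1E i j i' (j + 1)) // (f1E i' j' (i' - 1) j); try lia.
  rewrite linearB linearD /= !diffK linear0 add0r addr0.
  by rewrite (fc i j i' j').
exists (fun i j => ladd (k i j) (lcomp (u i j) (c i))) => i j i' j' v ji ii jj.
rewrite /= linearD /= addrACA chain_comm -(uE i j i' j') // f2E //.
by rewrite (f1E i j i' j') // addrCA subrr addr0.
Qed.

(** For [lift_ses], where [e] is 1, this relates degree [n] for the quotient to degree [n + 2] for
    the subcomplex: it is the step of the descent. *)
Lemma homvan_right_contra n : homvan B N n -> homvan A N (n + e + 1) ->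
  homvan C N n.
Proof.
move=> BN AN f fc; have [|h hE] := BN (fun i j => lcomp (f i j) (c i)).
  by move=> i j i' j' v ji ii jj; rewrite /= (fc i j i' j') // chain_comm.
have [|u uE] := anti_chain_null AN (f := fun i k =>
  lcomp (h (i + e) k) (a i (i + e))).
  move=> i j i' j' v ji ii jj /=.
  have /= /esym/eqP := hE (i + e) j' (i' + e) j (a i (i + e) v) (ltac:(lia))
    (ltac:(lia)) jj.
  rewrite ca // linear0 (@aC i _ i') //; try lia.
  by rewrite addr_eq0 => /eqP.
have [k kE] := extend_a u.
pose h1 i j := ladd (h i j) (lscale (-1) (ladd (lcomp (diff N (j + 1) j) (k i
  (j + 1)))
  (lscale (-1) (lcomp (k (i - 1) j) (diff B i (i - 1)))))).
have h1E i j i' j' v : i = i' + 1 -> j' = j + 1 ->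
    h1 i j v = h i j v - (diff N j' j (k i j' v) - k i' j (diff B i i' v)).
  move=> ii ->; have {ii}-> : i' = i - 1 by lia.
  by rewrite /= !scaleN1r.
have [|s sE] := @factor_c N (n + 1) h1.
  move=> i j l v ji lj; rewrite (h1E j l (j - 1) (l + 1)) //; last lia.
  rewrite (@aC i j (i - 1) (j - 1)); try lia.
  rewrite !kE; try lia.
  have /= := uE i l (i - 1) (l + 1) v (ltac:(lia)) (ltac:(lia)) erefl.
  rewrite -ji => ->.
  by rewrite subrr.
have cS : forall i w, exists v, c i v = w by case: abc.
exists s => i j i' j' w ji ii jj; have [v <-] := cS i w.
rewrite -chain_comm !sE; try lia.
rewrite (h1E i j' i' (j' + 1)) // (h1E i' j (i' - 1) j'); try lia.
have /= -> := hE i j i' j' v ji ii jj.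
rewrite linearB /= linearB /= !diffK linear0 subr0 sub0r opprK.
by rewrite addrACA addrN addr0.
Qed.

End Contravariant.

Lemma homology_zero_mid i k : i = k + e ->
  homology_zero A k -> homology_zero C i -> homology_zero B i.
Proof.
move=> ik A0 C0 w cw; have [u cwE] := C0 _ (cycle_chain c cw).
have [_ _ H cS] := abc; have [w' w'E] := cS _ u.
have [v vE] : exists v, a k i v = w - diff B (i + 1) i w'.
  by apply/(H k i _ ik); rewrite linearB /= chain_comm w'E cwE subrr.
have [|v' v'E] := A0 v.
  apply: (@aI (k - 1) (i - 1)); first by lia.
  by rewrite -(@aC k i) ?vE ?linear0 ?linearB ?diffK ?subr0 //; lia.
exists (w' + a (k + 1) (i + 1) v'); rewrite linearD (@aC (k + 1) _ k) //;
  try lia.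
by rewrite -v'E vE addrC subrK.
Qed.

Lemma homology_zero_right i k : i = k + 1 + e ->
  homology_zero B i -> homology_zero A k -> homology_zero C i.
Proof.
move=> ik B0 A0 u cu; have [_ _ H cS] := abc; have [w wE] := cS _ u.
have [v vE] : exists v, a k (i - 1) v = diff B i (i - 1) w.
  by apply/(H k); [lia | rewrite chain_comm wE].
have [|v' v'E] := A0 v.
  apply: (@aI (k - 1) (i - 1 - 1)); first by lia.
  by rewrite -(@aC k (i - 1)) ?vE ?linear0 ?diffK //; lia.
have [|w' w'E] := B0 (w - a (k + 1) i v').
  by rewrite /cycle linearB (@aC _ _ k) //; try lia; rewrite -v'E vE subrr.
exists (c _ w'); rewrite -chain_comm -w'E linearB /= wE ca ?subr0 //; lia.
Qed.

End ShortExact.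

(** * Resolutions *)

Lemma nat_dependent_choice (T : nat -> Type) (Q : forall m, T m -> Prop)
    (Rl : forall m, T m -> T m.+1 -> Prop) (t0 : T 0%N) :
  Q 0%N t0 ->
  (forall m t, Q m t -> exists t', Q m.+1 t' /\ Rl m t t') ->
  exists s : forall m, T m, s 0%N = t0 /\
    forall m, Q m (s m) /\ Rl m (s m) (s m.+1).
Proof.
move=> Q0 Qs.
pose next m (t : {t | Q m t}) : {t' | Q m.+1 t' /\ Rl m (sval t) t'} :=
  cid (Qs m (sval t) (svalP t)).
pose s := nat_rect (fun m => {t | Q m t}) (exist _ t0 Q0)
  (fun m t => exist _ (sval (next m t)) (svalP (next m t)).1).
exists (fun m => sval (s m)); split=> // m; split; first exact: svalP.
exact: (svalP (next m (s m))).2.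
Qed.

Section IntegerChoice.
Variables (T : int -> Type) (dflt : forall i, T i) (n : int).
Variables (Q : forall i, T i -> Prop) (Rl : forall i j, T i -> T j -> Prop).

(** Dependent choice along an injective sequence of degrees. Injectivity makes the transport of the
    choices to a function on all integers unambiguous, and other degrees receive the default. *)
Let int_choice (delta : nat -> int) : injective delta -> Q (dflt (delta 0%N)) ->
  (forall m t, Q t -> exists t' : T (delta m.+1), Q t' /\
    @Rl (delta m) _ t t') ->
  exists s : forall i, T i, [/\ s (delta 0%N) = dflt _,
    forall i, (forall m, delta m <> i) -> s i = dflt i &
    forall m, Q (s (delta m)) /\ Rl (s (delta m)) (s (delta m.+1))].
Proof.
move=> dI Q0 Qs; have [u [u0 uE]] := @nat_dependent_choice (fun m =>
  T (delta m))
  (fun m => @Q _) (fun m => @Rl _ _) (dflt (delta 0%N)) Q0 Qs.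
have ex i : exists t : T i, (forall m (e : delta m = i),
  t = eq_rect _ T (u m) _ e) /\
    ((forall m, delta m <> i) -> t = dflt i).
  have [[m <-]|none] := pselect (exists m, delta m = i).
    exists (u m); split=> [m' e|/(_ m)//]; have em := dI _ _ e; subst m'.
    by rewrite eq_axiomK.
  exists (dflt i); split=> // m e; by case: none; exists m.
have sE m : sval (cid (ex (delta m))) = u m by case: cid => /= t [/(_ m erefl)].
exists (fun i => sval (cid (ex i))); split=> [|i none|m]; rewrite ?sE //.
by case: cid => /= t [_ ->].
Qed.

Lemma int_choice_up : Q (dflt n) ->
  (forall i j t, j = i + 1 -> n <= i -> Q t -> exists t', Q t' /\
    @Rl i j t t') ->
  exists s : forall i, T i, [/\ forall i, i <= n -> s i = dflt i,
    forall i, n <= i -> Q (s i) &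
    forall i j, j = i + 1 -> n <= i -> Rl (s i) (s j)].
Proof.
move=> Q0 Qs; have [|||s [s0 sd sE]] := @int_choice (fun m : nat => n + m%:Z).
- by move=> m m' /eqP; rewrite (inj_eq (addrI _)) => /eqP[].
- by rewrite addr0.
- by move=> m t; apply: Qs; lia.
have ge i : n <= i -> exists m : nat, i = n + m%:Z by move=> ni;
  exists `|i - n|%N; lia.
exists s; split=> [i|i /ge[m ->]|i j -> /ge[m ->]].
- rewrite le_eqVlt => /predU1P[->|ni]; first by move: s0; rewrite addr0.
  by apply: sd => m; lia.
- by case: (sE m).
- have -> : n + m%:Z + 1 = n + m.+1%:Z by lia.
  by case: (sE m).
Qed.

Lemma int_choice_down : Q (dflt n) ->
  (forall i j t, i = j + 1 -> i <= n -> Q t -> exists t', Q t' /\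
    @Rl i j t t') ->
  exists s : forall i, T i, [/\ forall i, n <= i -> s i = dflt i,
    forall i, i <= n -> Q (s i) &
    forall i j, i = j + 1 -> i <= n -> Rl (s i) (s j)].
Proof.
move=> Q0 Qs; have [|||s [s0 sd sE]] := @int_choice (fun m : nat => n - m%:Z).
- by move=> m m'; lia.
- by rewrite subr0.
- by move=> m t; apply: Qs; lia.
have le i : i <= n -> exists m : nat, i = n - m%:Z by move=> ni;
  exists `|i - n|%N; lia.
exists s; split=> [i|i /le[m ->]|i j ij /le[m e]].
- rewrite le_eqVlt => /predU1P[<-|ni]; first by move: s0; rewrite subr0.
  by apply: sd => m; lia.
- by case: (sE m).
- have {ij} -> : j = n - m.+1%:Z by lia.
  by rewrite e; case: (sE m).
Qed.

End IntegerChoice.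

Section BoundedResolutions.
Variable S : comNzRingType.
Implicit Types (M N E : lmodType S).

Lemma projective_lift_image M N (P : lmodType S) (d : {linear M ->
  N}) (u : {linear P -> N}) :
  projective_module P -> (forall p, exists v, d v = u p) ->
  exists h : {linear P -> M}, forall p, d (h p) = u p.
Proof.
move=> Pp du; have hI := submod_image d; pose i := subm_val hI.
have [|u' u'E] := @factor_injective _ _ _ _ i u (@subm_val_inj _ _ _ hI).
  by move=> p; apply/subm_val_surj/du.
have [|d' d'E] := @factor_injective _ _ _ _ i d (@subm_val_inj _ _ _ hI).
  by move=> v; apply/subm_val_surj; exists v.
have [|h hE] := Pp _ _ d' u'; last first.
  by exists h => p; rewrite -d'E hE u'E.
move=> b; have [v vE] := subm_valP (hP := hI) b; exists v.
by apply: (@subm_val_inj _ _ _ hI); rewrite [LHS]d'E.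
Qed.

Lemma injective_extend M N E (d : {linear M -> N}) (u : {linear M -> E}) :
  injective_module E -> (forall v, d v = 0 -> u v = 0) ->
  exists h : {linear N -> E}, forall v, h (d v) = u v.
Proof.
move=> Ei du; have hI := submod_image d; pose i := subm_val hI.
have [|d' d'E] := @factor_injective _ _ _ _ i d (@subm_val_inj _ _ _ hI).
  by move=> v; apply/subm_val_surj; exists v.
have [||u' u'E] := @factor_surjective _ _ _ _ d' u.
- move=> b; have [v vE] := subm_valP (hP := hI) b; exists v.
  by apply: (@subm_val_inj _ _ _ hI); rewrite [LHS]d'E.
- by move=> v d'v; apply: du; rewrite -d'E d'v linear0.
have [h hE] := Ei _ _ i u' (@subm_val_inj _ _ _ hI).
by exists h => v; rewrite -d'E hE u'E.
Qed.

Lemma kproj_bounded (P : complex S) a : (forall i, projective_module (P i)) ->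
  (forall i (v : P i), i < a -> v = 0) -> K_projective P.
Proof.
move=> Pp P0 N Na f.
have [||s [_ _ sE]] := @int_choice_up (fun i => forall j, {linear P i -> N j})
  (fun i j => lzero _ _) (a - 1)
  (fun i h => forall k (w : P k), k = i + 1 ->
    f i (diff P k i w) = diff N k i (h k (diff P k i w)))
  (fun i j h h' => forall l v, l = j + 1 ->
    f j v = diff N l j (h' l v) + h j (diff P j i v)).
- by move=> k w kE; rewrite linear0 [diff _ _ _ _](P0 _) ?linear0 //; lia.
- move=> i j h ji ai hQ.
  have [|h' h'E] := @projective_lift_image _ _ _ (diff N (j + 1) j)
      (ladd (f j) (lscale (-1) (lcomp (h j) (diff P j i)))) (Pp j).
    move=> p; have [|w wE] := Na j (f j p - h j (diff P j i p)).
      have ij : j - 1 = i by lia.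
      by rewrite /cycle ij linearB /= -chain_comm hQ ?subrr.
    by exists w; rewrite /= scaleN1r wE.
  have h'S : forall v, f j v = diff N (j + 1) j (h' v) + h j (diff P j i v).
    by move=> v; rewrite h'E /= scaleN1r subrK.
  exists (fun l => lcomp (cast N (j + 1) l) h'); split=> [k w kE|l v lE]; subst.
    by rewrite h'S /= diffK linear0 addr0 castxx.
  by rewrite h'S /= castxx.
exists s => i v; have [ia|ai] := ltP i a.
  by rewrite [v](P0 _ v ia) !linear0 addr0.
by apply: (sE (i - 1) i); lia.
Qed.

Lemma kinj_bounded (I : complex S) a : (forall i, injective_module (I i)) ->
  (forall i (v : I i), a < i -> v = 0) -> K_injective I.
Proof.
move=> Ii I0 N Na f.
have [||s [_ _ sE]] := @int_choice_down (fun i => forall j, {linear N i -> I j})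
  (fun i j => lzero _ _) a
  (fun i h => forall k (w : N k), k = i + 1 ->
    f i (diff N k i w) = diff I k i (h k (diff N k i w)))
  (fun i j h h' => forall l v, l = i + 1 ->
    f i v = diff I l i (h l v) + h' i (diff N i j v)).
- by move=> k w kE; rewrite linear0 chain_comm [f k w](I0 _) ?linear0 //; lia.
- move=> i j h ij ia hQ.
  have [|h' h'E] := @injective_extend _ _ _ (diff N i j)
      (ladd (f i) (lscale (-1) (lcomp (diff I (i + 1) i) (h (i + 1))))) (Ii i).
    move=> v dv; have [|w ->] := Na i v.
      by rewrite /cycle; have -> : i - 1 = j by lia.
    by rewrite /= scaleN1r hQ ?subrr.
  exists (fun l => lcomp (cast I i l) h'); split=> [k w kE|l v lE].
    have {kE} kE : k = i by lia.
    subst k; rewrite /= castxx h'E /= scaleN1r linearB /= diffK subr0.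
    by rewrite chain_comm.
  by subst l; rewrite /= castxx h'E /= scaleN1r addrC subrK.
exists s => i v; have [ia|ai] := leP i a.
  by apply: (sE i (i - 1)); lia.
by rewrite [f i v]I0 // [RHS]I0.
Qed.

Definition row_comb M n (e : 'I_n -> M) (c : 'rV[S]_n) : M :=
  \sum_(k < n) c 0 k *: e k.

Fact row_comb_linear M n (e : 'I_n -> M) : linear (row_comb e).
Proof.
move=> a u v; rewrite /row_comb scaler_sumr -big_split; apply: eq_bigr => k _.
by rewrite !mxE scalerDl scalerA.
Qed.
Definition row_lin M n (e : 'I_n -> M) : {linear 'rV[S]_n -> M} :=
  lin (row_comb_linear e).

Lemma row_lin_eta M n (f : {linear 'rV[S]_n -> M}) c :
  f c = row_lin (fun k => f (delta_mx 0 k)) c.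
Proof.
rewrite {1}[c]row_sum_delta linear_sum; apply: eq_bigr => k _.
by rewrite linearZ.
Qed.

Lemma finitely_generatedP M : finitely_generated M <->
  exists n (e : 'I_n -> M), forall v, exists c, v = row_lin e c.
Proof.
split=> [[s sE]|[n [e eE]]].
  exists (size s), (fun k : 'I_(size s) => s`_k) => v; have [c ->] := sE v.
  exists (\row_k c k); apply: eq_bigr => k _; by rewrite mxE.
have E : size [seq e k | k <- enum 'I_n] = n by rewrite size_map size_enum_ord.
exists [seq e k | k <- enum 'I_n] => v; have [c ->] := eE v.
exists (fun k => c 0 (cast_ord E k)).
rewrite /= /row_comb (reindex (cast_ord E)) /=; last first.
  by exists (cast_ord (esym E)) => k _; rewrite ?cast_ordK ?cast_ordKV.
apply: eq_bigr => k _; congr (_ *: _); have kn := leq_trans (ltn_ord k) (eq_leq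
  E).
rewrite (nth_map (cast_ord E k)) ?size_enum_ord //.
by congr e; apply: val_inj; rewrite /= nth_enum_ord.
Qed.

Lemma rV_fg n : finitely_generated 'rV[S]_n.
Proof.
apply/finitely_generatedP; exists n, (delta_mx 0) => v; exists v.
by rewrite -[LHS]/(idfun v) (row_lin_eta idfun).
Qed.

Lemma rV_projective n : projective_module 'rV[S]_n.
Proof.
move=> A B u g uS; have [s sE] := choice (fun k => uS (g (delta_mx 0 k))).
exists (row_lin s) => c; rewrite [RHS]row_lin_eta /= /row_comb linear_sum.
by apply: eq_bigr => k _; rewrite linearZ /= sE.
Qed.

(** Complexes of finite free modules are given by matrices acting on row vectors, so that
    differentials can be reduced and lifted entrywise. *)
Record mcomplex := MComplex {
  rk : int -> nat;
  mx : forall i j, 'M[S]_(rk i, rk j);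
  mx_shape : forall i j, i != j + 1 -> mx i j = 0;
  mxK : forall i j k, mx i j *m mx j k = 0
}.

Section MatrixComplex.
Variable G : mcomplex.

Let mdiff i j : {linear 'rV[S]_(rk G i) -> 'rV[S]_(rk G j)} :=
  mulmxr (mx G i j).

Let mdiff_shape i j : i != j + 1 -> forall v, mdiff i j v = 0.
Proof. by move=> ij v; rewrite /= mx_shape // mulmx0. Qed.

Let mdiffK i j k v : mdiff j k (mdiff i j v) = 0.
Proof. by rewrite /= -mulmxA mxK mulmx0. Qed.

Definition complex_of : complex S := Complex mdiff_shape mdiffK.

Lemma complex_ofE i j (v : complex_of i) : diff complex_of i j v = v *m mx G i
  j.
Proof. by []. Qed.

Lemma complex_of_proj i : projective_module (complex_of i).
Proof. exact: rV_projective. Qed.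

Lemma complex_of_fg : degreewise_fg complex_of.
Proof.
by move=> i; apply: rV_fg.
Qed.

End MatrixComplex.

Definition bounded_below (G : mcomplex) a := forall i, i < a -> rk G i = 0%N.

Lemma rV0_eq0 n (v : 'rV[S]_n) : n = 0%N -> v = 0.
Proof. by move=> n0; subst n; apply: thinmx0. Qed.

Lemma complex_of_kproj G a : bounded_below G a -> K_projective (complex_of G).
Proof.
move=> Ga; apply: (kproj_bounded (a := a)); first exact: complex_of_proj.
by move=> i v /Ga; apply: rV0_eq0.
Qed.

(** [noetherian] speaks of proper ideals, so the unit ideal is treated apart, with generator 1. *)
Lemma ideal_fg (J : S -> Prop) : noetherian S -> J 0 ->
  (forall a u v, J u -> J v -> J (a * u + v)) ->
  exists m (g : 'I_m -> S), forall a, J a <-> exists c : 'I_m -> S,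
    a = \sum_k c k * g k.
Proof.
move=> nS J0 JL; have JM a u : J u -> J (a * u) by move=> Ju;
  rewrite -[_ * u]addr0; apply: JL.
have [J1|nJ1] := pselect (J 1).
  exists 1%N, (fun=> 1) => a; split=> [_|_]; last by rewrite -[a]mulr1;
    apply: JM.
  by exists (fun=> a); rewrite big_ord1 mulr1.
pose p : {pred S} := fun a => `[< J a >].
have pI : idealr_closed p.
  split; first exact/asboolP.
    by apply/asboolP.
  by move=> a u v /asboolP Ju /asboolP Jv; apply/asboolP/JL.
have [s sE] := nS (HB.pack p (isIdealr.Build S p pI)).
exists (size s), (fun k => s`_k) => a; rewrite -sE.
by split=> [Ja|/asboolP]; first exact/asboolP.
Qed.

(** Induction on [n]: the first coordinates of [P] form a finitely generated ideal, and the elements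
    of [P] with first coordinate zero form a submodule of a free module of smaller rank. *)
Lemma submodule_fg n (P : 'rV[S]_n -> Prop) : noetherian S -> submod P ->
  exists m (A : 'M[S]_(m, n)), forall v, P v <-> exists c, v = c *m A.
Proof.
move=> nS; elim: n P => [|n IHn] P hP.
  exists 0%N, 0 => v; split=> _; first by exists 0;
    apply: etrans (thinmx0 _) (esym (thinmx0 _)).
  by case: hP => P0 _; rewrite (thinmx0 v).
rewrite -[n.+1]/(1 + n)%N in P hP *.
have [P0 PD PN PZ PB] := submodE hP.
pose pr (v : 'rV[S]_(1 + n)) := lsubmx v 0 0.
have [||m [g gE]] := @ideal_fg (fun a => exists2 v, P v & pr v = a) nS.
- by exists 0; rewrite // /pr linear0 mxE.
- move=> a _ _ [u Pu <-] [v Pv <-]; exists (a *: u + v);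
  last by rewrite /pr !mxE.
  by case: hP => _; apply.
have /choice[k kE] l : exists v : 'rV[S]_(1 + n), P v /\ pr v = g l.
  have [|v Pv vE] := (gE (g l)).2; last by exists v.
  exists (fun j => (j == l)%:R); rewrite (bigD1 l) //= eqxx mul1r big1 ?addr0
    // => j /negbTE ->.
  by rewrite mul0r.
have [|m' [A AE]] := IHn (fun v => P (row_mx (0 : 'rV_1) v)).
  split=> [|a u v Pu Pv]; first by rewrite row_mx0.
  have -> : row_mx 0 (a *: u + v) = a *: row_mx (0 : 'rV_1) u + row_mx 0 v.
    by rewrite scale_row_mx add_row_mx scaler0 addr0.
  by case: hP => _; apply.
pose K : 'M[S]_(m, 1 + n) := \matrix_(l < m) k l.
have PK c : P (c *m K).
  rewrite mulmx_sum_row; apply: submod_sum => // l.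
  by rewrite rowK; apply: PZ; case: (kE l).
exists (m + m')%N, (col_mx K (row_mx 0 A)) => v; split=> [Pv|[c ->]];
  last first.
  rewrite -[c]hsubmxK mul_row_col; apply: PD; first exact: PK.
  by rewrite mul_mx_row mulmx0; apply/AE; exists (rsubmx c).
have [c cE] := (gE (pr v)).1 (ex_intro2 _ _ v Pv erefl).
pose c' : 'rV[S]_m := \row_l c l.
have e0 : lsubmx (v - c' *m K : 'rV[S]_(1 + n)) = 0.
  apply/rowP => j; rewrite [j]ord1 !mxE -[lshift n 0]/(lshift n (0 : 'I_1)).
  have -> : v 0 (lshift n 0) = pr v by rewrite /pr mxE.
  rewrite cE -sumrB big1 // => l _; rewrite !mxE; case: (kE l) => _ <-.
  by rewrite /pr mxE subrr.
have [d dE] : exists d, rsubmx (v - c' *m K : 'rV[S]_(1 + n)) = d *m A.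
  by apply/AE; rewrite -e0 hsubmxK; apply: PB.
exists (row_mx c' d); rewrite mul_row_col mul_mx_row mulmx0 -dE -e0 hsubmxK.
by rewrite addrC subrK.
Qed.

(** * Bounded below resolutions by finite free modules *)

Section ProjectiveResolution.
Variables (X : complex S) (a : int).
Hypotheses (nS : noetherian S) (X_fg : degreewise_fg X).
Hypothesis X_below : forall i, i < a -> homology_zero X i.

(* A free module with a map to X_i and its submodule of cycles. *)
Let stage i : Type :=
  {r : nat & ({linear 'rV[S]_r -> X i} * ('rV[S]_r -> Prop))%type}.
Let stage_map i (t : stage i) := (tagged t).1.
Let stage_cycle i (t : stage i) := (tagged t).2.
Arguments stage_map {i} t.
Arguments stage_cycle {i} t.
(** By the third clause the new free module covers the pullback, over [X i], of [X j] and the cycles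
    of the previous stage. This yields injectivity on homology in degree [i] and, taking [g = 0],
    surjectivity in degree [j]. *)
Let stage_rel i j (t : stage i) (t' : stage j) :=
  exists D : 'M[S]_(tag t', tag t),
  [/\ forall c, stage_cycle t (c *m D),
      forall c, stage_map t (c *m D) = diff X j i (stage_map t' c),
      forall g x, stage_cycle t g -> stage_map t g = diff X j i x ->
        exists c, c *m D = g /\ stage_map t' c = x
    & forall c, stage_cycle t' c <-> c *m D = 0].

Let stage_step i j (t : stage i) : submod (stage_cycle t) ->
  exists t' : stage j, submod (stage_cycle t') /\ stage_rel t t'.
Proof.
case: t => r [f Z] /= hZ; have [s [e eE]] := (finitely_generatedP _).1 (X_fg j).
(* The preimage of this pullback in a finite free module, which is finitely generated because [S] is
   noetherian. *)
pose P (w : 'rV[S]_(r + s)) :=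
  Z (lsubmx w) /\ f (lsubmx w) = diff X j i (row_lin e (rsubmx w)).
have hP : submod P.
  have [Z0 ZL] := hZ; split=> [|b u v [Zu fu] [Zv fv]]; rewrite /P.
    by rewrite !linear0; split=> //; rewrite linear0.
  rewrite linearP; split; first exact: ZL.
  by rewrite !linearP fu fv.
have [m [A AE]] := submodule_fg nS hP.
exists (existT _ m (lcomp (row_lin e) (mulmxr (rsubmx A)), fun c =>
  c *m lsubmx A = 0)).
split; first exact: (submod_ker (mulmxr (lsubmx A))).
have PA c : Z (c *m lsubmx A) /\ f (c *m lsubmx A) = diff X j i (row_lin e (c
  *m rsubmx A)).
  have [] := (AE (c *m A)).2 (ex_intro _ c erefl).
  by rewrite -mulmx_lsub -mulmx_rsub.
exists (lsubmx A); split=> //= [c|c|g x Zg fg]; try by case: (PA c).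
have [y xE] := eE x; have [|c cE] := (AE (row_mx g y)).1.
  by rewrite /P row_mxKl row_mxKr; split=> //; rewrite fg xE.
by exists c; rewrite mulmx_lsub mulmx_rsub -cE row_mxKl row_mxKr xE.
Qed.

Theorem projective_resolution_exists : exists (G : mcomplex),
  bounded_below G a /\ exists f : chain_map (complex_of G) X, quasi_iso f.
Proof.
have [|i j t ji _|s [sd sQ sE]] := @int_choice_up stage
  (fun i => existT _ 0%N (lzero _ _, fun=> True)) (a - 1)
  (fun i t => submod (stage_cycle t)) (fun i j t t' => stage_rel t t').
- by split.
- exact: stage_step.
have s0 i (c : 'rV[S]_(tag (s i))) : i < a -> c = 0.
  by move=> ia; apply: rV0_eq0; rewrite sd //; lia.
have ex i j : exists D : 'M[S]_(tag (s i), tag (s j)), (i = j + 1 -> a <= i ->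
  [/\ forall c, stage_cycle (s j) (c *m D),
      forall c, stage_map (s j) (c *m D) = diff X i j (stage_map (s i) c),
      forall g x, stage_cycle (s j) g -> stage_map (s j) g = diff X i j x ->
        exists c, c *m D = g /\ stage_map (s i) c = x
    & forall c, stage_cycle (s i) c <-> c *m D = 0]) /\
  (~ (i = j + 1 /\ a <= i) -> D = 0).
  have [[ij ai]|] := pselect (i = j + 1 /\ a <= i); last by move=> n; exists 0;
    split=> // ij ai; case: n.
  have [D DE] := sE j i ij (ltac:(lia)); by exists D;
    split=> // /(_ (conj ij ai)).
pose D i j := sval (cid (ex i j)).
have DE i j : i = j + 1 -> a <= i -> _ := (svalP (cid (ex i j))).1.
have D0 i j : ~ (i = j + 1 /\ a <= i) -> D i j = 0 := (svalP (cid (ex i j))).2.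
have Dshape i j : i != j + 1 -> D i j = 0.
  by move=> /eqP ij; apply: D0 => -[].
have DK i j k : D i j *m D j k = 0.
  have [[jk ak]|] := pselect (j = k + 1 /\ a <= j); last by move=> /D0 ->;
    rewrite mulmx0.
  have [[ij ai]|] := pselect (i = j + 1 /\ a <= i); last by move=> /D0 ->;
    rewrite mul0mx.
  apply/row_matrixP => l; rewrite row0 rowE mulmxA.
  by have [_ _ _ /(_ _)<-] := DE j k jk ak; case: (DE i j ij ai).
pose G := MComplex Dshape DK.
have fC i j v : stage_map (s j) (diff (complex_of G) i j v) = diff X i j
  (stage_map (s i) v).
  have [ij|ij] := eqVneq i (j + 1); last by rewrite !diff_shape ?linear0.
  have [ia|ai] := ltP i a; last by case: (DE i j ij ai) => _ ->.
  by rewrite (s0 i v ia) !linear0.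
exists G; split=> [i ia|]; first by rewrite /= sd //; lia.
exists (@ChainMap S (complex_of G) X (fun i => stage_map (s i)) fC) => i.
split=> [g|w cw].
  have [ia|ai] := ltP i a; first by rewrite (s0 i g ia) => _ _;
    apply: boundary0.
  rewrite /cycle complex_ofE => cg [x xE].
  have [_ _ _ /(_ g)[_ Zg]] := DE i (i - 1) (ltac:(lia)) ai.
  have [_ _ ex1 _] := DE (i + 1) i erefl (ltac:(lia)).
  by have [c [<- _]] := ex1 g x (Zg cg) xE; exists c.
have [ia|ai] := ltP i a.
  exists 0; first by rewrite /cycle linear0.
  by rewrite linear0 subr0; apply: X_below.
have [_ _ ex1 _] := DE i (i - 1) (ltac:(lia)) ai.
have [] := ex1 0 w.
- by have [] := sQ (i - 1); first lia.
- by rewrite linear0.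
- move=> c [c0 cw']; exists c; first exact: c0.
  by rewrite [X in w - X]cw' subrr; apply: boundary0.
Qed.

End ProjectiveResolution.

(** * Bounded above resolutions by injective modules *)

Section InjectiveResolution.
Variables (X : complex S) (a : int).
Hypothesis X_above : forall i, a < i -> homology_zero X i.

(* An injective module with a map from X_i and its submodule of boundaries. *)
Let costage i : Type :=
  {I : lmodType S & ({linear X i -> I} * (I -> Prop))%type}.
Let costage_map i (t : costage i) := (tagged t).1.
Let costage_boundary i (t : costage i) := (tagged t).2.
Arguments costage_map {i} t.
Arguments costage_boundary {i} t.
Let costage_good i (t : costage i) :=
  injective_module (tag t) /\ submod (costage_boundary t).
Arguments costage_good {i} t.
Let costage_props i j (t : costage i) (t' : costage j) (d : {linear tag t ->
  tag t'}) :=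
  [/\ forall e, costage_boundary t e -> d e = 0,
      forall x, d (costage_map t x) = costage_map t' (diff X i j x),
      forall e x, d e = costage_map t' x ->
        exists b y, [/\ costage_boundary t b, e = b + costage_map t y & x =
          diff X i j y]
    & forall e, costage_boundary t' e <-> exists e', e = d e'].
Arguments costage_props {i j} t t' d.

(** The dual construction: the pushout, along [X i], of [X j] and the quotient of [I] by its
    boundaries, embedded into an injective module. *)
Let costage_step i j (t : costage i) : costage_good t ->
  exists t' : costage j, costage_good t' /\ exists d, costage_props t t' d.
Proof.
case: t => I [f B] [/= Ii hB].
pose rel (u : (I * X j)%type) :=
  exists b y, [/\ B b, u.1 = b + f y & u.2 = - diff X i j y].
have hrel : submod rel.
  have [B0 BL] := hB; split=> [|c u v [b [y [Bb uE vE]]] [b' [y' [Bb' uE'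
    vE']]]].
    by exists 0, 0; rewrite !linear0 addr0.
  exists (c *: b + b'), (c *: y + y'); split; first exact: BL.
    by rewrite /= uE uE' linearP scalerDr addrACA.
  by rewrite /= vE vE' linearP opprD scalerN.
have [E [iota [Ei iotaI]]] := enough_injectives (quom hrel).
pose p : {linear (I * X j)%type -> E} := lcomp iota (quom_pi hrel).
have p0 u : p u = 0 <-> rel u.
  split=> [pu|/(quom_pi0 hrel u).2 e]; last exact: etrans (congr1 iota e)
    (linear0 _).
  by apply/(quom_pi0 hrel u)/iotaI; rewrite linear0.
pose d : {linear I -> E} := lcomp p (lpair idfun (lzero _ _)).
pose f' : {linear X j -> E} := lcomp p (lpair (lzero _ _) idfun).
exists (existT _ E (f', fun e => exists e', e = d e')); split.
  split=> //=; split=> [|c _ _ [e ->] [e' ->]]; first by exists 0;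
    apply/esym/(linear0 d).
  by exists (c *: e + e'); apply/esym/(linearP d).
have dE e x : d e - f' x = p (e, - x).
  have -> : (e, - x) = (e, 0) - (0, x) :> (I * X j)%type.
    by apply: injective_projections; rewrite /= ?subr0 ?sub0r.
  exact/esym/(linearB p).
exists d; split=> //= [b Bb|x|e x dex].
- by apply/p0; exists b, 0; rewrite !linear0 addr0 ?oppr0.
- apply/subr0_eq; rewrite dE; apply/p0; exists 0, x.
  by rewrite add0r; split=> //; case: hB.
- have /p0[b [y [/= Bb eE xE]]] : p (e, - x) = 0.
    by rewrite -dE; apply/eqP; rewrite subr_eq0; apply/eqP/dex.
  by exists b, y; split=> //; apply: oppr_inj.
Qed.

Theorem injective_resolution_exists : exists (I : complex S) (f : chain_map X
  I),
  injective_resolution f.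
Proof.
have zero_inj : injective_module 'rV[S]_0.
  by move=> A B u g _; exists (lzero _ _) => x;
    apply: etrans (thinmx0 _) (esym (thinmx0 _)).
have [|i j t ij ia|s [sd sQ sE]] := @int_choice_down costage
  (fun i => existT _ ('rV[S]_0 : lmodType S) (lzero _ _, fun=> True)) (a + 1)
  (fun i t => costage_good t) (fun i j t t' => exists d, costage_props t t' d).
- by [].
- exact: costage_step.
have s0 i (e : tag (s i)) : a < i -> e = 0.
  move=> ai; move: e; rewrite sd; last lia.
  by move=> e; apply: thinmx0.
have ex i j : exists d : {linear tag (s i) -> tag (s j)},
  (i = j + 1 -> i <= a + 1 -> costage_props (s i) (s j) d) /\
  (~ (i = j + 1 /\ i <= a + 1) -> forall e, d e = 0).
  have [[ij ai]|n] := pselect (i = j + 1 /\ i <= a + 1); last first.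
    by exists (lzero _ _); split=> // ij ai; case: n.
  by have [d dE] := sE i j ij ai; exists d; split=> // /(_ (conj ij ai)).
pose d i j := sval (cid (ex i j)).
have dE i j : i = j + 1 -> i <= a + 1 -> _ := (svalP (cid (ex i j))).1.
have d0 i j : ~ (i = j + 1 /\ i <= a + 1) -> forall e, d i j e = 0 :=
  (svalP (cid (ex i j))).2.
have dshape i j : i != j + 1 -> forall e, d i j e = 0.
  by move=> /eqP ij; apply: d0 => -[].
have dK i j k e : d j k (d i j e) = 0.
  have [[jk ja]|/d0 -> //] := pselect (j = k + 1 /\ j <= a + 1).
  have [[ij ia]|/d0 ->] := pselect (i = j + 1 /\ i <= a + 1);
    last by rewrite linear0.
  have [H _ _ _] := dE j k jk ja; apply: H.
  by have [_ _ _ H] := dE i j ij ia; apply/H; exists e.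
pose I := @Complex S (fun i => tag (s i)) d dshape dK.
have fC i j v : costage_map (s j) (diff X i j v) = diff I i j (costage_map (s
  i) v).
  have [ij|ij] := eqVneq i (j + 1); last by rewrite !diff_shape ?linear0.
  have [ia|ai] := leP i (a + 1); first by case: (dE i j ij ia) => _ ->.
  by rewrite [LHS]s0 ?[RHS]s0 //; lia.
have Ii i : injective_module (I i).
  have [ia|ai] := leP i (a + 1); first by have [] := sQ i ia.
  by rewrite /= sd //; lia.
exists I, (@ChainMap S X I (fun i => costage_map (s i)) fC); split=> // [i|].
  split=> [v cv [w /= vE]|w cw].
    have [ia|ai] := leP i a; last exact: X_above.
    have [_ _ H _] := dE (i + 1) i erefl (ltac:(lia)).
    by have [b [y [_ _ ->]]] := H w v (esym vE); exists y.
  have [ia|ai] := leP i a; last first.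
    exists 0; first by rewrite /cycle linear0.
    by rewrite [_ - _]s0 //; apply: boundary0.
  have [_ _ H _] := dE i (i - 1) (ltac:(lia)) (ltac:(lia)).
  have [|b [y [Bb wE yE]]] := H w 0; first by rewrite linear0.
  exists y; first by rewrite /cycle -yE.
  have [_ _ _ /(_ b)[/(_ Bb)[e bE] _]] := dE (i + 1) i erefl (ltac:(lia)).
  by exists e; rewrite /= wE addrK.
exact: (kinj_bounded Ii s0).
Qed.

End InjectiveResolution.

End BoundedResolutions.

(** * Tensor products of complexes *)

Section FreeModule.
Variables (S : comNzRingType) (A : choiceType).
Implicit Types M : lmodType S.

Let terms (s : seq (S * A)) : A -> S := fun a => \sum_(p <- s | p.2 == a) p.1.
(** The finitely supported functions, described as the coefficient functions of lists of terms. *)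
Let span (f : A -> S^o) := exists s, f = terms s.

Let span_submod : submod span.
Proof.
split=> [|a f g [s ->] [s' ->]].
  by exists [::]; apply/funext => a; rewrite /terms big_nil.
exists ([seq (a * p.1, p.2) | p <- s] ++ s'); apply/funext => b.
by rewrite /terms big_cat big_map /= -mulr_sumr.
Qed.

Definition free_module : lmodType S := subm span_submod.

Fact free_gen_span a : span (fun b => (a == b)%:R).
Proof.
by exists [:: (1, a)]; apply/funext => b; rewrite /terms big_cons big_nil /=
  addr0; case: eqP.
Qed.
Definition free_gen (a : A) : free_module := exist _ _ (free_gen_span a).

(** The value at a function is computed from a list representing it, and [sum_terms_eq0] makes it
    independent of the list. *)
Lemma free_rec M (b : A -> M) :
  exists g : {linear free_module -> M}, forall a, g (free_gen a) = b a.
Proof.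
have /choice[s sE] (f : free_module) : exists s, subm_val span_submod f = terms
  s.
  exact: (subm_valP f).
pose g f := \sum_(p <- s f) p.1 *: b p.2.
have gE f s' : subm_val span_submod f = terms s' ->
  g f = \sum_(p <- s') p.1 *: b p.2.
  move=> e; apply/subr0_eq; rewrite /g -sumrN.
  have := @sum_terms_eq0 S A M b (s f ++ [seq (- p.1, p.2) | p <- s']).
  rewrite big_cat big_map /= => H; rewrite -[RHS]H.
    by congr (_ + _); apply: eq_bigr => p _; rewrite scaleNr.
  move=> a; rewrite big_cat big_map /= sumrN.
  by have := congr1 (fun h => h a) (etrans (esym (sE f)) e) => /= ;
    rewrite /terms => ->; rewrite subrr.
have gL : linear g.
  move=> c f h; rewrite (gE _ ([seq (c * p.1, p.2) | p <- s f] ++ s h)).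
    rewrite big_cat big_map scaler_sumr; congr (_ + _).
    by apply: eq_bigr => p _; rewrite scalerA.
  rewrite linearP !sE; apply/funext => a.
  by rewrite /terms big_cat big_map /= -mulr_sumr.
exists (lin gL) => a; rewrite [LHS](gE _ [:: (1, a)]).
  by rewrite big_cons big_nil scale1r addr0.
by apply/funext => b'; rewrite /terms big_cons big_nil /= addr0; case: eqP.
Qed.

Lemma free_ext M (g h : {linear free_module -> M}) :
  (forall a, g (free_gen a) = h (free_gen a)) -> g =1 h.
Proof.
move=> gh f; have [s sE] := subm_valP (hP := span_submod) f.
have -> : f = \sum_(p <- s) p.1 *: free_gen p.2.
  apply: (@subm_val_inj _ _ _ span_submod); rewrite sE linear_sum.
  apply/funext => a; rewrite fct_sumE /terms big_mkcond; apply: eq_bigr => p _.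
  by rewrite linearZ /= fctE; case: eqP; rewrite ?scaler0 // /GRing.scale /=
    mulr1.
by rewrite !linear_sum; apply: eq_bigr => p _; rewrite !linearZ /= gh.
Qed.

End FreeModule.

Section Tensor.
Variable S : comNzRingType.
Implicit Types (X Y T : complex S) (M : lmodType S).

(** The body of [is_tensor_complex], with the structure maps [t] exposed. *)
Definition tensor_of X Y T (t : forall i j n : int, X i -> Y j -> T n) :=
  [/\ forall i j n : int, i + j = n -> is_bilinear (t i j n),
      forall (i j n : int) (x : X i) (y : Y j), i + j = n ->
        diff T n (n - 1) (t i j n x y) =
          t (i - 1) j (n - 1) (diff X i (i - 1) x) y
          + (-1) ^+ `|i|%N *: t i (j - 1) (n - 1) x (diff Y j (j - 1) y)
    & forall (n : int) M (b : forall i j : int, X i -> Y j -> M),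
        (forall i j : int, i + j = n -> is_bilinear (b i j)) ->
        let factors (g : {linear T n -> M}) :=
          forall (i j : int) (x : X i) (y : Y j),
            i + j = n -> g (t i j n x y) = b i j x y in
        exists2 g, factors g & forall g', factors g' -> g' =1 g].

Lemma bilinear0l (U V M : lmodType S) (b : U -> V -> M) v : is_bilinear b ->
  b 0 v = 0.
Proof. by move=> [_ bL]; exact: (linear0 (lin (bL v))). Qed.

Lemma bilinear0r (U V M : lmodType S) (b : U -> V -> M) u : is_bilinear b ->
  b u 0 = 0.
Proof. by move=> [bR _]; exact: (linear0 (lin (bR u))). Qed.

Lemma bilinear_comp (U V M N : lmodType S) (b : U -> V -> M) (g : {linear M ->
  N}) :
  is_bilinear b -> is_bilinear (fun u v => g (b u v)).
Proof.
by move=> [bR bL]; split=> [u a v w|v a u w]; rewrite ?bR ?bL linearP.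
Qed.

Lemma bilinear_precomp (U V U' V' M : lmodType S) (b : U -> V -> M)
    (f : {linear U' -> U}) (g : {linear V' -> V}) :
  is_bilinear b -> is_bilinear (fun u v => b (f u) (g v)).
Proof.
by move=> [bR bL]; split=> [u a v w|v a u w]; rewrite linearP ?bR ?bL.
Qed.

Lemma bilinear_add (U V M : lmodType S) (a : S) (b b' : U -> V -> M) :
  is_bilinear b -> is_bilinear b' -> is_bilinear (fun u v =>
    b u v + a *: b' u v).
Proof.
move=> [bR bL] [bR' bL']; split=> [u c v w|v c u w].
  by rewrite bR bR' !scalerDr addrACA !scalerA [a * c]mulrC.
by rewrite bL bL' !scalerDr addrACA !scalerA [a * c]mulrC.
Qed.

Lemma bilinear_scale (U V M : lmodType S) (a : S) (b : U -> V -> M) :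
  is_bilinear b -> is_bilinear (fun u v => a *: b u v).
Proof.
move=> [bR bL]; split=> [u c v w|v c u w].
  by rewrite bR !scalerDr !scalerA [a * c]mulrC.
by rewrite bL !scalerDr !scalerA [a * c]mulrC.
Qed.

Lemma bilinear_zero (U V M : lmodType S) : is_bilinear (fun (u : U) (v : V) =>
  0 : M).
Proof. by split=> [u|v] a w z; rewrite scaler0 addr0. Qed.

Lemma tensor_ext X Y T t n M (g h : {linear T n -> M}) : @tensor_of X Y T t ->
  (forall i j x y, i + j = n -> g (t i j n x y) = h (t i j n x y)) -> g =1 h.
Proof.
move=> [tb _ tu] gh; have [|k _ kU] := tu n M (fun i j x y => h (t i j n x y)).
  by move=> i j /tb; apply: bilinear_comp.
by move=> w; rewrite (kU g gh) (kU h).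
Qed.

Section Existence.
Variables X Y : complex S.

Let gens : choiceType := {p : int * int & (X p.1 * Y p.2)%type}.
Let gen i j (x : X i) (y : Y j) : gens :=
  existT (fun p : int * int => (X p.1 * Y p.2)%type) (i, j) (x, y).
Let good n M (b : gens -> M) :=
  (forall i j, i + j = n -> is_bilinear (fun (x : X i) (y : Y j) =>
    b (gen x y))) /\
  (forall i j (x : X i) (y : Y j), i + j <> n -> b (gen x y) = 0).
(** Instead of being generated by a list of identities, the relations are the common kernel of all
    maps induced by bilinear families in total degree [n]. The universal property is then nearly
    immediate. *)
Let relation n (f : free_module S gens) :=
  forall M (b : gens -> M) (g : {linear free_module S gens -> M}),
    good n b -> (forall a, g (free_gen S a) = b a) -> g f = 0.
Let relation_submod n : submod (relation n).
Proof.
split=> [M b g _ _|a u v ru rv M b g bn gb]; first by rewrite linear0.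
by rewrite linearP (ru M b g) // (rv M b g) // scaler0 addr0.
Qed.
Let T n : lmodType S := quom (relation_submod n).
Let t i j n (x : X i) (y : Y j) : T n := quom_pi (relation_submod n) (free_gen
  S (gen x y)).
Arguments t : clear implicits.

Let t_bilinear i j n : i + j = n -> is_bilinear (t i j n).
Proof.
move=> ijn; have P := quom_pi0 (relation_submod n).
split=> [x a y z|y a x z]; apply/subr0_eq; rewrite /t -linearP -linearB;
  apply/P.
  move=> M b g [bn _] gb; rewrite linearB linearP !gb;
    have [bR _] := bn i j ijn.
  by rewrite bR subrr.
move=> M b g [bn _] gb; rewrite linearB linearP !gb; have [_ bL] := bn i j ijn.
by rewrite bL subrr.
Qed.

Let t_univ (n : int) M (b : forall i j : int, X i -> Y j -> M) :
  (forall i j : int, i + j = n -> is_bilinear (b i j)) ->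
  let factors (g : {linear T n -> M}) :=
    forall (i j : int) (x : X i) (y : Y j), i + j = n ->
      g (t i j n x y) = b i j x y in
  exists2 g, factors g & forall g', factors g' -> g' =1 g.
Proof.
move=> bb factors.
pose b' (a : gens) : M := if (tag a).1 + (tag a).2 == n then b _ _ (tagged a).1
  (tagged a).2 else 0.
have b'n : good n b'.
  split=> i j => [ijn|x y /eqP ijn]; rewrite /b' /= ?ijn ?eqxx; first exact: bb.
  by rewrite (negbTE ijn).
have [g gE] := free_rec b'.
have [||h hE] := factor_surjective (f := quom_pi (relation_submod n)) (g := g).
- exact: quom_pi_surj.
- by move=> u /quom_pi0 ru; apply: (ru M b').
have hf : factors h.
  by move=> i j x y ijn; rewrite /t hE gE /b' /= ijn eqxx.
exists h => // g' g'f w; have [u <-] := quom_pi_surj w.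
apply: (free_ext (g := lcomp g' (quom_pi (relation_submod n)))
                 (h := lcomp h (quom_pi (relation_submod n)))) =>
                   -[[i j] [x y]] /=.
rewrite -/(gen x y); have [ijn|/eqP ijn] := eqVneq (i + j) n;
  first exact: etrans (g'f i j x y ijn) (esym (hf i j x y ijn)).
have -> : quom_pi (relation_submod n) (free_gen S (gen x y)) = 0.
  by apply/quom_pi0 => N c k [_ cn] kc; rewrite kc cn.
by rewrite !linear0.
Qed.

Let Tdiff_exists n k : exists d : {linear T n -> T k},
  (n = k + 1 -> forall i j x y, i + j = n -> d (t i j n x y) =
     t (i - 1) j k (diff X i (i - 1) x) y + sg S i *: t i (j - 1) k x (diff Y j
       (j - 1) y)) /\
  (n != k + 1 -> forall v, d v = 0).
Proof.
have [nk|nk] := eqVneq n (k + 1); last first.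
  by exists (lzero _ _); split=> // e; case/eqP: nk.
have [|d dE _] := @t_univ n (T k) (fun i j x y =>
  t (i - 1) j k (diff X i (i - 1) x) y + sg S i *: t i (j - 1) k x (diff Y j (j
    - 1) y)).
  move=> i j ijn; apply: bilinear_add.
    by apply: (bilinear_precomp (diff X i (i - 1)) idfun); apply: t_bilinear;
      lia.
  by apply: (bilinear_precomp idfun (diff Y j (j - 1))); apply: t_bilinear; lia.
by exists d; split=> // _ i j x y; apply: dE.
Qed.

Let Tdiff n k : {linear T n -> T k} := sval (cid (Tdiff_exists n k)).
Let TdiffE n k i j x y : n = k + 1 -> i + j = n -> Tdiff n k (t i j n x y) =
  t (i - 1) j k (diff X i (i - 1) x) y + sg S i *: t i (j - 1) k x (diff Y j (j
    - 1) y).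
Proof. by move=> nk; apply: (svalP (cid (Tdiff_exists n k))).1. Qed.
Let Tdiff_shape n k : n != k + 1 -> forall v, Tdiff n k v = 0.
Proof. exact: (svalP (cid (Tdiff_exists n k))).2. Qed.

Let TdiffK n k l v : Tdiff k l (Tdiff n k v) = 0.
Proof.
have [nk|nk] := eqVneq n (k + 1); last first.
  by rewrite (Tdiff_shape nk) linear0.
have [kl|kl] := eqVneq k (l + 1); last by rewrite Tdiff_shape.
have [g _ gU] := @t_univ n (T l) (fun _ _ _ _ => 0) (fun _ _ _ =>
  @bilinear_zero _ _ _).
have E : lcomp (Tdiff k l) (Tdiff n k) =1 g.
  apply: gU => i j x y ijn; rewrite /= TdiffE // linearD linearZ /= !TdiffE;
    try lia.
  rewrite !diffK (bilinear0l _ (t_bilinear _)) ?(bilinear0r _ (t_bilinear _));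
    try lia.
  by rewrite scaler0 addr0 add0r (@sgS _ i (i - 1)) ?scaleNr ?addrN //; lia.
rewrite [LHS](E v); apply/esym.
have zf : forall i j (x : X i) (y : Y j), i + j = n ->
  lzero _ (T l) (t i j n x y) = 0 by [].
exact: (gU _ zf v).
Qed.

Lemma tensor_exists : exists T t, @tensor_of X Y T t.
Proof.
exists (Complex Tdiff_shape TdiffK), t; split=> [i j n|i j n x y ijn|];
  first exact: t_bilinear.
  by apply: TdiffE; lia.
exact: t_univ.
Qed.

End Existence.

(** With the Koszul sign [s i j], the same complex [T] serves for the factors in the other order. *)
Lemma tensor_swap X Y T t : @tensor_of X Y T t -> exists t',
  @tensor_of Y X T t'.
Proof.
pose s i j : S := (-1) ^+ (`|i| * `|j|).
have sK i j : s i j * s i j = 1 by rewrite -expr2 -exprM mulnC exprM sqrrN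
  !expr1n.
have ss i j i' : i = i' + 1 -> s i j = sg S j * s i' j.
  move=> ->; rewrite /s /sg -exprD -[LHS]signr_odd -[RHS]signr_odd.
  by congr ((-1) ^+ nat_of_bool _); rewrite oddD !oddM; case: (odd `|j|); lia.
have sC i j : s i j = s j i by rewrite /s mulnC.
move=> [tb td tu]; exists (fun j i n y x => s i j *: t i j n x y); split.
- move=> j i n jin; have [bR bL] : is_bilinear (fun x y =>
  s i j *: t i j n x y).
    by apply/bilinear_scale/tb; lia.
  by split.
- move=> j i n y x jin; rewrite linearZ /= td; last lia.
  rewrite scalerDr [LHS]addrC; congr (_ + _).
    rewrite (sC i j) (@ss j i (j - 1)) -/(sg S i) ?scalerA; try lia.
    by congr (_ *: _); rewrite mulrAC sgK mul1r sC.
  rewrite (@ss i j (i - 1)) ?scalerA //; lia.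
move=> n M b bb factors.
have [i j ijn|g gE gU] := tu n M (fun i j x y => s i j *: b j i y x).
  have [bR bL] : is_bilinear (fun x y => s i j *: b j i x y).
    by apply/bilinear_scale/bb; lia.
  by split.
exists g => [j i y x jin|g' g'E]; first by rewrite linearZ /= gE ?scalerA ?sK
  ?scale1r //; lia.
apply: gU => i j x y ijn; rewrite -(g'E j i y x); last lia.
by rewrite linearZ /= scalerA sK scale1r.
Qed.

Lemma tensor_map X A B TA TB tA tB (u : chain_map A B) :
  @tensor_of X A TA tA -> @tensor_of X B TB tB ->
  exists U : chain_map TA TB, forall i j n x y, i + j = n ->
    U n (tA i j n x y) = tB i j n x (u j y).
Proof.
move=> hA [bB dB _]; have [_ dA uA] := hA.
have ex n : exists g : {linear TA n -> TB n}, forall i j x y, i + j = n ->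
    g (tA i j n x y) = tB i j n x (u j y).
  have [|g gE _] := uA n (TB n) (fun i j x y => tB i j n x (u j y));
    last by exists g.
  by move=> i j /bB; apply: (bilinear_precomp idfun (u j)).
pose U n := sval (cid (ex n)).
have UE n : _ := svalP (cid (ex n)).
have UC n k v : U k (diff TA n k v) = diff TB n k (U n v).
  have [nk|nk] := eqVneq n (k + 1); last by rewrite !diff_shape ?linear0.
  have {nk}-> : k = n - 1 by lia.
  move: v; apply: (tensor_ext (g := lcomp (U (n - 1)) (diff TA n (n - 1)))
    (h := lcomp (diff TB n (n - 1)) (U n)) hA) => i j x y ijn /=.
  rewrite dA // linearD linearZ /= !UE; try lia.
  by rewrite dB // chain_comm.
by exists (ChainMap UC) => i j n x y; apply: UE.
Qed.

End Tensor.

(** * Flatness *)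

Section Flatness.
Variable S : comNzRingType.
Implicit Types (A B Y P T : complex S) (M E : lmodType S).

(** Embed the quotient by [Q] into an injective module. *)
Lemma separate_submodule M (Q : M -> Prop) v : submod Q -> ~ Q v ->
  exists E (phi : {linear M -> E}), [/\ injective_module E, forall w, Q w ->
    phi w = 0
    & phi v <> 0].
Proof.
move=> hQ nQv; have [E [f [Ei fI]]] := enough_injectives (quom hQ).
exists E, (lcomp f (quom_pi hQ)); split=> // [w /quom_pi0 e|/eqP /=].
  by rewrite /= e linear0.
by rewrite raddf_eq0 // => /eqP/quom_pi0.
Qed.

(** The hypotheses say that [u] is surjective and injective on the cohomology of Hom(-, [E]). An
    element violating the conclusion would be separated from a submodule of good elements by a map
    to some injective [E]. *)
Lemma quasi_iso_by_injectives A B (u : chain_map A B) :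
  (forall E n (phi : {linear A n -> E}), injective_module E ->
     (forall v, phi (diff A (n + 1) n v) = 0) ->
     exists (phi' : {linear B n -> E}) (psi : {linear A (n - 1) -> E}),
       (forall w, phi' (diff B (n + 1) n w) = 0) /\
       forall v, phi v = phi' (u n v) + psi (diff A n (n - 1) v)) ->
  (forall E n (phi : {linear B n -> E}) (psi : {linear A (n - 1) -> E}),
    injective_module E ->
     (forall w, phi (diff B (n + 1) n w) = 0) ->
     (forall v, phi (u n v) = psi (diff A n (n - 1) v)) ->
     exists psi' : {linear B (n - 1) -> E}, forall w,
       phi w = psi' (diff B n (n - 1) w)) ->
  quasi_iso u.
Proof.
move=> H1 H2 n; split=> [v cv bv|w cw].
  apply: contrapT => nbv.
  have [E [phi [Ei phib phiv]]] := separate_submodule (submod_boundary A n) nbv.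
  have [|phi' [psi [phi'b phiE]]] := H1 E n phi Ei.
    by move=> x; apply: phib; exists x.
  apply: phiv; rewrite phiE (cv : diff _ _ _ v = 0) linear0 addr0.
  by case: bv => x ->.
pose Q (w : B n) := exists2 v : A n, cycle v & boundary (w - u n v).
have hQ : submod Q.
  have [B0 BL] := submod_boundary B n; have [Z0 ZL] := submod_cycle A n.
  split=> [|a x y [v cv bv] [v' cv' bv']].
    by exists 0; [exact: Z0 | rewrite linear0 subr0; exact: B0].
  exists (a *: v + v'); first exact: ZL.
  by rewrite linearP opprD addrACA -scalerBr; apply: BL.
apply: contrapT => nQw; have [E [phi [Ei phiQ phiw]]] :=
  separate_submodule hQ nQw.
have phib x : phi (diff B (n + 1) n x) = 0.
  apply: phiQ; exists 0; first by rewrite /cycle linear0.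
  by rewrite linear0 subr0; exists x.
have phic v : cycle v -> phi (u n v) = 0.
  by move=> cv; apply: phiQ; exists v => //; rewrite subrr; apply: boundary0.
have [psi psiE] := injective_extend (d := diff A n (n - 1)) (u :=
  lcomp phi (u n)) Ei phic.
have [psi' phiE] := H2 E n phi psi Ei phib (fun v => esym (psiE v)).
by apply: phiw; rewrite phiE (cw : diff _ _ _ w = 0) linear0.
Qed.

Section HomComplex.
Variables (Y : complex S) (E : lmodType S) (n : int).

(** The complex Hom([Y], [E]), indexed so that a map from [P i] to [obj i] is a bilinear form on
    [P i] and [Y (n - i)], that is, a component of a form on degree [n] of the tensor product. *)
Let obj i : lmodType S := lhom (Y (n - i)) E.
Fact hom_diff_linear i j : linear (fun u : obj i =>
  to_hom (lscale (- sg S i) (lcomp (hom_app u) (diff Y (n - j) (n - i)))) : obj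
    j).
Proof.
move=> a u v; apply: hom_ext => y; pose z := diff Y (n - j) (n - i) y.
transitivity (- sg S i *: (a *: hom_app u z + hom_app v z)); first by [].
by rewrite scalerDr scalerA mulrC -scalerA.
Qed.
Let d i j : {linear obj i -> obj j} := lin (@hom_diff_linear i j).
Let dE i j u y : hom_app (d i j u) y = - sg S i *: hom_app u (diff Y (n - j) (n
  - i) y).
Proof. by []. Qed.
Let d_shape i j : i != j + 1 -> forall u, d i j u = 0.
Proof.
move=> /eqP ij u; apply: hom_ext => y; rewrite dE diff_shape ?linear0 ?scaler0
  //.
by apply/eqP; lia.
Qed.
Let dK i j k u : d j k (d i j u) = 0.
Proof. by apply: hom_ext => y; rewrite !dE diffK linear0 !scaler0. Qed.
Definition hom_complex : complex S := Complex d_shape dK.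

Lemma hom_complexE i j (u : hom_complex i) y :
  hom_app (diff hom_complex i j u) y = - sg S i *: hom_app u (diff Y (n - j) (n
    - i) y).
Proof. by []. Qed.

End HomComplex.

Section HomMap.
Variables (A B : complex S) (u : chain_map A B) (E : lmodType S) (n : int).

Fact hom_map_linear i : linear (fun f : hom_complex B E n i =>
  to_hom (lcomp (hom_app f) (u (n - i))) : hom_complex A E n i).
Proof. by move=> a f g; apply: hom_ext. Qed.
Fact hom_map_comm i j v : lin (@hom_map_linear j) (diff (hom_complex B E n) i j
  v)
  = diff (hom_complex A E n) i j (lin (@hom_map_linear i) v).
Proof. by apply: hom_ext => y; rewrite !hom_complexE /= -chain_comm. Qed.
Definition hom_map : chain_map (hom_complex B E n) (hom_complex A E n) :=
  ChainMap hom_map_comm.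

Lemma hom_mapE i f y : hom_app (hom_map i f) y = hom_app f (u (n - i) y).
Proof. by []. Qed.

Lemma hom_map_quasi_iso : injective_module E -> quasi_iso u ->
  quasi_iso hom_map.
Proof.
move=> Ei uq i; have [uI uS] := uq (n - i).
have ZK (Y : complex S) (f : hom_complex Y E n i) : cycle f <->
    forall y : Y (n - i), boundary y -> hom_app f y = 0.
  have e : n - (i - 1) = n - i + 1 by lia.
  split=> [cf _ [y ->]|fb].
    have := congr1 (fun g => hom_app g (cast Y _ (n - (i - 1)) y)) cf.
    rewrite hom_complexE diff_cast // => /(congr1 (fun w => - sg S i *: w)).
    by rewrite !scaleNr scalerN opprK sgZK scaler0 oppr0.
  by apply: hom_ext => y; rewrite hom_complexE fb ?scaler0 //;
    apply: boundary_diff.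
split=> [f /ZK cf [g fE]|f /ZK cf].
  have gE v : hom_app f (u (n - i) v) =
      - sg S (i + 1) *: hom_app g (diff A (n - i) (n - (i + 1)) v).
    by rewrite -hom_mapE fE hom_complexE.
  have [h hE] : exists h : {linear B (n - i - 1) -> E},
      forall w, h (diff B (n - i) (n - i - 1) w) = hom_app f w.
    apply: injective_extend => // w cw; have [v cv bv] := uS w cw.
    rewrite -[w](subrK (u (n - i) v)) linearD cf // add0r gE.
    by rewrite ((cycleE v).1 cv) linear0 scaler0.
  have e : n - (i + 1) = n - i - 1 by lia.
  exists (to_hom (lscale (- sg S (i + 1)) (lcomp h (cast B (n - (i + 1)) (n - i
    - 1))))).
  apply: hom_ext => w; rewrite hom_complexE hom_appE /= cast_diff // hE.
  by rewrite !scaleNr scalerN opprK sgZK.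
have hZ := submod_cycle A (n - i).
(* A preimage [h] of [f] is prescribed on the image of [r]: it is [f] on images of cycles and zero
   on boundaries. Injectivity of [u] on homology makes this consistent, and injectivity of [E]
   extends it. *)
pose r : {linear (subm hZ * B (n - i + 1)%R)%type -> B (n - i)} := 
  ladd (lcomp (u (n - i)) (lcomp (subm_val hZ) fst)) (lcomp (diff B (n - i + 1)
    (n - i)) snd).
have [|h hE] := @injective_extend S _ _ E r (lcomp (hom_app f) (lcomp (subm_val
  hZ) fst)) Ei.
  move=> [z y] /= e; apply: cf; apply: uI; first exact: (subm_valP z).
  by exists (- y); rewrite linearN; apply/eqP; rewrite -addr_eq0 e.
have hb y : boundary y -> h y = 0.
  move=> [y' ->]; have rE : r (0, y') = diff B (n - i + 1) (n - i) y'.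
    transitivity (u (n - i) (subm_val hZ 0) + diff B (n - i + 1) (n - i) y') =>
      //.
    by rewrite !linear0 add0r.
  transitivity (hom_app f (subm_val hZ 0)); first by rewrite -rE hE.
  by rewrite !linear0.
have hu z : cycle z -> h (u (n - i) z) = hom_app f z.
  move=> cz; have [z' <-] := subm_val_surj hZ cz.
  have rE : r (z', 0) = u (n - i) (subm_val hZ z').
    transitivity (u (n - i) (subm_val hZ z') + diff B (n - i + 1) (n - i) 0) =>
      //.
    by rewrite linear0 addr0.
  by rewrite -rE hE.
exists (to_hom h); first by apply/ZK.
have [|psi psiE] := injective_extend (d := diff A (n - i) (n - i - 1))
    (u := ladd (hom_app f) (lscale (-1) (lcomp h (u (n - i))))) Ei.
  by move=> v cv; rewrite /= scaleN1r hu ?subrr.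
have e : n - (i + 1) = n - i - 1 by lia.
exists (to_hom (lscale (- sg S (i + 1)) (lcomp psi (cast A (n - (i + 1)) (n - i
  - 1))))).
apply: hom_ext => y; rewrite hom_complexE hom_appE /= cast_diff // psiE.
by rewrite /= scaleN1r !scaleNr scalerN opprK sgZK.
Qed.

End HomMap.

Lemma tensor_diff (X Y T : complex S) t : @tensor_of S X Y T t ->
  forall i j n i' j' n' x y, i + j = n -> i = i' + 1 -> j = j' + 1 ->
    n = n' + 1 ->
  diff T n n' (t i j n x y) =
    t i' j n' (diff X i i' x) y + sg S i *: t i j' n' x (diff Y j j' y).
Proof.
move=> [_ td _] i j n i' j' n' x y ijn ii jj nn.
have {ii}-> : i' = i - 1 by lia.
have {jj}-> : j' = j - 1 by lia.
have {nn}-> : n' = n - 1 by lia.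
exact: td.
Qed.

Lemma tensor_extr (X Y T : complex S) t n M (g h : {linear T n -> M}) :
  @tensor_of S X Y T t ->
  (forall i x y, g (t i (n - i) n x y) = h (t i (n - i) n x y)) -> g =1 h.
Proof.
move=> ht gh; apply: (tensor_ext ht) => i j x y ijn.
have e : j = n - i by lia.
by subst j.
Qed.

Lemma hom_complex_appD (Y : complex S) E n i (f g : hom_complex Y E n i) y :
  hom_app (f + g) y = hom_app f y + hom_app g y.
Proof. by []. Qed.

(** * Forms on a tensor product as maps to a Hom complex *)

Section Adjunction.
Variables (P Y T : complex S) (t : forall i j n : int, P i -> Y j -> T n).
Arguments t : clear implicits.
Hypothesis ht : tensor_of t.
Variables (E : lmodType S) (n : int).

Lemma hom_of_tensor m (psi : {linear T m -> E}) :
  exists h : hmap P (hom_complex Y E n), forall i k x y, i + (n - k) = m ->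
    hom_app (h i k x) y = psi (t i (n - k) m x y).
Proof.
have [i k|h hE] := @hmap_choice S P (hom_complex Y E n) (fun i k h =>
  i + (n - k) = m -> forall x y, hom_app (h x) y = psi (t i (n - k) m x y));
    last first.
  by exists h => i k x y e; apply: hE.
have [e|e] := pselect (i + (n - k) = m); last by exists (lzero _ _).
have [tb _ _] := ht; have [bR bL] := tb i (n - k) m e.
have L1 x : linear (fun y => psi (t i (n - k) m x y)).
  by move=> a y z; rewrite bR linearP.
have L2 : linear (fun x => to_hom (lin (L1 x)) : hom_complex Y E n k).
  by move=> a x z; apply: hom_ext => y; rewrite hom_appP !hom_appE /= bL
    linearP.
by exists (lin L2).
Qed.

Lemma tensor_of_hom m (h : hmap P (hom_complex Y E n)) :
  exists psi : {linear T m -> E}, forall i j k x y, i + j = m -> k = n - j ->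
    psi (t i j m x y) = hom_app (h i k x) (cast Y j (n - k) y).
Proof.
have [_ _ tu] := ht.
have [|psi psiE _] := tu m E
    (fun i j x y => hom_app (h i (n - j) x) (cast Y j (n - (n - j)) y)).
  move=> i j _; split=> [x a y z|y a x z]; first by rewrite !linearP.
  by rewrite linearP hom_appP.
by exists psi => i j k x y ijm ->; apply: psiE.
Qed.

(** Coboundaries become null homotopies. With [tensor_of_hom_cocycle] this identifies cohomology
    classes of forms on [T] with homotopy classes of chain maps from [P] to Hom([Y], [E]). *)
Lemma tensor_of_hom_diff (h : hmap P (hom_complex Y E n)) (psi : {linear T (n -
  1) -> E}) :
  (forall i j k x y, i + j = n - 1 -> k = n - j ->
    psi (t i j (n - 1) x y) = hom_app (h i k x) (cast Y j (n - k) y)) ->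
  forall i x y, psi (diff T n (n - 1) (t i (n - i) n x y)) =
    hom_app (diff (hom_complex Y E n) (i + 1) i (h i (i + 1) x)
             + h (i - 1) i (diff P i (i - 1) x)) y.
Proof.
move=> psiE i x y; rewrite hom_complex_appD hom_complexE.
rewrite (tensor_diff ht (i' := i - 1) (j' := n - i - 1)); try lia.
rewrite linearD linearZ /= (psiE _ _ i) ?(psiE _ _ (i + 1)) ?castxx; try lia.
rewrite cast_diff; last lia.
by rewrite (@sgS S (i + 1) i erefl) opprK [LHS]addrC.
Qed.

Lemma tensor_of_hom_cocycle (h : hmap P (hom_complex Y E n)) (phi : {linear T n
  -> E}) :
  (forall i j k x y, i + j = n -> k = n - j ->
    phi (t i j n x y) = hom_app (h i k x) (cast Y j (n - k) y)) ->
  (forall v, phi (diff T (n + 1) n v) = 0) <-> is_chain 0 h.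
Proof.
move=> phiE.
have E1 i i' x y : i = i' + 1 -> phi (diff T (n + 1) n (t i (n - i') (n + 1) x
  y)) =
    hom_app (h i' i' (diff P i i' x)) y - hom_app (diff (hom_complex Y E n) i
      i' (h i i x)) y.
  move=> ii; rewrite hom_complexE scaleNr opprK.
  rewrite (tensor_diff ht (i' := i') (j' := n - i)); try lia.
  by rewrite linearD linearZ /= (phiE _ _ i') ?(phiE _ _ i) ?castxx //; lia.
split=> [phid i j i' j' v ji ii jj|hc v].
  have {}ji : j = i by lia.
  have {}jj : j' = i' by lia.
  subst j j'; apply: hom_ext => y; apply/esym/subr0_eq.
  by rewrite -E1.
have := tensor_extr (g := lcomp phi (diff T (n + 1) n)) (h := lzero _ _) ht _ v.
apply=> i x y /=; have e : n + 1 - i = n - (i - 1) by lia.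
move: y; rewrite e => y; rewrite E1; last lia.
by rewrite (hc i i (i - 1) (i - 1)) ?subrr //; lia.
Qed.

End Adjunction.

(** Of the two conditions of [quasi_iso_by_injectives], the first comes from [kproj_lift] and the
    second from [kproj_null], both applied along Hom([u], [E]). *)
Theorem tensor_quasi_iso (P A B TA TB : complex S) tA tB (u : chain_map A B)
    (U : chain_map TA TB) :
  K_projective P -> quasi_iso u -> @tensor_of S P A TA tA ->
    @tensor_of S P B TB tB ->
  (forall i j n x y, i + j = n -> U n (tA i j n x y) = tB i j n x (u j y)) ->
  quasi_iso U.
Proof.
move=> Pk uq hA hB UE; apply: quasi_iso_by_injectives =>
  [E n phi Ei phid|E n phi psi Ei phid phiU].
  have [b bE] := hom_of_tensor hA n phi.
  have phiE i j k x y : i + j = n -> k = n - j ->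
      phi (tA i j n x y) = hom_app (b i k x) (cast A j (n - k) y).
    move=> ijn ->; rewrite bE; last by lia.
    have e : n - (n - j) = j by lia.
    by rewrite e castxx.
  have bc := (tensor_of_hom_cocycle hA phiE).1 phid.
  have [c [cc [h hE]]] := kproj_lift Pk (hom_map_quasi_iso n Ei uq) bc.
  have [phi' phi'E] := tensor_of_hom hB n c.
  have [psi psiE] := tensor_of_hom hA (n - 1) h.
  exists phi', psi; split; first exact: (tensor_of_hom_cocycle hB phi'E).2.
  apply: (tensor_extr (g := phi) (h := ladd (lcomp phi' (U n))
    (lcomp psi (diff TA n (n - 1)))) hA) => i x y.
  rewrite /= (tensor_of_hom_diff hA psiE) UE; last lia.
  rewrite (phi'E _ _ i) ?castxx; try lia.
  rewrite -hom_mapE (phiE _ _ i) ?castxx; try lia.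
  rewrite (hE i i (i - 1) (i + 1)); try lia.
  by rewrite hom_complex_appD.
have [b bE] := hom_of_tensor hB n phi.
have phiE i j k x y : i + j = n -> k = n - j ->
    phi (tB i j n x y) = hom_app (b i k x) (cast B j (n - k) y).
  move=> ijn ->; rewrite bE; last by lia.
  have e : n - (n - j) = j by lia.
  by rewrite e castxx.
have bc := (tensor_of_hom_cocycle hB phiE).1 phid.
have [h hE] := hom_of_tensor hA n psi.
have psiE i j k x y : i + j = n - 1 -> k = n - j ->
    psi (tA i j (n - 1) x y) = hom_app (h i k x) (cast A j (n - k) y).
  move=> ijn ->; rewrite hE; last by lia.
  have e : n - (n - j) = j by lia.
  by rewrite e castxx.
have [|h' h'E] := kproj_null Pk (hom_map_quasi_iso n Ei uq) bc.
  exists h => i j i' j' v ji ii jj.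
  have {}ji : j = i by lia.
  have {}ii : i' = i - 1 by lia.
  subst j j' i'; apply: hom_ext => y.
  rewrite -(tensor_of_hom_diff hA psiE) -phiU UE; last lia.
  by rewrite (phiE _ _ i) ?castxx //; lia.
have [psi' psi'E] := tensor_of_hom hB (n - 1) h'.
exists psi'.
apply: (tensor_extr (g := phi) (h := lcomp psi' (diff TB n (n - 1))) hB) =>
  i x y.
rewrite /= (tensor_of_hom_diff hB psi'E) (phiE _ _ i) ?castxx; try lia.
by rewrite (h'E i i (i - 1) (i + 1)) //; lia.
Qed.

End Flatness.

(** * Tensoring short exact sequences with projective terms *)

Section TensorExact.
Variable S : comNzRingType.
Variables (P A B C TA TB TC : complex S).
Variables (tA : forall i j n : int, P i -> A j -> TA n)
  (tB : forall i j n : int, P i -> B j -> TB n)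
  (tC : forall i j n : int, P i -> C j -> TC n).
Arguments tA : clear implicits.
Arguments tB : clear implicits.
Arguments tC : clear implicits.
Hypotheses (hA : tensor_of tA) (hB : tensor_of tB) (hC : tensor_of tC).
Variables (e : int) (a : hmap A B) (c : chain_map B C).

Definition tensor_hmap_spec (a' : hmap TA TB) := forall i j n k m x y,
  i + j = n -> k = j + e -> m = n + e ->
  a' n m (tA i j n x y) = tB i k m x (a j k y).

Lemma tensor_hmap : exists a', tensor_hmap_spec a'.
Proof.
have [n m|a' a'E] := @hmap_choice S TA TB (fun n m g => m = n + e ->
    forall i j k x y, i + j = n -> k = j + e -> g (tA i j n x y) = tB i k m x
      (a j k y)).
  have [mn|mn] := pselect (m = n + e); last by exists (lzero _ _).
  have [_ _ uA] := hA; have [bB _ _] := hB.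
  have [|g gE _] := uA n (TB m) (fun i j x y => tB i (j + e) m x (a j (j + e)
    y)).
    move=> i j ijn; apply: (bilinear_precomp idfun (a j (j + e))); apply: bB;
      lia.
  by exists g => _ i j k x y ijn ->; apply: gE.
by exists a' => i j n k m x y ijn kj mn; apply: a'E.
Qed.

Variables (a' : hmap TA TB) (c' : chain_map TB TC).
Hypotheses (P_proj : forall i, projective_module (P i)) (abc : ses e a c).
Hypothesis a'E : tensor_hmap_spec a'.
Hypothesis c'E : forall i j n x y, i + j = n -> c' n (tB i j n x y) = tC i j n
  x (c j y).

(** As [E] is injective, Hom([B], [E]) maps onto Hom([A], [E]), and the maps from the projective
    [P i] lift through this surjection. *)
Let extend_form (E : lmodType S) n m (phi : {linear TA n ->
  E}) : injective_module E ->
  m = n + e -> exists psi : {linear TB m -> E}, forall v,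
    psi (a' n m v) = phi v.
Proof.
move=> Ei mn; have [_ aI _ _] := abc.
have ext j (f : {linear A j -> E}) :
    exists g : {linear B (j + e) -> E}, forall y, g (a j (j + e) y) = f y.
  by apply: Ei; apply: raddf_inj => y; apply: aI.
have [h hE] := hom_of_tensor hA n phi.
have lift i : exists g : {linear P i -> lhom (B (n - i + e)) E}, forall x y,
    hom_app (g x) (a (n - i) (n - i + e) y) = hom_app (h i i x) y.
  have RL : linear (fun f : lhom (B (n - i + e)) E =>
      to_hom (lcomp (hom_app f) (a (n - i) (n - i + e))) : lhom (A (n - i)) E).
    by move=> b f g; apply: hom_ext.
  have [f|g gE] := @P_proj i _ _ (lin RL) (h i i).
    have [g gE] := ext (n - i) (hom_app f); exists (to_hom g).
    by apply: hom_ext => y; rewrite hom_appE /= gE.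
  by exists g => x y; rewrite -gE.
pose g i := sval (cid (lift i)); have gE i := svalP (cid (lift i)).
have [_ _ uB] := hB.
have [|psi psiE _] := uB m E
    (fun i j x y => hom_app (g i x) (cast B j (n - i + e) y)).
  by move=> i j _; split=> [x b y z|y b x z]; rewrite !linearP.
exists psi; apply: (tensor_extr (g := lcomp psi (a' n m)) (h := phi) hA) =>
  i x y /=.
rewrite (a'E (k := n - i + e)) ?psiE ?castxx ?gE ?hE //; lia.
Qed.

(** A section of [c] as a mere function is enough: the form does not distinguish two preimages,
    since they differ by an element coming from [A]. *)
Let descend_form (E : lmodType S) n m (phi : {linear TB m -> E}) : m = n + e ->
  (forall v, phi (a' n m v) = 0) ->
  exists psi : {linear TC m -> E}, forall v, psi (c' m v) = phi v.
Proof.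
move=> mn phia; have [_ _ ac cS] := abc; have [bB _ _] := hB;
  have [_ _ uC] := hC.
have sec j : exists s : C j -> B j, forall z, c j (s z) = z by have [s sE] :=
  choice (cS j); exists s.
pose s j := sval (cid (sec j)); have sE j := svalP (cid (sec j)).
have phiE i j x y y' : i + j = m -> c j y = c j y' ->
  phi (tB i j m x y) = phi (tB i j m x y').
  move=> ijm yy'; have [bR _] := bB i j m ijm.
  have [v vE] : exists v, a (j - e) j v = y - y'.
    by apply/ac; [lia|rewrite linearB yy' subrr].
  rewrite -[y](subrK y') -vE -[a _ _ _]scale1r bR linearP scale1r.
  by rewrite -(a'E (n := n)) ?phia ?add0r //; lia.
have [|psi psiE _] := uC m E (fun i j x z => phi (tB i j m x (s j z))).
  move=> i j ijm; have [bR bL] := bB i j m ijm.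
  split=> [x b y z|y b x z]; last by rewrite bL linearP.
  by rewrite -linearP -bR; apply: phiE => //; rewrite linearP !sE.
exists psi; apply: (tensor_ext (g := lcomp psi (c' m)) (h := phi) hB) =>
  i j x y ijm /=.
by rewrite c'E // psiE //; apply: phiE; rewrite ?sE.
Qed.

Theorem tensor_ses : ses e a' c'.
Proof.
have [aC aI ac cS] := abc.
have c'a' n m v : m = n + e -> c' m (a' n m v) = 0.
  move=> mn; apply: (tensor_ext (g := lcomp (c' m) (a' n m)) (h :=
    lzero _ _) hA) => i j x y ijn.
  rewrite /= (a'E (k := j + e)) // c'E; last lia.
  have -> : c (j + e) (a j (j + e) y) = 0 by apply/(ac j); last by exists y.
  by have [bC _ _] := hC; rewrite (bilinear0r _ (bC _ _ _ _)) //; lia.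
split.
- move=> n m n' m' v mn nn mm.
  apply: (tensor_ext (g := lcomp (diff TB m m') (a' n m))
    (h := lcomp (a' n' m') (diff TA n n')) hA) => i j x y ijn /=.
  rewrite (a'E (k := j + e)) // (tensor_diff hB (i' := i - 1) (j' :=
    j - 1 + e)); try lia.
  rewrite (tensor_diff hA (i' := i - 1) (j' := j - 1)); try lia.
  rewrite linearD linearZ /= (a'E (k := j + e)); try lia.
  rewrite (a'E (k := j - 1 + e)); try lia.
  by rewrite (aC j (j + e) (j - 1)) //; lia.
- move=> n m v mn av; apply: contrapT => v0.
  have [||E [phi [Ei _ phiv]]] := @separate_submodule S (TA n) (fun w =>
    w = 0) v => //.
    by split=> // b u w -> ->; rewrite scaler0 addr0.
  have [psi psiE] := extend_form phi Ei mn.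
  by apply: phiv; rewrite -psiE av linear0.
- move=> n m w mn; split=> [cw|[v <-]]; last exact: c'a'.
  apply: contrapT => nw.
  have [E [phi [Ei phia phiw]]] := separate_submodule (submod_image (a' n m))
    nw.
  have [|psi psiE] := descend_form (phi := phi) mn.
    by move=> v; apply: phia; exists v.
  by apply: phiw; rewrite -psiE cw linear0.
- move=> n w; apply: contrapT => nw.
  have [E [phi [Ei phic phiw]]] := separate_submodule (submod_image (c' n)) nw.
  apply: phiw; apply: (tensor_ext (g := phi) (h := lzero _ _) hC) =>
    i j x z ijn.
  have [y <-] := cS j z; rewrite -c'E // phic //; by exists (tB i j n x y).
Qed.

End TensorExact.

(** * Reduction modulo x *)

Section Restriction.
Variables (R S : comNzRingType) (pi : {rmorphism R -> S}).

Section Module.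
Variable M : lmodType S.

(** The carrier is [M] itself and only the type remembers [pi]. Statements that do not involve
    scalars, such as [res_quasi_iso], thus transfer by conversion. *)
Definition resm : Type := let _ := pi in M.
HB.instance Definition _ := GRing.Zmodule.on resm.

Let scale (a : R) (v : resm) : resm := pi a *: (v : M).
Let scaleA a b v : scale a (scale b v) = scale (a * b) v.
Proof. by rewrite /scale rmorphM scalerA. Qed.
Let scale1 : left_id 1 scale.
Proof. by move=> v; rewrite /scale rmorph1 scale1r. Qed.
Let scaleDr : right_distributive scale +%R.
Proof. by move=> a u v; rewrite /scale scalerDr. Qed.
Let scaleDl v : {morph scale^~ v : a b / a + b}.
Proof. by move=> a b; rewrite /scale rmorphD scalerDl. Qed.
HB.instance Definition _ := GRing.Zmodule_isLmodule.Build R resm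
  scaleA scale1 scaleDr scaleDl.

Definition res : lmodType R := resm.

Lemma res_scale (a : R) (v : M) : a *: (v : res) = pi a *: v.
Proof. by []. Qed.

End Module.

Fact res_linear (M N : lmodType S) (f : {linear M -> N}) :
  linear ((f : M -> N) : res M -> res N).
Proof. by move=> a u v; rewrite !res_scale [LHS]linearP. Qed.
Definition res_lin M N f : {linear res M -> res N} := lin (@res_linear M N f).

Fact res_diff_shape (X : complex S) i j : i != j + 1 -> forall v,
  res_lin (diff X i j) v = 0.
Proof. by move=> ij v; apply: diff_shape. Qed.
Fact res_diffK (X : complex S) i j k v : res_lin (diff X j k) (res_lin (diff X
  i j) v) = 0.
Proof. exact: diffK. Qed.
Definition res_complex (X : complex S) : complex R :=
  Complex (@res_diff_shape X) (@res_diffK X).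

Fact res_comm X Y (f : chain_map X Y) i j (v : res_complex X i) :
  res_lin (f j) (diff (res_complex X) i j v) = diff (res_complex Y) i j
    (res_lin (f i) v).
Proof. exact: chain_comm. Qed.
Definition res_map X Y (f : chain_map X Y) : chain_map (res_complex X)
  (res_complex Y) :=
  @ChainMap R (res_complex X) (res_complex Y) (fun i =>
    res_lin (f i)) (res_comm f).

Lemma res_quasi_iso X Y (f : chain_map X Y) : quasi_iso f ->
  quasi_iso (res_map f).
Proof. exact: id. Qed.

Definition res_hmap (A B : complex S) (f : hmap A B) : hmap (res_complex A)
  (res_complex B) :=
  fun i j => res_lin (f i j).

Lemma res_ses A B C e (a : hmap A B) (c : chain_map B C) :
  ses e a c -> ses e (res_hmap a) (res_map c).
Proof. exact: id. Qed.

Hypothesis pi_surj : forall s, exists r, pi r = s.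

Lemma res_fg X : degreewise_fg X -> degreewise_fg (res_complex X).
Proof.
move=> Xf i; have [s sE] := Xf i; exists s => v; have [c cE] := sE v.
have /choice[r rE] k : exists r, pi r = c k by apply: pi_surj.
by exists r; rewrite cE; apply: eq_bigr => k _; rewrite -rE.
Qed.

Section Reduction.
Variables (x : R).
Hypothesis (x_reg : GRing.lreg x) (pi_ker : forall a, pi a = 0 <-> exists r,
  a = x * r).

Lemma pi_x : pi x = 0.
Proof. by apply/pi_ker; exists 1; rewrite mulr1. Qed.

Lemma map_mx_surj m n (A : 'M[S]_(m, n)) : exists B : 'M[R]_(m, n),
  map_mx pi B = A.
Proof.
have /choice[s sK] := pi_surj; exists (map_mx s A).
by apply/matrixP => i j; rewrite !mxE sK.
Qed.

Lemma map_mx_ker m n (A : 'M[R]_(m, n)) :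
  map_mx pi A = 0 <-> exists B, A = x *: B.
Proof.
split=> [A0|[B ->]]; last by apply/matrixP => i j;
  rewrite !mxE rmorphM pi_x mul0r.
have /choice[f fE] (p : 'I_m * 'I_n) : exists r, A p.1 p.2 = x * r.
  by apply/pi_ker; have /matrixP/(_ p.1 p.2) := A0; rewrite !mxE.
exists (\matrix_(i, j) f (i, j)); apply/matrixP => i j; rewrite !mxE.
exact: (fE (i, j)).
Qed.

Lemma scale_mx_inj m n : injective (fun A : 'M[R]_(m, n) => x *: A).
Proof.
move=> A B /matrixP AB; apply/matrixP => i j; apply: x_reg.
by have := AB i j; rewrite !mxE.
Qed.

Fact reduce_shape (G : mcomplex R) i j : i != j + 1 -> map_mx pi (mx G i j) = 0.
Proof. by move=> ij; rewrite mx_shape // map_mx0. Qed.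
Fact reduceK (G : mcomplex R) i j k : map_mx pi (mx G i j) *m map_mx pi (mx G j
  k) = 0.
Proof. by rewrite -map_mxM mxK map_mx0. Qed.
Definition reduce (G : mcomplex R) : mcomplex S :=
  MComplex (@reduce_shape G) (@reduceK G).

Fact red_linear n : linear (fun v : 'rV[R]_n => map_mx pi v : res 'rV[S]_n).
Proof. by move=> a u v; rewrite map_mxD map_mxZ. Qed.
Definition red n : {linear 'rV[R]_n -> res 'rV[S]_n} := lin (@red_linear n).

Fact reduce_comm (G : mcomplex R) i j v :
  red _ (diff (complex_of G) i j v) = diff (res_complex (complex_of (reduce
    G))) i j (red _ v).
Proof. exact: map_mxM. Qed.
Definition reduce_map (G : mcomplex R) :
    chain_map (complex_of G) (res_complex (complex_of (reduce G))) :=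
  @ChainMap R (complex_of G) (res_complex (complex_of (reduce G))) (fun i =>
    red _)
    (@reduce_comm G).

Definition scale_hmap (X : complex R) : hmap X X := fun i j =>
  lscale x (cast X i j).

Lemma scale_hmapE X i v : scale_hmap X i i v = x *: v.
Proof. by rewrite /= castxx. Qed.

Lemma reduce_ses (G : mcomplex R) : ses 0 (scale_hmap (complex_of G))
  (reduce_map G).
Proof.
split=> [i j i' j' v|i j v|i j w|i w]; rewrite ?addr0.
- move=> -> ii jj; have {jj}-> : j' = i' by lia.
  by rewrite !scale_hmapE linearZ.
- by move=> ->; rewrite scale_hmapE => e; apply: scale_mx_inj;
  rewrite /= scaler0.
- move=> e; subst j; split=> [/map_mx_ker[B ->]|[v <-]]; first by exists B;
  rewrite scale_hmapE.
  by apply/map_mx_ker; exists v; rewrite scale_hmapE.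
- exact: map_mx_surj.
Qed.

Lemma factor_red n (M : lmodType S) (g : {linear 'rV[R]_n -> res M}) :
  exists f : {linear 'rV[S]_n -> M}, forall v, f (map_mx pi v) = g v.
Proof.
exists (@row_lin S M n (fun k => g (delta_mx 0 k))) => v.
rewrite [RHS]row_lin_eta /= /row_comb; apply: eq_bigr => k _.
by rewrite mxE.
Qed.

Lemma homvan_reduce (G : mcomplex R) (N : complex S) n :
  homvan (complex_of G) (res_complex N) n <-> homvan (complex_of (reduce G)) N
    n.
Proof.
have down (g : hmap (complex_of G) (res_complex N)) :
    exists f : hmap (complex_of (reduce G)) N, forall i j v,
      f i j (map_mx pi v) = g i j v.
  have [i j|f fE] := @hmap_choice S (complex_of (reduce G)) N
     (fun i j f => forall v, f (map_mx pi v) = g i j v); last by exists f.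
  exact: factor_red.
split=> [GN f fc|GN f fc].
  have [|h hE] := GN (fun i j => lcomp (res_lin (f i j)) (red _)).
    move=> i j i' j' v ji ii jj; rewrite [LHS](fc i j i' j') //.
    exact: (congr1 (f i' j') (esym (map_mxM pi v (mx G i i')))).
  have [k kE] := down h; exists k => i j i' j' w ji ii jj.
  have [v <-] := map_mx_surj w.
  transitivity (lcomp (res_lin (f i j)) (red _) v) => //.
  rewrite (hE i j i' j' v ji ii jj) kE; congr (_ + _).
  rewrite -kE; congr (k _ _ _); exact: (map_mxM pi).
have [f' f'E] := down f.
have [|h hE] := GN f'.
  move=> i j i' j' w ji ii jj; have [v <-] := map_mx_surj w; rewrite f'E.
  by rewrite [LHS](fc i j i' j') // -f'E; congr (f' _ _ _); apply: (map_mxM pi).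
exists (fun i j => lcomp (res_lin (h i j)) (red _)) => i j i' j' v ji ii jj.
rewrite -f'E [LHS](hE i j i' j') //; congr (_ + h _ _ _).
by apply/esym; apply: (map_mxM pi).
Qed.

End Reduction.
End Restriction.

(** * Lifting free complexes from R/x to R *)

Section IndexMatrices.
Variables (R : comNzRingType) (r : int -> nat).

(* Stands for the transport of 1%:M along i = j. *)
Definition idm i j : 'M[R]_(r i, r j) :=
  \matrix_(a, b) ((i == j) && (a == b :> nat))%:R.

Lemma idmxx i : idm i i = 1%:M.
Proof. by apply/matrixP => a b; rewrite !mxE eqxx. Qed.

Lemma idm_neq i j : i != j -> idm i j = 0.
Proof. by move=> /negbTE ij; apply/matrixP => a b; rewrite !mxE ij. Qed.

Lemma mul_idm m (A : forall i, 'M[R]_(m, r i)) i j : i = j ->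
  A i *m idm i j = A j.
Proof. by move=> <-; rewrite idmxx mulmx1. Qed.

Lemma idm_mul m (A : forall i, 'M[R]_(r i, m)) i j : i = j ->
  idm i j *m A j = A i.
Proof. by move=> <-; rewrite idmxx mul1mx. Qed.

Lemma idm_trans i j k : i = j -> idm i j *m idm j k = idm i k.
Proof. by move=> <-; rewrite idmxx mul1mx. Qed.

End IndexMatrices.

Section Lift.
Variables (R S : comNzRingType) (pi : {rmorphism R -> S}) (x : R).
Hypotheses (pi_surj : forall s, exists r, pi r = s).
Hypotheses (x_reg : GRing.lreg x) (pi_ker : forall a, pi a = 0 <-> exists r,
  a = x * r).

Let map_mxS := map_mx_surj pi_surj.
Let map0 m n (A : 'M[R]_(m, n)) := map_mx_ker pi_ker A.
Let scaleI := scale_mx_inj x_reg.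

Variable G : mcomplex S.
Notation r := (rk G).

Let lift_exists i j : exists L : 'M[R]_(r i, r j),
  map_mx pi L = mx G i j /\ (i != j + 1 -> L = 0).
Proof.
have [L LE] := map_mxS (mx G i j).
have [ij|ij] := eqVneq i (j + 1); first by exists L; split=> // /eqP.
by exists 0; rewrite mx_shape // map_mx0.
Qed.
Let L i j := sval (cid (lift_exists i j)).
Let LE i j : map_mx pi (L i j) = mx G i j.
Proof. exact: (svalP (cid (lift_exists i j))).1. Qed.
Let L0 i j : i != j + 1 -> L i j = 0.
Proof. exact: (svalP (cid (lift_exists i j))).2. Qed.

(* The square of the lifted differential is divisible by x. *)
Let t_exists i k : exists t, L i (k + 1) *m L (k + 1) k = x *: t.
Proof. by apply/map0; rewrite map_mxM !LE mxK. Qed.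
Let t i k := sval (cid (t_exists i k)).
Let tE i j k : j = k + 1 -> L i j *m L j k = x *: t i k.
Proof. by move=> ->; exact: (svalP (cid (t_exists i k))). Qed.
Let t0 i k : i != k + 1 + 1 -> t i k = 0.
Proof. by move=> ik; apply: scaleI; rewrite -(@tE i (k + 1)) // L0 // mul0mx
  scaler0. Qed.
(** Multiplied by [x], both sides are the product of three lifted differentials; [x] can be
    cancelled. *)
Let tL i j k l : i = j + 1 -> k = l + 1 -> L i j *m t j l = t i k *m L k l.
Proof.
move=> ij kl; have [e|e] := eqVneq j (k + 1); last first.
  by rewrite (@t0 j) ?(@t0 i) ?mulmx0 ?mul0mx //; lia.
apply: scaleI; rewrite scalemxAr -(@tE j k l) // mulmxA (@tE i j k) //.
by rewrite scalemxAl.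
Qed.

Let q i := (r i + r (i - 1))%N.
(** In the square of [D], each diagonal term [L L = x t] meets a product of the blocks of [t] and
    [x]. The sign [sg] alternates with the degree, which makes these cancel and the mixed terms as
    well, by [tL]. *)
Let D i j : 'M[R]_(q i, q j) := block_mx
  (L i j) (sg R i *: t i (j - 1))
  ((sg R i * x) *: idm R r (i - 1) j) (L (i - 1) (j - 1)).

Let D_shape i j : i != j + 1 -> D i j = 0.
Proof.
move=> ij; rewrite /D !L0 ?t0 ?idm_neq ?scaler0 ?block_mx0 //; lia.
Qed.

Let DK i j k : D i j *m D j k = 0.
Proof.
have [ij|ij] := eqVneq i (j + 1); last by rewrite (D_shape ij) mul0mx.
have [jk|jk] := eqVneq j (k + 1); last by rewrite (D_shape jk) mulmx0.
rewrite /D mulmx_block -[RHS]block_mx0.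
rewrite -!(scalemxAl, scalemxAr) !scalerA.
rewrite (@mul_idm _ _ _ (fun j => t i j)); last by lia.
rewrite (@idm_mul _ _ _ (fun j => L j k)); last by lia.
rewrite (@mul_idm _ _ _ (fun k => L (i - 1) k)); last by lia.
rewrite (@idm_mul _ _ _ (fun j => t j (k - 1))); last by lia.
rewrite (@tE i j k) // (@tE _ _ (k - 1)); last by lia.
rewrite (@tL i j k (k - 1)) //; last by lia.
rewrite (sgS _ ij) !mulNr !scaleNr mulrA sgK mul1r.
rewrite (_ : sg R j * x * sg R j = x); last by rewrite mulrAC sgK mul1r.
rewrite subrr addNr; congr block_mx.
  by rewrite (_ : j - 1 = k) ?subrr //; lia.
by rewrite addNr.
Qed.

Definition mlift : mcomplex R := MComplex D_shape DK.

Lemma lift_bounded_below a : bounded_below G a -> bounded_below mlift a.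
Proof. by move=> Ga i ia; rewrite /= /q !Ga //; lia. Qed.

Let lift_mul i j (u : 'rV[R]_(r i)) (v : 'rV[R]_(r (i - 1))) :
  row_mx u v *m D i j = row_mx (u *m L i j + (sg R i * x) *: (v *m idm R r (i -
    1) j))
    (sg R i *: (u *m t i (j - 1)) + v *m L (i - 1) (j - 1)).
Proof. by rewrite mul_row_block -!scalemxAr. Qed.

Fact lift_map_linear i : linear (fun v : complex_of mlift i =>
  map_mx pi (lsubmx (v : 'rV[R]_(r i + r (i - 1)))) : res_complex pi
    (complex_of G) i).
Proof. by move=> a u v; rewrite linearP map_mxD map_mxZ. Qed.

Fact lift_map_comm i j v : lin (@lift_map_linear j) (diff (complex_of mlift) i
  j v) =
  diff (res_complex pi (complex_of G)) i j (lin (@lift_map_linear i) v).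
Proof.
rewrite [RHS](_ : _ = map_mx pi (lsubmx (v : 'rV[R]_(r i + r (i - 1)))) *m mx G
  i j) //=.
rewrite -{1}[v](@hsubmxK _ _ (r i) (r (i - 1))) lift_mul row_mxKl map_mxD
  map_mxM LE.
by rewrite [X in _ + X](_ : _ = 0) ?addr0 //; apply/map0;
  exists (sg R i *: (rsubmx (v : 'rV[R]_(r i + r (i - 1))) *m idm R r (i - 1)
  j)); rewrite scalerA mulrC.
Qed.

Definition lift_map : chain_map (complex_of mlift) (res_complex pi (complex_of
  G)) :=
  ChainMap lift_map_comm.

(** In the kernel of [lift_map], the block [x] identifies the second summand with the multiples of
    [x] in the first, so the kernel is acyclic. Concretely, an error [x c] in the first coordinate
    is absorbed by [c] in the second. *)
Lemma lift_quasi_iso : quasi_iso lift_map.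
Proof.
move=> i; split=> [v cv [g gE]|g cg].
  have [w wE] := map_mxS (g : 'rV[S]_(r (i + 1))).
  pose v1 := lsubmx (v : 'rV[R]_(r i + r (i - 1))).
  pose v2 := rsubmx (v : 'rV[R]_(r i + r (i - 1))).
  have vE : v = row_mx v1 v2 by rewrite hsubmxK.
  have [c cE] : exists c, v1 - w *m L (i + 1) i = x *: c.
    by apply/map0; rewrite map_mxB map_mxM LE wE; apply/subr0_eq;
      rewrite subr0; apply/eqP; rewrite subr_eq0; apply/eqP.
  have e0 : sg R (i + 1) = - sg R i by apply: sgS.
  exists (row_mx w (sg R (i + 1) *: (c *m idm R r i (i + 1 - 1))) : 'rV[R]_(r
    (i + 1) + r (i + 1 - 1))).
  rewrite complex_ofE /= lift_mul -!scalemxAl -mulmxA idm_trans ?idmxx;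
    last lia.
  rewrite mulmx1 scalerA mulrAC sgK mul1r -cE [w *m _ + _]addrC subrK.
  have eL : idm R r i (i + 1 - 1) *m L (i + 1 - 1) (i - 1) = L i (i - 1).
    by apply: (@idm_mul _ _ _ (fun j => L j (i - 1))); lia.
  rewrite -mulmxA eL -scalerDr vE; congr row_mx.
  have := cv; rewrite /cycle complex_ofE /= vE lift_mul -[RHS]row_mx0 =>
    /eq_row_mx[E _].
  move: E; rewrite idmxx mulmx1 => E.
  have v1E : v1 = w *m L (i + 1) i + x *: c by rewrite -cE addrC subrK.
  (* The first coordinate of the cycle condition is [x] times this equation, which determines
     [v2]. *)
  have {}E : w *m t (i + 1) (i - 1) + c *m L i (i - 1) + sg R i *: v2 = 0.
    apply: scaleI; rewrite scaler0 -E v1E mulmxDl -mulmxA (@tE _ i) ?subrK //.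
    by rewrite !scalerDr scalemxAr scalemxAl scalerA mulrC.
  rewrite e0 scaleNr -scalerN -[LHS](sgZK i); congr (_ *: _).
  by apply/eqP; rewrite -addr_eq0 [X in X == _]addrC E.
have [a aE] := map_mxS (g : 'rV[S]_(r i)).
have [b bE] : exists b, a *m L i (i - 1) = x *: b.
  by apply/map0; rewrite map_mxM LE aE.
exists (row_mx a (- (sg R i *: b)) : 'rV[R]_(r i + r (i - 1))).
  rewrite /cycle complex_ofE /= lift_mul idmxx mulmx1 -[RHS]row_mx0;
    congr row_mx.
    by rewrite bE scalerN scalerA mulrAC sgK mul1r subrr.
  rewrite mulNmx -scalemxAl -scalerBr [X in _ *: X](_ : _ = 0) ?scaler0 //.
  apply: scaleI; rewrite scaler0 scalerBr scalemxAr scalemxAl -bE -mulmxA.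
  by rewrite -(@tE i (i - 1)) ?subrr //; lia.
rewrite /= row_mxKl aE subrr; exact: boundary0.
Qed.

(** Modulo [x] the lower left block vanishes: the second summand becomes a subcomplex and the first
    one a quotient. *)
Let red_mul i j (u : 'rV[S]_(r i)) (v : 'rV[S]_(r (i - 1))) :
  row_mx u v *m map_mx pi (D i j) = row_mx (u *m mx G i j)
    (u *m map_mx pi (sg R i *: t i (j - 1)) + v *m mx G (i - 1) (j - 1)).
Proof.
rewrite map_block_mx !LE mul_row_block; congr row_mx.
rewrite [X in _ + _ *m X](_ : _ = 0) ?mulmx0 ?addr0 //.
by apply/map0; exists (sg R i *: idm R r (i - 1) j); rewrite scalerA mulrC.
Qed.

Fact lift_incl_linear i j : linear (fun g : 'rV[S]_(r i) =>
  row_mx (0 : 'rV_(r j)) (g *m idm S r i (j - 1)) : complex_of (reduce pi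
    mlift) j).
Proof.
by move=> a u v; rewrite scale_row_mx add_row_mx mulmxDl scalemxAl scaler0
  addr0.
Qed.
Definition lift_incl : hmap (complex_of G) (complex_of (reduce pi mlift)) :=
  fun i j => lin (@lift_incl_linear i j).

Fact lift_proj_linear i : linear (fun v : complex_of (reduce pi mlift) i =>
  lsubmx (v : 'rV[S]_(r i + r (i - 1))) : complex_of G i).
Proof. by move=> a u v; rewrite linearP. Qed.
Definition lift_proj_fun i : {linear complex_of (reduce pi mlift) i ->
  complex_of G i} :=
  lin (@lift_proj_linear i).

Fact lift_proj_comm i j v : lift_proj_fun j (diff (complex_of (reduce pi
  mlift)) i j v) =
  diff (complex_of G) i j (lift_proj_fun i v).
Proof.
rewrite !complex_ofE -[v in LHS](@hsubmxK _ _ (r i) (r (i - 1))).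
by rewrite [X in lift_proj_fun j X]red_mul [LHS]row_mxKl.
Qed.

Definition lift_proj : chain_map (complex_of (reduce pi mlift)) (complex_of G)
  :=
  ChainMap lift_proj_comm.

Lemma lift_ses : ses 1 lift_incl lift_proj.
Proof.
split=> [i j i' j' v ji ii jj|i j v ji|i j w ji|i w].
- rewrite complex_ofE [X in X = _]red_mul mul0mx mul0mx add0r; congr row_mx.
  rewrite -mulmxA (@idm_mul _ _ _ (fun i => mx G i (j' - 1))); last by lia.
  rewrite complex_ofE -mulmxA (@mul_idm _ _ _ (fun i' => mx G i i')) //; lia.
- move=> e; have : row_mx (0 : 'rV_(r j)) (v *m idm S r i (j - 1)) = 0 := e.
  move/(congr1 (fun w => rsubmx w *m idm S r (j - 1) i)); rewrite row_mxKr.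
  by rewrite -mulmxA idm_trans ?idmxx ?mulmx1 ?linear0 ?mul0mx //; lia.
- have wE := @hsubmxK _ _ (r j) (r (j - 1)) w.
  split=> [w0|[v <-]]; last exact: row_mxKl.
  exists (rsubmx (w : 'rV[S]_(r j + r (j - 1))) *m idm S r (j - 1) i).
  rewrite -[RHS]wE [X in _ = row_mx X _]w0; congr row_mx.
  by rewrite -mulmxA idm_trans ?idmxx ?mulmx1 //; lia.
- exists (row_mx w 0 : 'rV[S]_(r i + r (i - 1))); exact: row_mxKl.
Qed.

(** In each degree [lift_incl] is split by the projection to the second summand. *)
Lemma lift_extend N i j k (u : {linear complex_of G i ->
  (N : complex S) k}) : j = i + 1 ->
  exists u' : {linear complex_of (reduce pi mlift) j -> N k}, forall v,
    u' (lift_incl i j v) = u v.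
Proof.
move=> ji.
have pL : linear (fun w : 'rV[S]_(r j + r (j - 1)) =>
  rsubmx w *m idm S r (j - 1) i).
  by move=> a v w; rewrite linearP mulmxDl scalemxAl.
exists (lcomp u (lin pL : {linear complex_of (reduce pi mlift) j ->
  complex_of G i})) => v.
rewrite [LHS]/(u (rsubmx (row_mx (0 : 'rV_(r j)) (v *m idm S r i (j - 1))) *m
  idm S r (j - 1) i)).
by rewrite row_mxKr -mulmxA idm_trans ?idmxx ?mulmx1 //; lia.
Qed.

End Lift.

(** * Tensor products over R with a module killed by x *)

Section TensorRestriction.
Variables (R S : comNzRingType) (pi : {rmorphism R -> S}) (x : R).
Hypotheses (pi_surj : forall s, exists r, pi r = s).
Hypotheses (pi_ker : forall a, pi a = 0 <-> exists r, a = x * r).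

(* An R-bilinear map out of Q x Y, where x kills Y, takes its values in the
   elements killed by x, which form a module over S. *)
Section Torsion.
Variable M : lmodType R.

Let killed (v : M) := x *: v = 0.
Let killed_submod : submod killed.
Proof.
split=> [|a u v ku kv]; first exact: scaler0.
by rewrite /killed scalerDr scalerA mulrC -scalerA ku kv !scaler0 addr0.
Qed.
Let K : lmodType R := subm killed_submod.
Definition torsion : Type := K.
HB.instance Definition _ := GRing.Zmodule.on torsion.
Let xK (v : K) : x *: v = 0.
Proof.
apply: (@subm_val_inj _ _ _ killed_submod); rewrite linearZ linear0.
exact: (subm_valP v).
Qed.
Let s (a : S) : R := sval (cid (pi_surj a)).
Let sK a : pi (s a) = a. Proof. exact: (svalP (cid (pi_surj a))). Qed.
Let act (a b : R) (v : K) : pi a = pi b -> a *: v = b *: v.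
Proof.
move=> ab; have /pi_ker[c cE] : pi (a - b) = 0 by rewrite rmorphB ab subrr.
by apply/subr0_eq; rewrite -scalerBl cE mulrC -scalerA xK scaler0.
Qed.
Let scale (a : S) (v : torsion) : torsion := s a *: (v : K).
Let scaleA a b v : scale a (scale b v) = scale (a * b) v.
Proof. by rewrite /scale scalerA; apply: act; rewrite rmorphM !sK. Qed.
Let scale1 : left_id 1 scale.
Proof. by move=> v; rewrite /scale -[RHS]scale1r; apply: act;
  rewrite sK rmorph1. Qed.
Let scaleDr : right_distributive scale +%R.
Proof. by move=> a u v; rewrite /scale scalerDr. Qed.
Let scaleDl v : {morph scale^~ v : a b / a + b}.
Proof. by move=> a b; rewrite /scale -scalerDl; apply: act;
  rewrite rmorphD !sK. Qed.
HB.instance Definition _ := GRing.Zmodule_isLmodule.Build S torsion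
  scaleA scale1 scaleDr scaleDl.

Let torsion_val_linear : linear (fun v : res pi torsion =>
  subm_val killed_submod v).
Proof.
move=> a u v; rewrite -linearP; congr (subm_val _ (_ + _)).
by rewrite res_scale [LHS]/(s (pi a) *: (u : K)); apply: act; rewrite sK.
Qed.
Definition torsion_val : {linear res pi torsion -> M} := lin torsion_val_linear.

Lemma torsion_val_inj : injective torsion_val.
Proof. exact: subm_val_inj. Qed.

Lemma torsion_val_surj v : x *: v = 0 -> exists u, torsion_val u = v.
Proof. exact: (subm_val_surj killed_submod). Qed.

End Torsion.

Lemma res_linear_inv (U V : lmodType S) (f : {linear res pi U -> res pi V}) :
  linear (f : U -> V).
Proof.
move=> a u v; have [b <-] := pi_surj a.
exact: (linearP f b u v).
Qed.

Lemma res_killed (U : lmodType S) (u : res pi U) : x *: u = 0.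
Proof. by rewrite res_scale (pi_x pi_ker) scale0r. Qed.

(** Hence a tensor product over [S] with the reduction of [Q] also computes one over [R], where [Q]
    may be a resolution. *)
Theorem tensor_res (Q : mcomplex R) (Y T : complex S) t :
  @tensor_of S (complex_of (reduce pi Q)) Y T t ->
  @tensor_of R (complex_of Q) (res_complex pi Y) (res_complex pi T)
    (fun i j n q y => t i j n (map_mx pi q) y).
Proof.
move=> [tb td tu]; split.
- move=> i j n ijn; have [bR bL] := tb i j n ijn; split=> [q a y z|y a q q'].
    by rewrite res_scale [LHS]bR.
  by rewrite map_mxD map_mxZ [LHS]bL.
- move=> i j n q y ijn; rewrite [LHS]td //; congr (t _ _ _ _ _ + _).
    exact: (esym (map_mxM pi _ _)).
  by rewrite res_scale rmorphXn rmorphN1.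
move=> n M b bb factors.
have bx i j q y : i + j = n -> x *: b i j q y = 0.
  move=> ijn; have [bR _] := bb i j ijn.
  have /= <- := linearZ_LR (lin (bR q)) x y.
  by rewrite res_killed; exact: (linear0 (lin (bR q))).
have lift_b i j (q : 'rV[S]_(rk Q i)) y : exists w : torsion M,
    i + j = n -> forall q', map_mx pi q' = q -> torsion_val M w = b i j q' y.
  have [ijn|] := pselect (i + j = n); last by exists 0.
  have [q0 q0E] := map_mx_surj pi_surj q.
  have [w wE] := torsion_val_surj (bx i j q0 y ijn).
  exists w => _ q' q'E; rewrite wE; apply/subr0_eq.
  have /(map_mx_ker pi_ker)[c cE] : map_mx pi (q0 - q') = 0.
    by rewrite map_mxB q0E q'E subrr.
  have [_ bL] := bb i j ijn.
  have /= <- := linearB (lin (bL y)) q0 q'.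
  rewrite cE; have /= -> := linearZ_LR (lin (bL y)) x c.
  exact: bx.
pose b' i j q y := sval (cid (lift_b i j q y)).
have b'E i j q y : i + j = n -> torsion_val M (b' i j (map_mx pi q) y) = b i j
  q y.
  by move=> ijn; apply: (svalP (cid (lift_b i j (map_mx pi q) y))).
have [i j ijn|g gE gU] := tu n (torsion M) b'.
  have [bR bL] := bb i j ijn; split=> [q a y z|y a q q'].
    have [q0 <-] := map_mx_surj pi_surj q; have [c <-] := pi_surj a.
    apply: torsion_val_inj.
    transitivity (c *: torsion_val M (b' i j (map_mx pi q0) y)
                  + torsion_val M (b' i j (map_mx pi q0) z)).
      by rewrite !b'E //; apply: bR.
    exact: esym (linearP (torsion_val M) c _ _).
  have [q0 <-] := map_mx_surj pi_surj q; have [q1 <-] := map_mx_surj pi_surj q'.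
  have [c <-] := pi_surj a; rewrite -map_mxZ -map_mxD; apply: torsion_val_inj.
  transitivity (c *: torsion_val M (b' i j (map_mx pi q0) y)
                + torsion_val M (b' i j (map_mx pi q1) y)).
    by rewrite !b'E //; apply: bL.
  exact: esym (linearP (torsion_val M) c _ _).
exists (lcomp (torsion_val M) (res_lin pi g)) => [i j q y ijn|g' g'E v].
  exact: etrans (congr1 (torsion_val M) (gE i j _ y ijn)) (b'E _ _ _ _ ijn).
have [|h hE] := factor_injective (f := torsion_val M) (g :=
  g') (@torsion_val_inj _).
  by move=> w; apply: torsion_val_surj; rewrite -linearZ res_killed linear0.
rewrite -hE; apply: (congr1 (torsion_val M)).
apply: (gU (lin (res_linear_inv h))) => i j q y ijn.
have [q0 <-] := map_mx_surj pi_surj q.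
by apply: torsion_val_inj; rewrite [LHS]hE g'E // b'E.
Qed.

End TensorRestriction.

(** * Depth *)

(** [infimum] is a choice, meaningful only if a greatest lower bound exists. For a nonempty set of
    integers it does: a least element, or [-oo]. *)
Lemma int_infimumP (A : set int) (d := infimum +oo%E [set i%:E | i in A]) :
  (forall i, A i -> (d <= i%:E)%E) /\
  forall e : \bar int, (forall i, A i -> (e <= i%:E)%E) -> (e <= d)%E.
Proof.
rewrite /d /infimum; case: ifPn => [/eqP A0|An0].
  split=> [i Ai|e _]; last exact: leey.
  have : [set i%:E | i in A] i%:E by exists i.
  by rewrite A0.
have [i0 Ai0] : exists i, A i.
  apply: contrapT => nA; case/eqP: An0; apply/seteqP; split=> // e [i Ai _].
  by case: nA; exists i.
have ex : exists d, infimums [set i%:E | i in A] d.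
  have [[b bA]|unb] := pselect (exists b, forall i, A i -> b <= i).
    have exk : exists k : nat, `[< A (b + k%:Z) >].
      have := bA _ Ai0 => bi; exists `|i0 - b|%N; apply/asboolP.
      by have -> : b + `|i0 - b|%N%:Z = i0 by lia.
    case: (ex_minnP exk) => k /asboolP Ak kmin; exists (b + k%:Z)%:E.
    split=> [_ [i Ai <-]|e]; last by apply; exists (b + k%:Z).
    rewrite lee_fin; have bi := bA i Ai.
    have := kmin `|i - b|%N; have -> : b + `|i - b|%N%:Z = i by lia.
    by move=> /(_ (asboolT Ai)); lia.
  exists -oo%E; split=> [_ [i _ <-]|e elb]; first exact: leNye.
  case: e elb => [r| |] elb //.
    case: unb; exists r => i Ai; have := elb i%:E; rewrite lee_fin; apply.
    by exists i.
  by have := elb i0%:E (ex_intro2 _ _ i0 Ai0 erefl).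
have [lb gt] : infimums [set i%:E | i in A] (xget +oo%E (infimums [set i%:E | i
  in A])).
  by have [d' d'P] := ex; apply: (xgetPex _ ex).
split=> [i Ai|e elb]; first by apply: lb; exists i.
by apply: gt => _ [i Ai <-]; apply: elb.
Qed.

Section Depth.
Variable S : comNzRingType.
Implicit Types (A B P I N X : complex S) (L M : lmodType S).

Lemma homvan_kproj P A B n (g : chain_map A B) : K_projective P ->
  quasi_iso g ->
  homvan P A n <-> homvan P B n.
Proof.
move=> Pk gq; split=> [PA f fc|PB f fc].
  have [psi [psic [h hE]]] := kproj_lift Pk gq fc; have [k kE] := PA psi psic.
  exists (fun i j => ladd (h i j) (lcomp (g j) (k i j))) =>
    i j i' j' v ji ii jj.
  rewrite (hE i j i' j') // (kE i j i' j') // !linearD /= chain_comm.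
  by rewrite [RHS]addrACA [LHS]addrC.
have [|h hE] := PB (fun i j => lcomp (g j) (f i j)); last first.
  by apply: (kproj_null Pk gq fc); exists h.
by move=> i j i' j' v ji ii jj; rewrite /= -chain_comm (fc i j i' j').
Qed.

Lemma homvan_kinj I A B n (g : chain_map A B) : K_injective I -> quasi_iso g ->
  homvan A I n <-> homvan B I n.
Proof.
move=> Ik gq; split=> [AI f fc|BI f fc].
  have [|h hE] := AI (fun i j => lcomp (f i j) (g i)); last first.
    by apply: (kinj_null Ik gq fc); exists h.
  by move=> i j i' j' v ji ii jj; rewrite /= (fc i j i' j') // chain_comm.
have [psi [psic [h hE]]] := kinj_extend Ik gq fc; have [k kE] := BI psi psic.
exists (fun i j => ladd (h i j) (lcomp (k i j) (g i))) => i j i' j' v ji ii jj.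
rewrite (hE i j i' j') // (kE i j i' j') // !linearD /= chain_comm.
by rewrite [RHS]addrACA [LHS]addrC.
Qed.

Lemma stalk_zero M i (v : stalk M i) : i != 0 -> v = 0.
Proof. by case: i v => [[|k]|k] v // _; apply: thinmx0. Qed.

Definition from_stalk M N (f : forall k, {linear M ->
  N k}) : hmap (stalk M) N :=
  fun i k => match i as i return {linear stalk M i -> N k} with
  | Posz 0 => f k
  | _ => lzero _ _
  end.

Lemma from_stalk0 M N (f : forall k, {linear M -> N k}) k (v : M) :
  from_stalk f 0 k v = f k v.
Proof. by []. Qed.

Lemma Hom_homology_neq0_homvan L I j :
  Hom_homology_neq0 L I j <-> ~ homvan (stalk L) I j.
Proof.
split=> [[phi phic nb] van|nvan].
  have [|h hE] := van (from_stalk (fun k => lcomp (cast I j k) phi)).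
    move=> i k i' k' v ki ii kk; rewrite [diff (stalk L) _ _ _]/(0) linear0.
    have [i0|i0] := eqVneq i 0; last by rewrite (stalk_zero v i0) !linear0.
    move: v ki ii; rewrite i0 => v ki _; have kj : k = j by lia.
    have -> : k' = j - 1 by lia.
    rewrite kj from_stalk0 /= castxx.
    exact: phic.
  apply: nb; exists (h 0 (j + 1)) => l.
  have := hE 0 j (-1) (j + 1) l; rewrite add0r => /(_ erefl erefl erefl).
  by rewrite from_stalk0 /= castxx linear0 addr0.
apply: contrapT => nH; apply: nvan => f fc.
pose phi : {linear L -> I j} := f 0 j.
have phic l : diff I j (j - 1) (phi l) = 0.
  by rewrite /phi (fc 0 j (-1) (j - 1) l) ?linear0 //; lia.
have [psi psiE] : exists psi : {linear L -> I (j + 1)},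
    forall l, phi l = diff I (j + 1) j (psi l).
  by apply: contrapT => nb; apply: nH; exists phi.
exists (from_stalk (fun k => lcomp (cast I (j + 1) k) psi)) =>
  i k i' k' v ki ii kk.
rewrite [diff (stalk L) _ _ _]/(0) linear0 addr0.
have [i0|i0] := eqVneq i 0; last by rewrite (stalk_zero v i0) !linear0.
move: v ki ii; rewrite i0 => v ki _; have kj : k = j by lia.
rewrite kk kj from_stalk0 /= castxx; exact: psiE.
Qed.

(** Balancing: Hom([G], [X]), Hom([G], [I]) and Hom([stalk L], [I]) have the same homology, because
    [G] is K-projective and [I] is K-injective. *)
Lemma Hom_homology_neq0_kproj L G X I (eps : chain_map G (stalk L)) (f :
  chain_map X I) j :
  K_projective G -> quasi_iso eps -> injective_resolution f ->
  Hom_homology_neq0 L I j <-> ~ homvan G X j.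
Proof.
move=> Gk epsq [fq Ik _].
have e1 := homvan_kproj j Gk fq; have e2 := homvan_kinj j Ik epsq.
have e3 := Hom_homology_neq0_homvan L I j.
by split=> [/e3 n /e1 /e2|n]; last apply/e3 => /e2/e1.
Qed.

Definition bounded_above X := exists a, forall i, a < i -> homology_zero X i.

Lemma bounded_homology_above X : bounded_homology X -> bounded_above X.
Proof. by move=> [n Xn]; exists n%:Z => i ni; apply: Xn; lia. Qed.

Section WithResolution.
Variables (n : idealr S) (G : complex S) (eps : chain_map G (stalk {ideal_quot
  n})).
Hypotheses (Gk : K_projective G) (eps_q : quasi_iso eps).

(** The bound on the homology supplies an injective resolution, without which the degree would not
    enter the set whose infimum is the depth. *)
Lemma depth_le_nonvanishing X i : bounded_above X -> ~ homvan G X (- i) ->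
  (depth n X <= i%:E)%E.
Proof.
move=> [a Xa] nv; have [I [f fI]] := injective_resolution_exists Xa.
apply: (int_infimumP _).1; exists I, f; split=> //.
exact/(Hom_homology_neq0_kproj _ Gk eps_q fI).
Qed.

Lemma le_depth X e : (forall i, ~ homvan G X (- i) -> (e <= i%:E)%E) ->
  (e <= depth n X)%E.
Proof.
move=> Xe; apply: (int_infimumP _).2 => i [I [f [fI nv]]].
exact/Xe/(Hom_homology_neq0_kproj _ Gk eps_q fI).
Qed.

End WithResolution.

(** A map of degree [n] from [G] lands in the truncation of [N] with cycles in degree [n] and zero
    below, cut out by [Q]. Since [a < n], this truncation is acyclic. *)
Lemma homvan_above G N a n : K_projective G -> (forall i (v : G i), i < 0 ->
  v = 0) ->
  (forall i, a < i -> homology_zero N i) -> a < n -> homvan G N n.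
Proof.
move=> Gk G0 Na an f fc.
pose Q i (v : N i) := (i < n -> v = 0) /\ (i = n -> cycle v).
have hQ i : submod (@Q i).
  split=> [|b u v [u1 u2] [v1 v2]]; rewrite /Q.
    by split=> // _; rewrite /cycle linear0.
  split=> [ni|ni]; first by rewrite u1 // v1 // scaler0 addr0.
  by rewrite /cycle linearP (u2 ni) (v2 ni) scaler0 addr0.
have [d dE] : exists d : forall i j, {linear subm (hQ i) -> subm (hQ j)},
    forall i j v, subm_val (hQ j) (d i j v) = diff N i j (subm_val (hQ i) v).
  have ex i j : exists d : {linear subm (hQ i) -> subm (hQ j)},
      forall v, subm_val (hQ j) (d v) = diff N i j (subm_val (hQ i) v).
    have [v|d dE] := @factor_injective _ _ _ _ (subm_val (hQ j))
      (lcomp (diff N i j) (subm_val (hQ i))) (@subm_val_inj _ _ _ (hQ j));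
        last by exists d.
    apply: subm_val_surj; split=> [jn|_]; last exact: cycle_diff.
    change (diff N i j (subm_val (hQ i) v) = 0).
    have [v1 v2] := subm_valP v; have [e|/diff_shape->//] := eqVneq i (j + 1).
    have [lt|ge] := ltP i n; first by rewrite [subm_val _ v]v1 ?linear0.
    have ein : i = n by lia.
    by rewrite ((cycleE _).1 (v2 ein)).
  by exists (fun i j => sval (cid (ex i j))) => i j; case: cid.
have dS i j : i != j + 1 -> forall v, d i j v = 0.
  by move=> ij v; apply: (@subm_val_inj _ _ _ (hQ j));
    rewrite dE diff_shape ?linear0.
have dK i j k v : d j k (d i j v) = 0.
  by apply: (@subm_val_inj _ _ _ (hQ k)); rewrite !dE diffK linear0.
pose T : complex S := @Complex S (fun i => subm (hQ i)) d dS dK.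
have Ta : acyclic T.
  move=> i v cv; have [v1 v2] := subm_valP v.
  have [ni|ni] := ltP i n.
    by exists 0; apply: (@subm_val_inj _ _ _ (hQ i));
      rewrite linear0 v1 ?linear0.
  have [||w wE] := Na i _ (subm_val (hQ i) v); first by lia.
    by have := congr1 (subm_val (hQ (i - 1))) cv; rewrite dE linear0 => e;
      exact: e.
  have [|w' w'E] := @subm_val_surj _ _ _ (hQ (i + 1)) w; first by split; lia.
  by exists w'; apply: (@subm_val_inj _ _ _ (hQ i)); rewrite dE w'E.
have [f' f'E] : exists f' : hmap G T, forall i j, j = i + n -> forall v,
    subm_val (hQ j) (f' i j v) = f i j v.
  apply: (@hmap_choice S G T (fun i j f' => j = i + n -> forall v,
    subm_val (hQ j) (f' v) = f i j v)) => i j.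
  have [ji|ji] := pselect (j = i + n); last by exists (lzero _ _).
  have [v|g gE] := @factor_injective _ _ _ _ (subm_val (hQ j)) (f i j)
    (@subm_val_inj _ _ _ (hQ j)); last by exists g.
  apply: subm_val_surj; split=> [jn|jn].
    by rewrite (G0 _ v) ?linear0 //; lia.
  rewrite /cycle (fc i j (i - 1) (j - 1)) //; try lia.
  by rewrite (G0 _ (diff G i (i - 1) v)) ?linear0 //; lia.
have [|h hE] := @kproj_homvan S G T n Gk Ta f'.
  move=> i j i' j' v ji ii jj; apply: (@subm_val_inj _ _ _ (hQ j')).
  by rewrite dE !f'E ?(fc i j i' j') //; lia.
exists (fun i j => lcomp (subm_val (hQ j)) (h i j)) => i j i' j' v ji ii jj.
by rewrite -f'E // (hE i j i' j') // linearD dE.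
Qed.

End Depth.

(** * Comparison of depths over R and R/x *)

Section Stalks.
Variable S : comNzRingType.
Implicit Types M : lmodType S.

Lemma stalk_homology_zero M i : i != 0 -> homology_zero (stalk M) i.
Proof. by move=> i0 v _; rewrite (stalk_zero v i0); apply: boundary0. Qed.

Lemma stalk_bounded M : bounded_homology (stalk M).
Proof. by exists 0%N => i i0; apply: stalk_homology_zero;
  rewrite -absz_gt0. Qed.

Lemma stalk_fg M : finitely_generated M -> degreewise_fg (stalk M).
Proof. by move=> Mf [[|k]|k] //; apply: rV_fg. Qed.

Lemma quot_fg (n : idealr S) : finitely_generated {ideal_quot n}.
Proof.
apply/finitely_generatedP; exists 1%N, (fun=> 1) => q.
exists (const_mx (repr q)); rewrite /= /row_comb big_ord1 mxE.
by rewrite -[LHS]reprK -[RHS]/(quot_scale _ _) /quot_scale mulr1.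
Qed.

Lemma ideal_quot0 (I : idealr S) a : \pi_({ideal_quot I}) a = 0 <-> a \in I.
Proof.
rewrite -[X in X \in I]subr0 Quotient.idealrBE.
have p0 : \pi_({ideal_quot I}) 0 = 0 by apply: rmorph0.
by split=> [e|/eqP ->]; [apply/eqP; rewrite e p0|].
Qed.

End Stalks.

Section DegreeZero.
Variables (R : comNzRingType) (A B : complex R) (f : {linear A 0 -> B 0}).
Hypotheses (A0 : forall i (v : A i), i != 0 -> v = 0).
Hypotheses (B0 : forall i (v : B i), i != 0 -> v = 0).

Let fam i : {linear A i -> B i} :=
  match i as i return {linear A i -> B i} with Posz 0 => f | _ => lzero _ _ end.

Let fam_comm i j v : fam j (diff A i j v) = diff B i j (fam i v).
Proof.
have [i0|i0] := eqVneq i 0; last by rewrite (A0 v i0) !linear0.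
have [j0|j0] := eqVneq j 0; last by rewrite (A0 (diff A i j v) j0) [RHS]B0
  ?linear0.
by rewrite !diff_shape ?linear0 //; lia.
Qed.

Definition degree0_map : chain_map A B := ChainMap fam_comm.

Lemma degree0_mapE v : degree0_map 0 v = f v.
Proof. by []. Qed.

Lemma degree0_quasi_iso : injective f -> (forall w, exists v, f v = w) ->
  quasi_iso degree0_map.
Proof.
move=> fI fS i; have [->|i0] := eqVneq i 0; last first.
  split=> [v _ _|w _]; first by rewrite (A0 v i0); apply: boundary0.
  exists 0; first by rewrite /cycle linear0.
  by rewrite (B0 w i0) linear0 subrr; apply: boundary0.
split=> [v _ [w]|w _].
  rewrite (B0 w) // linear0 degree0_mapE => /eqP;
    rewrite raddf_eq0 // => /eqP ->.
  exact: boundary0.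
have [v <-] := fS w; exists v; last by rewrite degree0_mapE subrr;
  apply: boundary0.
by rewrite /cycle; apply: A0.
Qed.

End DegreeZero.

Section Comparison.
Variables (R S : comNzRingType) (pi : {rmorphism R -> S}) (x : R).
Hypotheses (pi_surj : forall s, exists r, pi r = s).
Hypotheses (x_reg : GRing.lreg x) (pi_ker : forall a, pi a = 0 <-> exists r,
  a = x * r).
Variable G : mcomplex S.
Hypothesis G0 : bounded_below G 0.
Notation F := (mlift pi_surj x_reg pi_ker G).
Notation ER N n := (homvan (complex_of F) N n).
Notation ES N n := (homvan (complex_of G) N n).

Let ses_G := lift_ses pi_surj x_reg pi_ker G.
Let F_proj i : projective_module (complex_of F i).
Proof. exact: complex_of_proj. Qed.
Let F_kproj : K_projective (complex_of F) := complex_of_kproj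
  (lift_bounded_below pi_surj x_reg pi_ker G0).

Lemma homvan_res N n : ES N n -> ES N (n + 1) -> ER (res_complex pi N) n.
Proof.
move=> e0 e1; apply/(homvan_reduce pi_surj); apply: (homvan_mid_contra ses_G)
  e1 e0.
by move=> i j k u ji; apply: lift_extend.
Qed.

Lemma homvan_of_res N n : bounded_above N ->
  (forall k, n <= k -> ER (res_complex pi N) k) -> ES N n.
Proof.
move=> [a Na] van.
(* Descending induction from the degrees above [a], where [homvan_above] applies. The connecting map
   has degree 2, so degree [k] is reached from [k + 2]. *)
have step d : forall k, n <= k -> a - k < d%:Z -> ES N k.
  elim: d => [|d IHd] k nk kd.
    apply: (homvan_above (a := a)) => //; last by lia.
      exact: complex_of_kproj G0.
    by move=> i v i0; apply: rV0_eq0; apply: G0.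
  apply: (homvan_right_contra ses_G).
  - by move=> i j l u ji; apply: lift_extend.
  - by apply/(homvan_reduce pi_surj)/van.
  - by apply: IHd; lia.
by apply: (step (`|a - n| + 1)%N) => //; lia.
Qed.

Variables (kR : lmodType R) (aug : chain_map (complex_of F) (stalk kR)).
Hypotheses (aug_q : quasi_iso aug) (x_kR : forall v : kR, x *: v = 0).

(** Multiplication by [x] on the resolution becomes zero after [aug], because [x] kills the residue
    field; [kproj_null] then contracts it. *)
Lemma scale_null : is_null 0 (scale_hmap x (complex_of F)).
Proof.
apply: (kproj_null F_kproj aug_q).
  move=> i j i' j' v ji ii jj; have -> : j' = i' by lia.
  have -> : j = i by lia.
  by rewrite !scale_hmapE linearZ.
exists (fun i j => lzero _ _) => i j i' j' v ji _ _.
have {ji}-> : j = i by lia.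
rewrite linear0 addr0; change (aug i (scale_hmap x (complex_of F) i i v) = 0).
rewrite scale_hmapE linearZ /=.
have [i0|i0] := eqVneq i 0; last exact: stalk_zero i0.
by move: v; rewrite i0 => v; apply: x_kR.
Qed.

(** By linearity [x f = f x], so [f] is composed with a contraction of [x]. The degrees [n + 0] and
    [j - 0] are those of [homvan_left] for [e = 0]. *)
Lemma scale_null_comp N n (f : hmap (complex_of F) N) : is_chain n f ->
  is_null (n + 0) (fun i j => lcomp (scale_hmap x N (j - 0) j) (f i (j - 0))).
Proof.
move=> fc; have [h hE] := scale_null.
exists (fun i j => lcomp (f (j - n) j) (h i (j - n))).
move=> i j i' j' v ji ii jj; rewrite subr0 addr0 in ji *.
have e := hE i i i' (i + 1) v (esym (addr0 i)) ii erefl.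
rewrite /= castxx -linearZ.
rewrite scale_hmapE in e; rewrite e linearD /=.
have e1 : j - n = i by lia.
have e2 : j' - n = i + 1 by lia.
by rewrite e1 e2 (fc (i + 1) j' i j) //; lia.
Qed.

Section ShortExactSequence.
Variables (V : complex R) (V' : complex S) (c : chain_map V (res_complex pi
  V')).
Hypothesis V_ses : ses 0 (scale_hmap x V) c.

Lemma homvan_of_reduction n : ER (res_complex pi V') (n + 1) -> ER V n.
Proof.
move=> van f fc; apply: (homvan_left V_ses) => //; first exact: scale_null_comp.
by rewrite addr0.
Qed.

Lemma homvan_reduction n : ER V n -> ER V (n - 1) -> ER (res_complex pi V') n.
Proof.
by move=> v0 v1; apply: (homvan_right V_ses) => //; rewrite subr0.
Qed.

End ShortExactSequence.
End Comparison.

Section Bounded.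
Variable S : comNzRingType.
Implicit Types X Y A B C : complex S.

Lemma bounded_below_homology X : bounded_homology X ->
  exists a, forall i, i < a -> homology_zero X i.
Proof. by move=> [n Xn]; exists (- n%:Z) => i ni; apply: Xn; lia. Qed.

Lemma bounded_quasi_iso X Y (f : chain_map X Y) : quasi_iso f ->
  bounded_homology X <-> bounded_homology Y.
Proof.
by move=> fq; split=> -[n Xn]; exists n => i ni;
  apply/(homology_zero_quasi_iso i fq)/Xn.
Qed.

Lemma bounded_mid A B C e (a : hmap A B) (c : chain_map B C) : ses e a c ->
  bounded_homology A -> bounded_homology C -> bounded_homology B.
Proof.
move=> abc [p Ap] [q Cq]; exists (p + q + `|e|)%N => i ni.
apply: (homology_zero_mid abc (k := i - e)); [lia|apply: Ap; lia|apply: Cq;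
  lia].
Qed.

Lemma bounded_right A B C e (a : hmap A B) (c : chain_map B C) : ses e a c ->
  bounded_homology A -> bounded_homology B -> bounded_homology C.
Proof.
move=> abc [p Ap] [q Bq]; exists (p + q + `|e| + 1)%N => i ni.
by apply: (homology_zero_right abc (k := i - 1 - e)); [lia|apply: Bq;
  lia|apply: Ap; lia].
Qed.

Lemma bilinear_scaler (U V M : lmodType S) (b : U -> V -> M) a u v :
  is_bilinear b -> b u (a *: v) = a *: b u v.
Proof. by move=> [bR _]; exact: (linearZ_LR (lin (bR u))). Qed.

End Bounded.

Lemma derived_tensor_intro (S : comNzRingType) (X Y Z P : complex S) (f :
  chain_map P X) t :
  projective_resolution f -> @tensor_of S P Y Z t -> is_derived_tensor X Y Z.
Proof. by move=> fr ht; exists P, f; split=> //; exists t. Qed.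

(** * Depth inequalities between R and S, and the two implications *)

Section ChangeOfRings.
Variables (R S : comNzRingType) (pi : {rmorphism R -> S}) (x : R).
Hypotheses (pi_surj : forall s, exists r, pi r = s).
Hypotheses (x_reg : GRing.lreg x) (pi_ker : forall a, pi a = 0 <-> exists r,
  a = x * r).
Variables (m : idealr R) (n : idealr S).
Hypothesis m_n : forall a, a \in m <-> pi a \in n.
Hypotheses (nR : noetherian R) (nS : noetherian S).

Let residue_map : exists f : {linear res pi {ideal_quot n} ->
  ({ideal_quot m} : lmodType R)},
  injective f /\ forall w, exists v, f v = w.
Proof.
have p_lin : linear (fun a : R^o => \pi_({ideal_quot n}) (pi a) : res pi
  {ideal_quot n}).
  by move=> a u v; rewrite rmorphD rmorphM rmorphD rmorphM.
have q_lin : linear (fun a : R^o => \pi_({ideal_quot m}) a : {ideal_quot m}).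
  by move=> a u v; rewrite rmorphD rmorphM.
have p_surj w : exists a, lin p_lin a = w.
  by have [a aE] := pi_surj (repr w); exists a; rewrite /= aE reprK.
have [|f fE] := @factor_surjective _ _ _ _ (lin p_lin) (lin q_lin) p_surj.
  by move=> a /ideal_quot0 h; apply/ideal_quot0/m_n.
exists f; split=> [|w]; last by exists (lin p_lin (repr w));
  apply: etrans (fE (repr w)) (reprK w).
apply: raddf_inj => v; have [a <-] := p_surj v => fa.
have /ideal_quot0/m_n h : \pi_({ideal_quot m}) a = 0 := etrans (esym (fE a)) fa.
exact/ideal_quot0.
Qed.

Let G_exists := projective_resolution_exists nS (stalk_fg (quot_fg n))
  (fun i (i0 : i < 0) => stalk_homology_zero (M := {ideal_quot n}) (ltr0_neq0
    i0)).
Let G := sval (cid G_exists).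
Let G0 : bounded_below G 0 := (svalP (cid G_exists)).1.
Let eps := sval (cid (svalP (cid G_exists)).2).
Let eps_q : quasi_iso eps := svalP (cid (svalP (cid G_exists)).2).
Let F := mlift pi_surj x_reg pi_ker G.
Let G_kproj : K_projective (complex_of G) := complex_of_kproj G0.
Let F_kproj : K_projective (complex_of F) :=
  complex_of_kproj (lift_bounded_below pi_surj x_reg pi_ker G0).

Let aug_exists : exists f : chain_map (complex_of F) (stalk {ideal_quot m}),
  quasi_iso f.
Proof.
have [f [fI fS]] := residue_map.
have z1 i (v : res_complex pi (stalk {ideal_quot n}) i) : i != 0 -> v = 0.
  exact: stalk_zero.
pose g := @degree0_map R (res_complex pi (stalk {ideal_quot n})) (stalk
  {ideal_quot m}) f
  z1 (@stalk_zero R {ideal_quot m}).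
exists (comp_map g (comp_map (res_map pi eps) (lift_map pi_surj x_reg pi_ker
  G))).
apply: quasi_iso_comp; first exact: degree0_quasi_iso.
apply: quasi_iso_comp; first exact: res_quasi_iso.
exact: lift_quasi_iso.
Qed.
Let aug := sval (cid aug_exists).
Let aug_q : quasi_iso aug := svalP (cid aug_exists).

Let x_residue (v : {ideal_quot m}) : x *: v = 0.
Proof.
have xm : x \in m.
  apply/m_n; have -> : pi x = 0 by apply/pi_ker; exists 1; rewrite mulr1.
  exact: idealr0.
change (\pi_({ideal_quot m}) x * v = 0).
by have /ideal_quot0 -> := xm; rewrite mul0r.
Qed.

Notation ER N n := (homvan (complex_of F) N n).
Notation ES N n := (homvan (complex_of G) N n).
Notation dR := (depth m).
Notation dS := (depth n).

Let dR_le X i : bounded_above X -> ~ ER X (- i) -> (dR X <= i%:E)%E.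
Proof. exact: (depth_le_nonvanishing F_kproj aug_q). Qed.
Let dS_le X i : bounded_above X -> ~ ES X (- i) -> (dS X <= i%:E)%E.
Proof. exact: (depth_le_nonvanishing G_kproj eps_q). Qed.
Let le_dR X e : (forall i, ~ ER X (- i) -> (e <= i%:E)%E) -> (e <= dR X)%E.
Proof. exact: (le_depth F_kproj aug_q). Qed.
Let le_dS X e : (forall i, ~ ES X (- i) -> (e <= i%:E)%E) -> (e <= dS X)%E.
Proof. exact: (le_depth G_kproj eps_q). Qed.

(** This half of the equality of depths is the one that needs the descent. *)
Lemma depth_res_le Y : bounded_above Y -> (dR (res_complex pi Y) <= dS Y)%E.
Proof.
move=> Ya; apply: le_dS => i nv.
have [k [ik nvk]] : exists k, - i <= k /\ ~ ER (res_complex pi Y) k.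
  apply: contrapT => none; apply: nv; apply: (@homvan_of_res R S pi x pi_surj
    x_reg pi_ker G G0) => // k ik.
  by apply: contrapT => nvk; apply: none; exists k.
rewrite -[k]opprK in nvk; apply: le_trans (dR_le (Ya : bounded_above
  (res_complex pi Y)) nvk) _.
by rewrite lee_fin; lia.
Qed.

Let shift_le (d : \bar int) i k : (d <= k%:E)%E -> k < i ->
  (d + 1%:E <= i%:E)%E.
Proof.
move=> dk ki; apply: le_trans (leeD2r _ dk) _.
by rewrite -EFinD lee_fin; lia.
Qed.

(** [W] is built from two copies of [Z] and the reduction of [F] from two copies of [G], each pair
    one degree apart. Together they reach the degrees from [k - 1] to [k + 1], and the worst one
    costs a unit. *)
Lemma depth_tensor_le Z W : bounded_above Z ->
  (forall k, ES Z k -> ES Z (k + 1) -> ES Z (k - 1) -> ER W k) ->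
    (dS Z <= dR W + 1%:E)%E.
Proof.
move=> Za van; rewrite -leeBlDr //; apply: le_dR => i nv.
rewrite leeBlDr //.
have [k [ki nvk]] : exists k, k <= i + 1 /\ ~ ES Z (- k).
  apply: contrapT => none; apply: nv; apply: van; apply: contrapT => nvk;
    apply: none.
  - by exists i; split=> //; lia.
  - by exists (i - 1); split; [lia|rewrite opprB addrC].
  - by exists (i + 1); split=> //; rewrite opprD.
by apply: le_trans (dS_le Za nvk) _; rewrite -EFinD lee_fin.
Qed.

Section Reduction.
Variables (V : complex R) (V' : complex S) (c : chain_map V (res_complex pi
  V')).
Hypothesis V_ses : ses 0 (scale_hmap x V) c.
Hypothesis V'_above : bounded_above V'.
(** [V] stands for a replacement of [X] on which [x] is injective. Only vanishing degrees are
    compared, so [V] and [X] may be linked by a zigzag. *)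
Variable X : complex R.
Hypothesis VX : forall i, ER V i <-> ER X i.

(** Every map to [V] is null after multiplication by [x], so it comes from [V'] through the
    connecting map, one degree up. The two copies of [G] in the reduction of [F] then leave [i - 1]
    and [i - 2]. *)
Lemma depth_reduction_lt : (dS V' + 1%:E <= dR X)%E.
Proof.
apply: le_dR => i nv.
have [k [ki nvk]] : exists k, k < i /\ ~ ES V' (- k).
  apply: contrapT => none; apply: nv; apply/VX.
  apply: (homvan_of_reduction G0 aug_q x_residue V_ses).
  apply: homvan_res; apply: contrapT => nvk; apply: none.
  - by exists (i - 1); split; [lia|rewrite opprB addrC].
  - exists (i - 2); split; first lia.
    by move=> h; apply: nvk; have -> : - i + 1 + 1 = - (i - 2) by lia.
exact: shift_le (dS_le V'_above nvk) ki.
Qed.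

(** After descent, a nonvanishing degree [k] for [V'] over [R] comes from degree [k] or [k - 1] for
    [V]; the second possibility costs the unit. *)
Lemma depth_le_reduction : bounded_above X -> (dR X <= dS V' + 1%:E)%E.
Proof.
move=> Xa; rewrite -leeBlDr //; apply: le_dS => i nv; rewrite leeBlDr //.
have [k [ik nvk]] : exists k, k <= i + 1 /\ ~ ER V (- k).
  apply: contrapT => none; apply: nv; apply: (@homvan_of_res R S pi x pi_surj
    x_reg pi_ker G G0) => // k ik.
  apply: (homvan_reduction V_ses); apply: contrapT => nvk; apply: none.
    by exists (- k); rewrite opprK; split=> //; lia.
  by exists (1 - k); rewrite opprB; split=> //; lia.
have {}nvk : ~ ER X (- k) by move/VX.
by apply: le_trans (dR_le Xa nvk) _; rewrite -EFinD lee_fin.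
Qed.

End Reduction.

Let ring_ses : exists c : chain_map (stalk R^o) (res_complex pi (stalk S^o)),
  ses 0 (scale_hmap x (stalk R^o)) c.
Proof.
have p_lin : linear (fun a : R^o => pi a : res pi S^o).
  by move=> a u v; rewrite rmorphD rmorphM.
have z1 i (v : res_complex pi (stalk S^o) i) : i != 0 ->
  v = 0 by apply: stalk_zero.
exists (@degree0_map R (stalk R^o) (res_complex pi (stalk S^o)) (lin p_lin)
  (@stalk_zero R R^o) z1).
split=> [i j i' j' v ji ii jj|i j v ji|i j w ji|i w].
- have -> : j' = i' by lia.
  have -> : j = i by lia.
  by rewrite !scale_hmapE linearZ.
- move: ji; rewrite addr0 => ->; rewrite scale_hmapE.
  have [i0|i0] := eqVneq i 0; last by rewrite (stalk_zero v i0).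
  move: v; rewrite i0 => v xv; apply: x_reg; rewrite mulr0; exact: xv.
- move: w; rewrite ji addr0 => w.
  have [i0|i0] := eqVneq i 0; last first.
    by rewrite (stalk_zero w i0) linear0; split=> // _; exists 0;
      rewrite linear0.
  move: w; rewrite i0 => w; rewrite degree0_mapE;
    split=> [/pi_ker[r rE]|[v <-]].
    by exists r; rewrite scale_hmapE rE.
  by apply/pi_ker; exists v; rewrite scale_hmapE.
- have [i0|i0] := eqVneq i 0; last by exists 0; rewrite linear0; apply/esym/z1.
  by move: w; rewrite i0 => w; have [a aE] := pi_surj w; exists a.
Qed.

Definition rdep_for (T : comNzRingType) (p : idealr T) :=
  forall X Y Z : complex T,
  degreewise_fg X -> degreewise_fg Y -> is_derived_tensor X Y Z ->
  bounded_homology X -> bounded_homology Y -> bounded_homology Z ->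
  (depth p Z + depth p (stalk T^o) <= depth p X + depth p Y)%E.

Theorem rdep_quotient : rdep_for m -> rdep_for n.
Proof.
move=> rdepR X Y Z Xf Yf [P [f [[fq Pk Pp] [tZ hZ]]]] Xb Yb Zb.
have [b Yb'] := bounded_below_homology Yb.
have [GY [GYb [g gq]]] := projective_resolution_exists nS Yf Yb'.
pose Q := mlift pi_surj x_reg pi_ker GY; pose Qr := reduce pi Q.
have Qb : bounded_below Q b := lift_bounded_below pi_surj x_reg pi_ker GYb.
have Qk : K_projective (complex_of Q) := complex_of_kproj Qb.
have Qrk : K_projective (complex_of Qr) by apply: (complex_of_kproj (a :=
  b)) => i /Qb.
(* [W] computes the derived tensor product of [Y] and [X] over [R]. It is exchanged for [T], with
   [P] in place of [X], since tensoring [lift_ses] with the projective terms of [P] is exact and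
   exhibits [T] as an extension of copies of [V], a model of [Z]. *)
have [W [tW hW]] := tensor_exists (complex_of Qr) X.
have [T [tT hT]] := tensor_exists (complex_of Qr) P.
have [U UE] := tensor_map f hT hW.
have Uq : quasi_iso U := tensor_quasi_iso Qrk fq hT hW UE.
have [tT' hT'] := tensor_swap hT.
have [V [tV hV]] := tensor_exists P (complex_of GY).
have [u uE] := tensor_map g hV hZ.
have uq : quasi_iso u := tensor_quasi_iso Pk gq hV hZ uE.
have [a aE] := tensor_hmap hV hT' 1 (lift_incl pi_surj x_reg pi_ker GY).
have [c cE] := tensor_map (lift_proj pi_surj x_reg pi_ker GY) hT' hV.
have acs : ses 1 a c := tensor_ses hV hT' hV Pp (lift_ses pi_surj x_reg pi_ker
  GY) aE cE.
have Vb : bounded_homology V by apply/(bounded_quasi_iso uq).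
have Wb : bounded_homology W by apply/(bounded_quasi_iso Uq)/(bounded_mid acs).
have hWR := tensor_res pi_surj pi_ker hW.
have qres : quasi_iso (comp_map (res_map pi g) (lift_map pi_surj x_reg pi_ker
  GY)).
  by apply: quasi_iso_comp; [apply: res_quasi_iso|apply: lift_quasi_iso].
have der : is_derived_tensor (res_complex pi Y) (res_complex pi X) (res_complex
  pi W).
  apply: (derived_tensor_intro _ hWR (f := comp_map (res_map pi g) (lift_map
    pi_surj x_reg pi_ker GY))).
  by split=> // i; apply: complex_of_proj.
have main := rdepR _ _ _ (res_fg pi_surj Yf) (res_fg pi_surj Xf) der Yb Xb Wb.
have leY := depth_res_le (bounded_homology_above Yb);
  have leX := depth_res_le (bounded_homology_above Xb).
have leZ : (dS Z <= dR (res_complex pi W) + 1%:E)%E.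
  apply: depth_tensor_le => [|k e0 e1 e2]; first exact: bounded_homology_above.
  apply/(homvan_kproj k F_kproj (res_quasi_iso pi Uq)).
  have VZ l := homvan_kproj l F_kproj (res_quasi_iso pi uq).
  apply: (homvan_mid (res_ses pi acs)) => [i||]; first exact: complex_of_proj.
    by apply/VZ/homvan_res; rewrite ?subrK.
  by apply/VZ/homvan_res.
have [c0 c0s] := ring_ses.
have leR := depth_reduction_lt c0s (bounded_homology_above (stalk_bounded S^o))
  (fun i => iff_refl _).
(* The unit lost between [Z] and [W] is paid for by the depth of [S], which is at least one below
   that of [R]. *)
apply: le_trans (leeD2r _ leZ) _; rewrite -addeA [X in (_ + X)%E]addeC.
apply: le_trans (leeD2l _ leR) _; apply: le_trans main _.
by rewrite addeC; apply: leeD.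
Qed.

Theorem rdep_of_quotient : rdep_for n -> rdep_for m.
Proof.
move=> rdepS X Y Z Xf Yf [P [f [[fq Pk Pp] [tZ hZ]]]] Xb Yb Zb.
have [bX Xb'] := bounded_below_homology Xb; have [bY Yb'] :=
  bounded_below_homology Yb.
have [QX [QXb [gX gXq]]] := projective_resolution_exists nR Xf Xb'.
have [QY [QYb [gY gYq]]] := projective_resolution_exists nR Yf Yb'.
have QYk : K_projective (complex_of QY) := complex_of_kproj QYb.
pose X' := complex_of (reduce pi QX); pose Y' := complex_of (reduce pi QY).
have [V [tV hV]] := tensor_exists (complex_of QX) (complex_of QY).
(* [V] and [Z] are linked through [P] tensored with [QY] and [QY] tensored with [X], replacing one
   factor at a time. *)
have [T1 [tT1 hT1]] := tensor_exists P (complex_of QY).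
have [T2 [tT2 hT2]] := tensor_exists (complex_of QY) X.
have [U1 U1E] := tensor_map gY hT1 hZ.
have U1q : quasi_iso U1 := tensor_quasi_iso Pk gYq hT1 hZ U1E.
have [tT1' hT1'] := tensor_swap hT1; have [tV' hV'] := tensor_swap hV.
have [U2 U2E] := tensor_map f hT1' hT2.
have U2q : quasi_iso U2 := tensor_quasi_iso QYk fq hT1' hT2 U2E.
have [U3 U3E] := tensor_map gX hV' hT2.
have U3q : quasi_iso U3 := tensor_quasi_iso QYk gXq hV' hT2 U3E.
have VZ i : ER V i <-> ER Z i.
  have e1 := homvan_kproj i F_kproj U1q; have e2 := homvan_kproj i F_kproj U2q.
  have e3 := homvan_kproj i F_kproj U3q.
  by split=> [/e3/e2/e1|/e1/e2/e3].
have Vb : bounded_homology V.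
  by apply/(bounded_quasi_iso U3q)/(bounded_quasi_iso U2q)/(bounded_quasi_iso
    U1q).
have [Z' [tZ' hZ']] := tensor_exists X' Y'.
have hZR := tensor_res pi_surj pi_ker hZ'.
have sX := reduce_ses pi_surj x_reg pi_ker QX;
  have sY := reduce_ses pi_surj x_reg pi_ker QY.
have [c cE] := tensor_map (reduce_map pi QY) hV hZR.
have aE : tensor_hmap_spec tV tV 0 (scale_hmap x (complex_of QY)) (scale_hmap x
  V).
  move=> i j l k p q y ijl; rewrite !addr0 => -> ->; rewrite !scale_hmapE.
  by have [bV _ _] := hV; rewrite (bilinear_scaler _ _ _ (bV _ _ _ _)).
(* The sequence of [QY] modulo [x], tensored with [QX], shows that [Z'] is the reduction of [V]. *)
have sV : ses 0 (scale_hmap x V) c.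
  by apply: (tensor_ses hV hV hZR _ sY aE cE) => i; apply: complex_of_proj.
have Z'b : bounded_homology Z' := bounded_right sV Vb Vb.
have QXh : bounded_homology (complex_of QX) by apply/(bounded_quasi_iso gXq).
have QYh : bounded_homology (complex_of QY) by apply/(bounded_quasi_iso gYq).
have X'b : bounded_homology X' := bounded_right sX QXh QXh.
have Y'b : bounded_homology Y' := bounded_right sY QYh QYh.
have der : is_derived_tensor X' Y' Z'.
  apply: (derived_tensor_intro _ hZ' (f := id_map X')); split.
  - exact: quasi_iso_id.
  - by apply: (complex_of_kproj (a := bX)) => i /QXb.
  - by move=> i; apply: complex_of_proj.
have main := rdepS _ _ _ (@complex_of_fg S _) (@complex_of_fg S _) der X'b Y'b
  Z'b.
have leZ := depth_le_reduction sV (bounded_homology_above Z'b) VZ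
  (bounded_homology_above Zb).
have [c0 c0s] := ring_ses.
have leR := depth_le_reduction c0s (bounded_homology_above (stalk_bounded S^o))
  (fun i => iff_refl _)
  (bounded_homology_above (stalk_bounded R^o)).
have leX := depth_reduction_lt sX (bounded_homology_above X'b) (fun i =>
  homvan_kproj i F_kproj gXq).
have leY := depth_reduction_lt sY (bounded_homology_above Y'b) (fun i =>
  homvan_kproj i F_kproj gYq).
(* Passing to [S] costs two units on the left, for [Z] and [R], and leaves two on the right, for [X]
   and [Y]. *)
apply: le_trans (leeD leZ leR) _; apply: le_trans (leeD leX leY).
by rewrite addeACA [X in (_ <= X)%E]addeACA; apply: leeD2r.
Qed.

End ChangeOfRings.

(** * Ideals of a quotient ring *)

Section IdealCorrespondence.
Variables (R S : comNzRingType) (pi : {rmorphism R -> S}).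
Hypothesis pi_surj : forall s, exists r, pi r = s.

Lemma preimage_idealr (J : idealr S) : exists I : idealr R, forall a,
  (a \in I) = (pi a \in J).
Proof.
pose p : {pred R} := fun a => pi a \in J.
have pI : idealr_closed p.
  split; rewrite /in_mem /= /p ?rmorph0 ?rmorph1 ?idealr0 ?idealr1 // =>
    a u v uJ vJ.
  by rewrite rmorphD rmorphM rpredD ?idealMr.
pose I : idealr R := HB.pack p (isIdealr.Build R p pI).
by exists I.
Qed.

Lemma image_idealr (I : idealr R) : (forall a, pi a = 0 -> a \in I) ->
  exists J : idealr S, forall a, (pi a \in J) = (a \in I).
Proof.
move=> kerI; pose p : {pred S} := fun s => `[< exists2 a, a \in I & pi a = s >].
have pE a : (pi a \in p) = (a \in I).
  apply/asboolP/idP => [[b bI ab]|aI]; last by exists a.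
  by rewrite -[a](subrK b) rpredD // kerI // rmorphB ab subrr.
have pI : idealr_closed p.
  split; first by rewrite -(rmorph0 pi) pE idealr0.
    by rewrite -(rmorph1 pi) pE idealr1.
  move=> a u v; have [a' <-] := pi_surj a; have [u' <-] := pi_surj u.
  have [v' <-] := pi_surj v; rewrite !pE => uI vI.
  by rewrite -rmorphM -rmorphD pE rpredD ?idealMr.
pose J : idealr S := HB.pack p (isIdealr.Build S p pI).
by exists J.
Qed.

Lemma noetherian_image : noetherian R -> noetherian S.
Proof.
move=> nR J; have [I IE] := preimage_idealr J; have [s sE] := nR I.
exists [seq pi a | a <- s] => b; have [a <-] := pi_surj b; rewrite -IE sE.
have szE : size [seq pi a | a <- s] = size s by rewrite size_map.
split=> [[c ->]|[c cE]].
  exists (fun k => pi (c (cast_ord szE k))); rewrite rmorph_sum (reindex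
    (cast_ord szE)) /=.
    by apply: eq_bigr => k _; rewrite rmorphM (nth_map 0) // -szE.
  by exists (cast_ord (esym szE)) => k _; rewrite ?cast_ordK ?cast_ordKV.
apply/sE; rewrite IE cE; apply: rpred_sum => k _; apply: idealMr.
rewrite (nth_map 0) -?szE // -IE; apply/sE.
have ks : (k < size s)%N by rewrite -szE.
exists (fun l => (l == Ordinal ks)%:R).
rewrite (bigD1 (Ordinal ks)) //= eqxx mul1r big1 ?addr0 // => l /negbTE ->.
by rewrite mul0r.
Qed.

Lemma preimage_maximal (J : idealr S) (I : idealr R) :
  (forall a, (a \in I) = (pi a \in J)) -> maximal_ideal J -> maximal_ideal I.
Proof.
move=> IE Jm K IK a aK; have [|K' K'E] := @image_idealr K.
  by move=> b b0; apply: IK; rewrite IE b0 idealr0.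
rewrite IE; apply: (Jm K') => [s sJ|]; last by rewrite K'E.
by have [b bE] := pi_surj s; rewrite -bE K'E IK // IE bE.
Qed.

(** The preimage of [n] is a maximal ideal, and [m] is the only one. *)
Lemma local_preimage (m : idealr R) (n : idealr S) :
  local_ring m -> local_ring n -> forall a, a \in m <-> pi a \in n.
Proof.
move=> [_ mU] [nM _]; have [I IE] := preimage_idealr n.
by move=> a; rewrite -(mU I (preimage_maximal IE nM)) IE.
Qed.

Lemma local_image (m : idealr R) : (forall a, pi a = 0 -> a \in m) ->
  local_ring m ->
  exists2 n : idealr S, local_ring n & forall a, a \in m <-> pi a \in n.
Proof.
move=> kerm [mM mU]; have [n nE] := image_idealr kerm.
exists n; last by move=> a; rewrite nE.
split=> [K nK s sK|n' n'M s].
  have [I IE] := preimage_idealr K; have [a aE] := pi_surj s.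
  rewrite -aE nE; apply: (mM I); last by rewrite IE aE.
  by move=> b bm; rewrite IE nK // nE.
have [I IE] := preimage_idealr n'; have [a <-] := pi_surj s.
by rewrite nE -IE; apply: mU; apply: preimage_maximal n'M.
Qed.

End IdealCorrespondence.

Theorem proposition5p2 (R : comNzRingType) (m : idealr R) (x : R)
  (R_noetherian : noetherian R) (R_local : local_ring m)
  (xm : x \in m) (x_regular : GRing.lreg x) :
  derived_rdep R <-> derived_rdep {ideal_quot (principal_ideal xm)}.
Proof.
pose S : comNzRingType := {ideal_quot (principal_ideal xm)}.
pose pi : {rmorphism R -> S} := \pi_({ideal_quot (principal_ideal xm)}).
have pi_surj s : exists r, pi r = s by exists (repr s); apply: reprK.
have pi_ker a : pi a = 0 <-> exists r, a = x * r.
  split=> [/ideal_quot0/asboolP[r ->]|[r ->]]; first by exists r; rewrite mulrC.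
  by apply/ideal_quot0/asboolP; exists r; rewrite mulrC.
have kerm a : pi a = 0 -> a \in m by move=> /pi_ker[r ->];
  rewrite mulrC idealMr.
have S_noetherian : noetherian S := noetherian_image pi_surj R_noetherian.
split=> [[_ [m' m'_local rdepR]]|[_ [n n_local rdepS]]].
  (* The maximal ideal [m'] provided by [derived_rdep] is another predicate than [m], with the same
     elements. *)
  have kerm' a : pi a = 0 -> a \in m'.
    by move=> a0; case: R_local => mM _; case: m'_local => _ /(_ m mM) <-;
      apply: kerm.
  have [n n_local m_n] := local_image pi_surj kerm' m'_local.
  split=> //; exists n => //.
  exact: (rdep_quotient pi_surj x_regular pi_ker m_n S_noetherian rdepR).
split=> //; exists m => //.
have m_n := local_preimage pi_surj R_local n_local.
exact: (rdep_of_quotient pi_surj x_regular pi_ker m_n R_noetherian S_noetherian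
  rdepS).
Qed.
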